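(* Let $n\ge1$, $1<p<\infty$, $0<s<1$ and $0\le\alpha<\min\{Q-2,\,p(1-s)\}$ be such that $sp+\alpha>1$. Then $$\mathcal{C}_{s,p,\alpha}(\mathbb{H}^n_+)=C_{n,s,p,\alpha}\,\Lambda_{s,p,\alpha},$$ where $\mathcal{C}_{s,p,\alpha}(\mathbb{H}^n_+)$ is the sharp Hardy constant $$\mathcal{C}_{s,p,\alpha}(\mathbb{H}^n_+)=\inf_{f\in C_c^\infty(\mathbb{H}^n_+)}\left\{\int_{\mathbb{H}^n}\int_{\mathbb{H}^n}\frac{|f(\xi)-f(\xi')|^p}{d(\xi^{-1}\circ\xi')^{Q+sp}|z-z'|^{\alpha}}\,d\xi'\,d\xi \;:\; \int_{\mathbb{H}^n_+}\frac{|f(\xi)|^p}{x_1^{sp+\alpha}}\,d\xi=1\right\},$$ $$C_{n,s,p,\alpha}=2\,|S_{2n-2}|\,\mathcal{I}(Q-2,sp,\alpha),$$ and $$\Lambda_{s,p,\alpha}=2\int_0^1\frac{\left|1-\tau^{\frac{sp+\alpha-1}{p}}\right|^p}{(1-\tau)^{1+sp+\alpha}}\,d\tau+\frac{2}{sp+\alpha}.$$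
   Context: The Heisenberg group $\mathbb{H}^n$ ($n\ge1$) is $\mathbb{R}^n\times\mathbb{R}^n\times\mathbb{R}$ with points $\xi=(z,t)=(x,y,t)$, $z=(x,y)$, and group law $\xi\circ\xi'=(x+x',\,y+y',\,t+t'+2\langle y,x'\rangle-2\langle x,y'\rangle)$; the inverse is $\xi^{-1}=-\xi$. The homogeneous norm is $d(\xi)=(|z|^4+t^2)^{1/4}$, and $Q=2n+2$ is the homogeneous dimension. $d\xi$ is Lebesgue measure on $\mathbb{R}^{2n+1}$. The half-space is $\mathbb{H}^n_+=\{\xi=(x,y,t)\in\mathbb{H}^n: x_1>0\}$, and functions in $C_c^\infty(\mathbb{H}^n_+)$ are extended by zero to $\mathbb{H}^n$. For an integer $k\ge2$, $\theta>0$ and $\alpha\ge0$, $$\mathcal{I}(k,\theta,\alpha)=\int_0^\infty\frac{dt}{(1+t^2)^{\frac{k+2+\theta}{4}}}\int_0^\infty\frac{r^{k-2}\,dr}{(1+r^2)^{\frac{k+\theta+\alpha}{2}}}.$$ $S_{2n-2}$ is the unit sphere in $\mathbb{R}^{2n-1}$ and $|S_{2n-2}|$ its surface measure (for $n=1$, $S_0=\{-1,1\}$ and $|S_0|=2$). *)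

(* Defs.v *)
From HB Require Import structures.
From mathcomp Require Import all_boot all_order all_algebra.
From mathcomp Require Import all_classical all_reals all_analysis.

Set Implicit Arguments.
Unset Strict Implicit.
Unset Printing Implicit Defensive.

Import Order.TTheory GRing.Theory Num.Theory.
Import numFieldNormedType.Exports.

Local Open Scope classical_set_scope.
Local Open Scope ring_scope.

(* 'rV[T]_n carries the sigma-algebra generated by the n coordinates. *)
Definition rV_display : measure_display -> measure_display.
Proof. exact. Qed.

Section measurable_rV.
Context {d} {T : measurableType d} (n : nat).

Let coord (i : 'I_n) (x : 'rV[T]_n) : T := x ord0 i.

Let rV_set0 : g_sigma_preimage coord set0.
Proof. exact: sigma_algebra0. Qed.

Let rV_setC A : g_sigma_preimage coord A -> g_sigma_preimage coord (~` A).
Proof. exact: sigma_algebraC. Qed.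

Let rV_bigcup (F : (set 'rV[T]_n)^nat) :
  (forall i, g_sigma_preimage coord (F i)) ->
  g_sigma_preimage coord (\bigcup_i F i).
Proof. exact: sigma_algebra_bigcup. Qed.

HB.instance Definition _ := @isMeasurable.Build (rV_display d)
  'rV[T]_n (g_sigma_preimage coord) rV_set0 rV_setC rV_bigcup.

End measurable_rV.

(* The library's instance for products of sigma-finite measures is not
   inferred: a later instance, for subprobabilities, shadows it. *)
Lemma product_measure1_sigma_finite d1 d2 (T1 : measurableType d1)
    (T2 : measurableType d2) (R : realType)
    (m1 : {sigma_finite_measure set T1 -> \bar R})
    (m2 : {sigma_finite_measure set T2 -> \bar R}) :
  sigma_finite setT (m1 \x m2)%E.
Proof.
have /sigma_finiteP[F [TF ndF Foo]] := sigma_finiteT m1.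
have /sigma_finiteP[G [TG ndG Goo]] := sigma_finiteT m2.
exists (fun n => F n `*` G n).
  rewrite -setXTT TF TG predeqE => -[x y]; split.
    move=> [/= [n _ Fnx] [k _ Gky]]; exists (maxn n k) => //; split.
    - by move: x Fnx; exact/subsetPset/ndF/leq_maxl.
    - by move: y Gky; exact/subsetPset/ndG/leq_maxr.
  by move=> [n _ []/= ? ?]; split; exists n.
move=> k; have [? ?] := Foo k; have [? ?] := Goo k.
split; first exact: measurableX.
by rewrite product_measure1E// lte_mul_pinfty// ge0_fin_numE.
Qed.

Section lebesgue_measure_rV.
Context {R : realType}.
Local Notation rR := (measurableTypeR R).

Lemma measurable_coord_rV n (i : 'I_n) :
  measurable_fun [set: 'rV[rR]_n] (fun x : 'rV[rR]_n => x ord0 i).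
Proof.
move=> _ Y mY; rewrite setTI; apply: sub_sigma_algebra => /=.
rewrite -bigcup_seq/=; exists i => /=; first by rewrite mem_index_enum.
by exists Y => //; rewrite setTI.
Qed.

Lemma measurable_fun_rVP d (T : measurableType d) n (f : T -> 'rV[rR]_n) :
  (forall i, measurable_fun [set: T] (fun x => f x ord0 i : rR)) ->
  measurable_fun [set: T] f.
Proof.
move=> mf.
suff H : g_sigma_preimage (fun i : 'I_n => (fun x : 'rV[rR]_n => x ord0 i) \o f)
    `<=` measurable.
  move=> _ A mA; rewrite g_sigma_preimage_comp in H.
  by apply: H; exists A.
apply: smallest_sub; first exact: sigma_algebra_measurable.
case: n => [|n] in f mf *; first by rewrite big_ord0.
rewrite -bigcup_mkord_ord; apply: bigcup_sub => i Ii.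
by move=> A [B mB <-]; exact: mf.
Qed.

Definition cons_rV n (u : rR * 'rV[rR]_n) : 'rV[rR]_n.+1 :=
  row_mx (\row_(_ < 1) u.1) u.2.

Let uncons_rV n (x : 'rV[rR]_n.+1) : rR * 'rV[rR]_n :=
  (x ord0 ord0, \row_i x ord0 (lift ord0 i)).

Lemma cons_rV0 n u : @cons_rV n u ord0 ord0 = u.1.
Proof.
rewrite /cons_rV (_ : ord0 = lshift n (ord0 : 'I_1)); last exact/val_inj.
by rewrite (@row_mxEl _ 1 1 n) mxE.
Qed.

Lemma cons_rVS n u i : @cons_rV n u ord0 (lift ord0 i) = u.2 ord0 i.
Proof.
rewrite /cons_rV (_ : lift ord0 i = rshift 1 i); last exact/val_inj.
by rewrite (@row_mxEr _ 1 1 n).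
Qed.

Lemma measurable_cons_rV n : measurable_fun [set: rR * 'rV[rR]_n] (@cons_rV n).
Proof.
apply: measurable_fun_rVP => i; case: (unliftP ord0 i) => [j|] ->.
  apply: (eq_measurable_fun (fun u : rR * 'rV[rR]_n => u.2 ord0 j)).
    by move=> u _; rewrite cons_rVS.
  exact: (measurableT_comp (measurable_coord_rV j)).
apply: (eq_measurable_fun (fun u : rR * 'rV[rR]_n => u.1)).
  by move=> u _; rewrite cons_rV0.
exact: measurable_fst.
Qed.

Let measurable_uncons_rV n : measurable_fun [set: 'rV[rR]_n.+1] (@uncons_rV n).
Proof.
apply: measurable_fun_pair; first exact: measurable_coord_rV.
apply: measurable_fun_rVP => i.
apply: (eq_measurable_fun (fun x : 'rV[rR]_n.+1 => x ord0 (lift ord0 i))).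
  by move=> x _; rewrite mxE.
exact: measurable_coord_rV.
Qed.

Let cons_rVK n : cancel (@cons_rV n) (@uncons_rV n).
Proof.
move=> [a v]; rewrite /uncons_rV cons_rV0; congr pair.
by apply/rowP => i; rewrite mxE cons_rVS.
Qed.

Section lebesgue_rV_succ.
Variables (n : nat) (m : {sigma_finite_measure set 'rV[rR]_n -> \bar R}).

Let prod_m := (@lebesgue_measure R \x m)%E.

Definition lebesgue_rV_succ : set 'rV[rR]_n.+1 -> \bar R :=
  pushforward prod_m (@cons_rV n).

HB.instance Definition _ := Measure.copy lebesgue_rV_succ
  (measure_function_pushforward__canonical__measure_function_Measure
     prod_m (@measurable_cons_rV n)).

Let lebesgue_rV_succ_sigma_finite : sigma_finite setT lebesgue_rV_succ.
Proof.
have [F FT Foo] := product_measure1_sigma_finite (@lebesgue_measure R) m.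
exists (fun k => @uncons_rV n @^-1` F k).
  by rewrite -preimage_bigcup -FT preimage_setT.
move=> k; have [mF Fk] := Foo k; split.
  by rewrite -[X in measurable X]setTI; exact: measurable_uncons_rV.
rewrite /lebesgue_rV_succ /pushforward -comp_preimage.
by rewrite (_ : _ \o _ = id)//; apply/funext => u /=; rewrite cons_rVK.
Qed.

HB.instance Definition _ := @Measure_isSigmaFinite.Build _ _ _
  lebesgue_rV_succ lebesgue_rV_succ_sigma_finite.

End lebesgue_rV_succ.

(* Lebesgue measure on R^n: the n-fold product of lebesgue_measure,
   transported along R * R^n ~ R^n.+1. *)
Fixpoint lebesgue_rV n : {sigma_finite_measure set 'rV[rR]_n -> \bar R} :=
  match n with
  | 0 => @dirac _ 'rV[rR]_0 0 R
  | n.+1 => lebesgue_rV_succ (lebesgue_rV n)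
  end.

Section lebesgue_heis.
Variable n : nat.

Definition lebesgue_z : set ('rV[rR]_n * 'rV[rR]_n)%type -> \bar R :=
  (lebesgue_rV n \x lebesgue_rV n)%E.

HB.instance Definition _ := Measure.on lebesgue_z.
HB.instance Definition _ := @Measure_isSigmaFinite.Build _ _ _ lebesgue_z
  (product_measure1_sigma_finite (lebesgue_rV n) (lebesgue_rV n)).

Definition lebesgue_heis : set ('rV[rR]_n * 'rV[rR]_n * rR)%type -> \bar R :=
  (lebesgue_z \x @lebesgue_measure R)%E.

HB.instance Definition _ := Measure.on lebesgue_heis.
HB.instance Definition _ := @Measure_isSigmaFinite.Build _ _ _ lebesgue_heis
  (product_measure1_sigma_finite lebesgue_z (@lebesgue_measure R)).

End lebesgue_heis.

End lebesgue_measure_rV.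

Arguments lebesgue_z {R} n.
Arguments lebesgue_heis {R} n.

Section euclidean.
Context {R : realType} {m : nat}.

Definition dot (x y : 'rV[R]_m) : R := \sum_i x ord0 i * y ord0 i.

Definition unit_sphere : set 'rV[R]_m := [set x | Num.sqrt (dot x x) = 1].

Definition cone (E : set 'rV[R]_m) : set 'rV[R]_m :=
  [set r *: w | r in `]0, 1] & w in E].

(* The measure sigma on the unit sphere for which dx = r^(m-1) dr dsigma, so
   that the cone over E has volume sigma(E) / m. *)
Definition surface_measure (E : set 'rV[R]_m) : \bar R :=
  (m%:R%:E * lebesgue_rV m (cone E))%E.

End euclidean.

Definition sphere_area (R : realType) (m : nat) : \bar R :=
  surface_measure (@unit_sphere R m).

Section smooth.
Context {R : realType} {V : normedModType R}.

Fixpoint class_C (k : nat) (f : V -> R) : Prop :=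
  match k with
  | 0 => continuous f
  | k.+1 => [/\ continuous f, (forall x v, derivable f x v)
             & forall v, class_C k ('D_v f)]
  end.

Definition smooth (f : V -> R) : Prop := forall k, class_C k f.

(* C_c^oo(A), every function being extended by 0 outside A. *)
Definition Cc_infty (A : set V) : set (V -> R) :=
  [set f | [/\ smooth f, compact (closure [set x | f x != 0])
             & closure [set x | f x != 0] `<=` A]].

End smooth.

Section heisenberg.
Context {R : realType} (n : nat).

Definition heis : Type := ('rV[R]_n * 'rV[R]_n * R)%type.

Implicit Types (z : 'rV[R]_n * 'rV[R]_n) (xi : heis).

Definition heis_mul xi xi' : heis :=
  (xi.1.1 + xi'.1.1, xi.1.2 + xi'.1.2,
   xi.2 + xi'.2 + 2 * dot xi.1.2 xi'.1.1 - 2 * dot xi.1.1 xi'.1.2).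

Definition heis_inv xi : heis := - xi.

Definition znorm z : R := Num.sqrt (dot z.1 z.1 + dot z.2 z.2).

Definition heis_norm xi : R :=
  (znorm xi.1 ^+ 4 + xi.2 ^+ 2) `^ (1 / 4).

Definition hom_dim : nat := (2 * n + 2)%N.

(* Where z = z' and alpha > 0 the integrand is 0 because x / 0 = 0; for every
   xi these xi' form a Lebesgue null set. *)
Definition gagliardo (s p alpha : R) (f : heis -> R) : \bar R :=
  (\int[lebesgue_heis n]_xi \int[lebesgue_heis n]_xi'
    (`|f xi - f xi'| `^ p /
     (heis_norm (heis_mul (heis_inv xi) xi') `^ (hom_dim%:R + s * p) *
      znorm (xi.1 - xi'.1) `^ alpha))%:E)%E.

End heisenberg.

Section hardy.
Context {R : realType} {n : nat} (n_gt0 : (0 < n)%N).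

Definition x1 (xi : heis n) : R := xi.1.1 ord0 (Ordinal n_gt0).

Definition half_space : set (heis n) := [set xi | 0 < x1 xi].

Definition hardy_weighted (s p alpha : R) (f : heis n -> R) : \bar R :=
  (\int[lebesgue_heis n]_(xi in half_space)
    (`|f xi| `^ p / x1 xi `^ (s * p + alpha))%:E)%E.

Definition hardy_const (s p alpha : R) : \bar R :=
  ereal_inf [set gagliardo s p alpha f | f in
    [set f | Cc_infty half_space f /\ hardy_weighted s p alpha f = 1%E]].

End hardy.

Section constants.
Context {R : realType}.
Local Open Scope ereal_scope.

Definition cal_I (k : nat) (theta alpha : R) : \bar R :=
  (\int[lebesgue_measure]_(t in `]0%R, +oo[)
    ((1 + t ^+ 2) `^ ((k%:R + 2 + theta) / 4))^-1%:E) *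
  (\int[lebesgue_measure]_(r in `]0%R, +oo[)
    (r ^+ (k - 2) / (1 + r ^+ 2) `^ ((k%:R + theta + alpha) / 2))%:E).

Definition C_const (n : nat) (s p alpha : R) : \bar R :=
  2%:E * sphere_area R (2 * n - 1) * cal_I (hom_dim n - 2) (s * p) alpha.

Definition Lambda_const (s p alpha : R) : \bar R :=
  2%:E * (\int[lebesgue_measure]_(tau in `]0%R, 1%R[)
    (`|1 - tau `^ ((s * p + alpha - 1) / p)| `^ p /
     (1 - tau) `^ (1 + s * p + alpha))%:E) +
  (2 / (s * p + alpha))%:E.

End constants.

(* Main.v *)
Require Import Defs.
From mathcomp Require Import all_boot all_order all_algebra.
From mathcomp Require Import all_classical all_reals all_analysis.
From mathcomp Require Import measurable_realfun.
From mathcomp Require Import ring lra.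

Set Implicit Arguments.
Unset Strict Implicit.
Unset Printing Implicit Defensive.

Import Order.TTheory GRing.Theory Num.Theory.
Import numFieldNormedType.Exports.

Local Open Scope classical_set_scope.
Local Open Scope ring_scope.

(** Write beta = s p + alpha and gam = (beta - 1) / p; the height of a point is
    its coordinate x_1.  Everything rests on an exact formula for the double
    integral.  The integrand is symmetric and vanishes when both heights are
    nonpositive, so one may assume height xi' < height xi and 0 < height xi, and
    then xi' has a unique form displace xi eta, that is
      xi' = xi o (- a sigma, a sigma u, a sigma y, (a sigma)^2 |(1, u, y)|^2 t),
    with a = height xi and eta = (sigma, u, y, t), sigma > 0.  Here
    height xi' = a (1 - sigma).  By homogeneity the kernel times the Jacobian
    factors into a ^ (- beta) and a function rho of eta alone (kernel_displace),
    and integral_gagliardo says that the double integral is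
      2 int rho(eta) E(eta) d eta,
      E(eta) = int |f(xi) - f(displace xi eta)|^p (height xi)^(- beta) d xi.

    Lower bound.  Composition with xi |-> displace xi eta multiplies the
    weighted L^p norm by (1 - sigma)^gam (integral_hardy_density_displace).  If
    f has norm 1, the triangle inequality gives E(eta) >=
    |1 - (1 - sigma)^gam|^p for sigma < 1, and E(eta) = 1 for sigma >= 1, where
    the displaced point has left the half-space.  Since rho is a product of
    functions of sigma, of (u, y) and of t, polar coordinates in (u, y) turn the
    integral of this bound into the product of the two constants (integral_rho,
    integral_Lambda).

    Upper bound.  The function (height xi)^gam would give equality, but it has
    infinite norm.  It is multiplied by a cutoff that varies at scale j in
    ln (height xi) and at the scales L = j e^j and L^2 in the horizontal
    coordinates and in t.  On the support the displacement has size at most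
    e^j sigma / (1 - sigma) times |(1, u, y)|, so for fixed eta the cutoff
    changes by O(1 / j), while its norm stays comparable to the mass of a box.
    Splitting the p-th power by convexity, with a parameter e, bounds E by
    (1 - e)^(1 - p) times the lower bound plus an error of order 1 / j
    (slice_energy_le).  The error is integrated after replacing a p-th power of
    a number at most 1 by a power q0 <= p.  Its integral against rho converges
    if beta < q0 < min (beta + 1, 2 n + s p), and such a q0 in [1, p] exists
    exactly because alpha < p (1 - s) and alpha < Q - 2.  Letting j tend to
    infinity and then e to 0 gives the theorem. *)

(** * Lebesgue measure on R^n and on the Heisenberg group *)

Section iterated.
Context {R : realType}.
Local Notation rR := (measurableTypeR R).
Local Notation mu := (@lebesgue_measure R).
Local Open Scope ereal_scope.

Lemma measurable_affine (a c : R) :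
  measurable_fun [set: rR] (fun x : rR => (c + a * x)%R : rR).
Proof.
apply: measurable_funD; first exact: measurable_cst.
by apply: measurable_funM => //; exact: measurable_cst.
Qed.

Lemma lebesgue_affine_gt0 (a c : R) (A : set rR) : (0 < a)%R -> measurable A ->
  mu A = a%:E * pushforward mu (fun x : rR => (c + a * x)%R : rR) A.
Proof.
move=> a0 mA.
pose m2 := mscale (NngNum (ltW a0))
  (measure_function_pushforward__canonical__measure_function_Measure
     mu (measurable_affine a c)).
apply: (@lebesgue_measure_unique R m2) => // _ [[p q]] _ <- /=.
rewrite /m2 /mscale /= /pushforward.
have -> : (fun x : rR => (c + a * x)%R : rR) @^-1` `]p, q]%classic =
  `](a^-1 * (p - c))%R, (a^-1 * (q - c))%R]%classic.
  by apply/seteqP; split => x /=; rewrite !in_itv /= ltr_pdivrMl// ler_pdivlMl// ltrBlDl lerBrDl.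
rewrite !lebesgue_measure_itv /= !lte_fin ltr_pM2l ?invr_gt0// ltrD2r.
case: ifPn => _; last by rewrite mule0.
by rewrite -EFinB -EFinM; congr EFin; field; rewrite gt_eqF.
Qed.

Lemma ge0_integral_affine (a c : R) (f : rR -> \bar R) : a != 0%R ->
  measurable_fun setT f -> (forall x, 0 <= f x) ->
  \int[mu]_x f x = `|a|%:E * \int[mu]_x f (c + a * x)%R.
Proof.
wlog a0 : a f / (0 < a)%R => [hw|].
  move=> an0 mf f0; have [|a0] := ltP 0%R a; first by move=> a0; exact: hw.
  have {}a0 : (0 < - a)%R by rewrite oppr_gt0 lt_neqAle an0.
  have mN : measurable_fun setT (fun x : rR => (- x)%R : rR) by exact: oppr_measurable.
  rewrite (hw (- a)%R) ?gt_eqF// normrN; congr (_ * _).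
  transitivity (\int[pushforward mu (-%R : rR -> rR)]_x f (c + - a * x)%R).
    apply: eq_measure_integral => A mA _; exact/esym/lebesgue_measureN.
  rewrite ge0_integral_pushforward//=; last first.
    by apply: measurableT_comp => //; exact: measurable_affine.
  by rewrite preimage_setT; apply: eq_integral => x _ /=; rewrite mulrNN.
move=> _ mf f0; rewrite gtr0_norm//.
pose m2 := mscale (NngNum (ltW a0))
  (measure_function_pushforward__canonical__measure_function_Measure
     mu (measurable_affine a c)).
transitivity (\int[m2]_x f x).
  apply: eq_measure_integral => A mA _; exact: lebesgue_affine_gt0.
rewrite ge0_integral_mscale//=; congr (_ * _).
rewrite ge0_integral_pushforward//=; exact: measurable_affine.
Qed.

Lemma ge0_integral_cons_rV n (f : 'rV[rR]_n.+1 -> \bar R) :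
  measurable_fun setT f -> (forall x, 0 <= f x) ->
  \int[lebesgue_rV n.+1]_x f x =
  \int[mu]_a \int[lebesgue_rV n]_u f (cons_rV (a, u)).
Proof.
move=> mf f0 /=.
rewrite -(fubini_tonelli1 (f \o @cons_rV R n))//=; last first.
  apply: measurableT_comp => //; exact: measurable_cons_rV.
rewrite /lebesgue_rV_succ.
rewrite ge0_integral_pushforward//=; exact: measurable_cons_rV.
Qed.

Lemma integral_rV0 (f : 'rV[rR]_0 -> \bar R) : measurable_fun setT f ->
  \int[lebesgue_rV 0]_x f x = f 0%R.
Proof. by move=> mf /=; rewrite integral_dirac//= diracT mul1e. Qed.

Lemma measurable_affine_rV n (a : R) (c : 'rV[rR]_n) :
  measurable_fun setT (fun x : 'rV[rR]_n => (c + a *: x)%R : 'rV[rR]_n).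
Proof.
apply: measurable_fun_rVP => i.
apply: (eq_measurable_fun (fun x : 'rV[rR]_n => (c ord0 i + a * x ord0 i)%R : rR)).
  by move=> x _; rewrite !mxE.
exact: (measurableT_comp (measurable_affine a (c ord0 i)) (measurable_coord_rV i)).
Qed.

Lemma measurable_cons_rV_snd n (a : rR) :
  measurable_fun setT (fun u : 'rV[rR]_n => cons_rV (a, u)).
Proof.
apply: measurableT_comp; first exact: measurable_cons_rV.
exact: pair1_measurable.
Qed.

Lemma affine_cons_rV n (a : R) (c : 'rV[rR]_n.+1) (x : rR) (u : 'rV[rR]_n) :
  (c + a *: cons_rV (x, u) =
  cons_rV ((c ord0 ord0 + a * x)%R : rR, ((\row_i c ord0 (lift ord0 i)) + a *: u)%R : 'rV[rR]_n))%R.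
Proof.
apply/rowP => i; rewrite mxE [X in (_ + X)%R]mxE.
by case: (unliftP ord0 i) => [j|] ->; rewrite ?cons_rVS ?cons_rV0//= !mxE.
Qed.

Lemma ge0_integral_affine_rV n (a : R) (c : 'rV[rR]_n) (f : 'rV[rR]_n -> \bar R) :
  (0 < a)%R -> measurable_fun setT f -> (forall x, 0 <= f x) ->
  \int[lebesgue_rV n]_x f x =
  (a ^+ n)%:E * \int[lebesgue_rV n]_x f (c + a *: x)%R.
Proof.
move=> a0; elim: n c f => [|n IH] c f mf f0.
  rewrite !integral_rV0//; last first.
    by apply: measurableT_comp => //; exact: measurable_affine_rV.
  by rewrite expr0 mul1e; congr f; apply/rowP; case.
rewrite !ge0_integral_cons_rV//; last first.
  by apply: measurableT_comp => //; exact: measurable_affine_rV.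
under [X in _ = _ * X]eq_integral do under eq_integral do rewrite affine_cons_rV.
set c' := (\row_i _)%R.
transitivity (\int[mu]_x ((a ^+ n)%:E *
    \int[lebesgue_rV n]_u f (cons_rV (x, (c' + a *: u)%R : 'rV[rR]_n)))).
  apply: eq_integral => x _.
  exact: (IH c' (fun u => f (cons_rV (x, u))) (measurableT_comp mf (measurable_cons_rV_snd x))).
have mg : measurable_fun setT (fun z : rR * 'rV[rR]_n => f (cons_rV (z.1 : rR, (c' + a *: z.2)%R : 'rV[rR]_n))).
  apply: (measurableT_comp mf); apply: (measurableT_comp (@measurable_cons_rV R n)).
  apply: measurable_fun_pair => //=.
  exact: (measurableT_comp (measurable_affine_rV a c')).
have mh : measurable_fun setT (fun x : rR => \int[lebesgue_rV n]_u f (cons_rV (x, (c' + a *: u)%R : 'rV[rR]_n))).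
  exact: (measurable_fun_fubini_tonelli_F
    (fun z : rR * 'rV[rR]_n => f (cons_rV (z.1 : rR, (c' + a *: z.2)%R : 'rV[rR]_n)))).
have h0 x : 0 <= \int[lebesgue_rV n]_u f (cons_rV (x, (c' + a *: u)%R : 'rV[rR]_n)).
  exact: integral_ge0.
have an0 : 0 <= (a ^+ n)%:E by rewrite lee_fin exprn_ge0// ltW.
rewrite (ge0_integralZl mu measurableT mh (fun x _ => h0 x) an0).
rewrite [in LHS](ge0_integral_affine (c ord0 ord0) (lt0r_neq0 a0) mh h0).
by rewrite gtr0_norm// muleA -EFinM exprSr.
Qed.

Lemma row_mx_cons_rV a b (x : rR) (u : 'rV[rR]_a) (v : 'rV[rR]_b) :
  row_mx (cons_rV (x, u)) v = cons_rV (x, row_mx u v) :> 'rV[rR]_(a.+1 + b).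
Proof.
apply/rowP => i; rewrite mxE; case: splitP => [j ij|j ij].
  case: (unliftP ord0 j) ij => [k|] -> ij.
    rewrite cons_rVS (_ : i = lift ord0 (lshift b k)); last exact: val_inj.
    by rewrite cons_rVS row_mxEl.
  rewrite cons_rV0 (_ : i = ord0); last exact: val_inj.
  by rewrite cons_rV0.
rewrite (_ : i = lift ord0 (rshift a j)); last exact: val_inj.
by rewrite cons_rVS row_mxEr.
Qed.

Lemma measurable_row_mx a b :
  measurable_fun setT (fun z : 'rV[rR]_a * 'rV[rR]_b => row_mx z.1 z.2 : 'rV[rR]_(a + b)).
Proof.
apply: measurable_fun_rVP => i; case: (splitP i) => j ij.
  apply: (eq_measurable_fun (fun z : 'rV[rR]_a * 'rV[rR]_b => z.1 ord0 j)).
    move=> z _; rewrite (_ : i = lshift b j); last exact: val_inj.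
    by rewrite row_mxEl.
  exact: (measurableT_comp (measurable_coord_rV j)).
apply: (eq_measurable_fun (fun z : 'rV[rR]_a * 'rV[rR]_b => z.2 ord0 j)).
  move=> z _; rewrite (_ : i = rshift a j); last exact: val_inj.
  by rewrite row_mxEr.
exact: (measurableT_comp (measurable_coord_rV j)).
Qed.

(** R^a x R^b is identified with R^(a + b) so that the 2 n - 1 coordinates other
    than x_1 and t can be integrated in polar coordinates. *)
Lemma ge0_integral_row_mx a b (f : 'rV[rR]_(a + b) -> \bar R) :
  measurable_fun setT f -> (forall x, 0 <= f x) ->
  \int[lebesgue_rV (a + b)]_x f x =
  \int[lebesgue_rV a]_u \int[lebesgue_rV b]_v f (row_mx u v).
Proof.
elim: a f => [|a IH] f mf f0.
  rewrite integral_rV0.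
    by apply: eq_integral => v _; rewrite row_thin_mx.
  apply: (measurable_fun_fubini_tonelli_F (m2 := lebesgue_rV b)
    (fun z : 'rV[rR]_0 * 'rV[rR]_b => f (row_mx z.1 z.2))) => //.
  by apply: measurableT_comp => //; exact: measurable_row_mx.
rewrite [RHS]ge0_integral_cons_rV; last 2 first.
- apply: (measurable_fun_fubini_tonelli_F (m2 := lebesgue_rV b)
    (fun z : 'rV[rR]_a.+1 * 'rV[rR]_b => f (row_mx z.1 z.2))) => //.
  by apply: measurableT_comp => //; exact: measurable_row_mx.
- by move=> x; exact: integral_ge0.
rewrite [LHS]ge0_integral_cons_rV//; apply: eq_integral => x _.
rewrite (IH _ (measurableT_comp mf (measurable_cons_rV_snd x)) (fun=> f0 _)).
apply: eq_integral => u _; apply: eq_integral => v _.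
by rewrite row_mx_cons_rV.
Qed.

Lemma ge0_integral_heis n (f : @heis R n -> \bar R) :
  measurable_fun [set: 'rV[rR]_n * 'rV[rR]_n * rR] f -> (forall x, 0 <= f x) ->
  \int[lebesgue_heis n]_xi f xi =
  \int[lebesgue_rV n]_x \int[lebesgue_rV n]_y \int[mu]_t f (x, y, t).
Proof.
move=> mf f0.
transitivity (\int[lebesgue_z n]_z fubini_F mu f z).
  exact: (fubini_tonelli1 (m1 := lebesgue_z n) (m2 := mu) f mf f0).
have m2 := measurable_fun_fubini_tonelli_F (m2 := mu) f mf f0.
have h0 z : 0 <= fubini_F (T1:=('rV[rR]_n * 'rV[rR]_n)%type) mu f z.
  exact: integral_ge0.
exact: (fubini_tonelli1 (m1 := lebesgue_rV n) (m2 := lebesgue_rV n) _ m2 h0).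
Qed.

Lemma ge0_integral_heis_cons m (f : @heis R m.+1 -> \bar R) :
  measurable_fun [set: 'rV[rR]_m.+1 * 'rV[rR]_m.+1 * rR] f -> (forall x, 0 <= f x) ->
  \int[lebesgue_heis m.+1]_xi f xi =
  \int[mu]_a \int[lebesgue_rV m]_u \int[lebesgue_rV m.+1]_y \int[mu]_t
    f (cons_rV (a, u), y, t).
Proof.
move=> mf f0; rewrite ge0_integral_heis//.
have m2 := measurable_fun_fubini_tonelli_F (m2 := mu) f mf f0.
have h0 z : 0 <= fubini_F (T1:=('rV[rR]_m.+1 * 'rV[rR]_m.+1)%type) mu f z.
  exact: integral_ge0.
have m1 := measurable_fun_fubini_tonelli_F (m2 := lebesgue_rV m.+1) _ m2 h0.
apply: (ge0_integral_cons_rV m1) => x; apply: integral_ge0 => y _; exact: h0.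
Qed.

Section triangular.
Variables (k l : nat) (cx : 'rV[rR]_k) (cy : 'rV[rR]_l) (a b : R).
Variables (ct kt : 'rV[rR]_k * 'rV[rR]_l -> rR).
Hypotheses (a0 : (0 < a)%R) (b0 : (0 < b)%R) (kt0 : forall z, (0 < kt z)%R).
Hypotheses (mct : measurable_fun setT ct) (mkt : measurable_fun setT kt).
Variable G : 'rV[rR]_k * 'rV[rR]_l * rR -> \bar R.
Hypotheses (mG : measurable_fun setT G) (G0 : forall x, 0 <= G x).

Lemma measurable_inner_integral2 (F : 'rV[rR]_k * 'rV[rR]_l * rR -> \bar R) :
  measurable_fun setT F -> (forall x, 0 <= F x) ->
  measurable_fun setT (fun x => \int[lebesgue_rV l]_y \int[mu]_t F (x, y, t)).
Proof.
move=> mF F0.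
have m2 := measurable_fun_fubini_tonelli_F (m2 := mu) F mF F0.
have h0 z : 0 <= fubini_F (T1:=('rV[rR]_k * 'rV[rR]_l)%type) mu F z.
  exact: integral_ge0.
exact: (measurable_fun_fubini_tonelli_F (m2 := lebesgue_rV l) _ m2 h0).
Qed.

Lemma measurable_inner_integral1 (F : 'rV[rR]_k * 'rV[rR]_l * rR -> \bar R) x :
  measurable_fun setT F -> (forall x, 0 <= F x) ->
  measurable_fun setT (fun y => \int[mu]_t F (x, y, t)).
Proof.
move=> mF F0.
have m2 := measurable_fun_fubini_tonelli_F (m2 := mu) F mF F0.
exact: (measurableT_comp m2 (pair1_measurable x)).
Qed.

Definition triangular_map (w : 'rV[rR]_k * 'rV[rR]_l * rR) :
    'rV[rR]_k * 'rV[rR]_l * rR :=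
  (cx + a *: w.1.1, cy + b *: w.1.2, ct w.1 + kt w.1 * w.2)%R.

Lemma measurable_triangular_map : measurable_fun setT triangular_map.
Proof.
apply: measurable_fun_pair.
  apply: measurable_fun_pair.
    apply: (measurableT_comp (measurable_affine_rV a cx)).
    by apply: (measurableT_comp measurable_fst measurable_fst).
  apply: (measurableT_comp (measurable_affine_rV b cy)).
  by apply: (measurableT_comp measurable_snd measurable_fst).
apply: (measurable_realfun.measurable_funD (measurableT_comp mct measurable_fst)).
exact: (measurable_realfun.measurable_funM (measurableT_comp mkt measurable_fst) measurable_snd).
Qed.

(** A change of variables whose Jacobian matrix is triangular needs only the
    affine substitution in each variable: the coefficients for t may depend on
    (x, y), which are fixed when t is integrated.  Group translations, the chart
    below and displacements are all of this form. *)
Lemma integral_triangular :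
  \int[lebesgue_rV k]_x \int[lebesgue_rV l]_y \int[mu]_t G (x, y, t) =
  \int[lebesgue_rV k]_x \int[lebesgue_rV l]_y \int[mu]_t
    ((a ^+ k * b ^+ l * kt (x, y))%:E * G (triangular_map (x, y, t))).
Proof.
have ak0 : (0 <= a ^+ k)%R by rewrite exprn_ge0// ltW.
have bl0 : (0 <= b ^+ l)%R by rewrite exprn_ge0// ltW.
have ak0E : 0 <= (a ^+ k)%:E by rewrite lee_fin.
have bl0E : 0 <= (b ^+ l)%:E by rewrite lee_fin.
pose mu2 := @lebesgue_rV R k; pose mu3 := @lebesgue_rV R l.
have mT : measurable_fun setT (G \o triangular_map).
  exact: (measurableT_comp mG measurable_triangular_map).
have mkE : measurable_fun setT
    (fun w : 'rV[rR]_k * 'rV[rR]_l * rR => (kt w.1)%:E).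
  apply/measurable_EFinP; exact: (measurableT_comp mkt measurable_fst).
pose F1 w := (kt w.1)%:E * (G \o triangular_map) w.
have mF1 : measurable_fun setT F1 by exact: (emeasurable_funM mkE mT).
have F10 w : 0 <= F1 w by apply: mule_ge0; [rewrite lee_fin ltW|exact: G0].
pose F2 w := (b ^+ l)%:E * F1 w.
have mF2 : measurable_fun setT F2 by exact: (emeasurable_funM (measurable_cst _) mF1).
have F20 w : 0 <= F2 w by apply: mule_ge0; [rewrite lee_fin|exact: F10].
rewrite (ge0_integral_affine_rV cx a0 (measurable_inner_integral2 mG G0)); last first.
  by move=> x; do 2 (apply: integral_ge0 => ? _).
(* the Jacobian factors are introduced one at a time, innermost last *)
transitivity ((a ^+ k)%:E * \int[lebesgue_rV k]_x \int[lebesgue_rV l]_y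
    \int[mu]_t F2 (x, y, t)).
  apply: (congr1 (mule (a ^+ k)%:E)); apply: eq_integral => x _.
  rewrite (ge0_integral_affine_rV cy b0 (measurable_inner_integral1 _ mG G0)); last first.
    by move=> y; apply: integral_ge0 => ? _.
  transitivity ((b ^+ l)%:E * \int[lebesgue_rV l]_y \int[mu]_t F1 (x, y, t)).
    apply: (congr1 (mule (b ^+ l)%:E)); apply: eq_integral => y _.
    have mGt : measurable_fun setT
        (fun t => G ((cx + a *: x)%R, (cy + b *: y)%R, t)).
      exact: (measurableT_comp mG (pair1_measurable _)).
    rewrite (ge0_integral_affine (ct (x, y)) (lt0r_neq0 (kt0 (x, y))) mGt)//.
    rewrite gtr0_norm//.
    have mTt := measurableT_comp mT (pair1_measurable (x, y)).
    have k0 : 0 <= (kt (x, y))%:E by rewrite lee_fin ltW.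
    exact: (esym (ge0_integralZl mu measurableT mTt (fun _ _ => G0 _) k0)).
  rewrite -(ge0_integralZl mu3 measurableT (measurable_inner_integral1 x mF1 F10)
    (fun y _ => integral_ge0 mu (fun t _ => F10 (x, y, t))) bl0E).
  apply: eq_integral => y _.
  have mF1t := measurableT_comp mF1 (pair1_measurable (x, y)).
  exact: (esym (ge0_integralZl mu measurableT mF1t (fun _ _ => F10 _) bl0E)).
rewrite -(ge0_integralZl mu2 measurableT (measurable_inner_integral2 mF2 F20)
  (fun x _ => integral_ge0 mu3 (fun y _ => integral_ge0 mu
    (fun t _ => F20 (x, y, t)))) ak0E).
apply: eq_integral => x _.
rewrite -(ge0_integralZl mu3 measurableT (measurable_inner_integral1 x mF2 F20)
    (fun y _ => integral_ge0 mu (fun t _ => F20 (x, y, t))) ak0E).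
apply: eq_integral => y _.
have mF2t := measurableT_comp mF2 (pair1_measurable (x, y)).
rewrite -(ge0_integralZl mu measurableT mF2t (fun _ _ => F20 _) ak0E).
by apply: eq_integral => t _; rewrite /F2 /F1 /= !EFinM !muleA.
Qed.

End triangular.
End iterated.

(** * Measurability of real and vector expressions *)

Section measurability.
Context {R : realType} d (T : measurableType d).
Local Notation rR := (measurableTypeR R).

(** Real expressions (measR_) and row vectors (measV_) are measurable as maps to
    measurableTypeR R and 'rV[measurableTypeR R]_k: it is on these carriers that
    the sigma-algebras used by the measures live. *)
Lemma measR_add (f g : T -> rR) : measurable_fun setT f -> measurable_fun setT g ->
  measurable_fun setT (fun x => f x + g x : rR).
Proof. move=> mf mg; exact: (measurable_realfun.measurable_funD mf mg). Qed.

Lemma measR_mul (f g : T -> rR) : measurable_fun setT f -> measurable_fun setT g ->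
  measurable_fun setT (fun x => f x * g x : rR).
Proof. move=> mf mg; exact: (measurable_realfun.measurable_funM mf mg). Qed.

Lemma measR_opp (f : T -> rR) : measurable_fun setT f ->
  measurable_fun setT (fun x => - f x : rR).
Proof. move=> mf; exact: (measurable_realfun.measurable_funN mf). Qed.

Lemma measR_sub (f g : T -> rR) : measurable_fun setT f -> measurable_fun setT g ->
  measurable_fun setT (fun x => f x - g x : rR).
Proof. move=> mf mg; exact: (measurable_realfun.measurable_funB mf mg). Qed.

Lemma measR_exp (f : T -> rR) k : measurable_fun setT f ->
  measurable_fun setT (fun x => f x ^+ k : rR).
Proof. move=> mf; exact: (measurable_realfun.measurable_funX _ mf). Qed.

Lemma measR_powR (f : T -> rR) (r : R) : measurable_fun setT f ->
  measurable_fun setT (fun x => f x `^ r : rR).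
Proof. move=> mf; exact: (measurableT_comp (measurable_powR r) mf). Qed.

Lemma measR_norm (f : T -> rR) : measurable_fun setT f ->
  measurable_fun setT (fun x => `|f x| : rR).
Proof. move=> mf; exact: (measurableT_comp (@normr_measurable _ setT) mf). Qed.

Lemma measR_sqrt (f : T -> rR) : measurable_fun setT f ->
  measurable_fun setT (fun x => Num.sqrt (f x) : rR).
Proof.
move=> mf; apply: (measurableT_comp _ mf).
apply: continuous_measurable_fun; exact: sqrt_continuous.
Qed.

(** The power function only gives the inverse of nonnegative numbers, whence
    1 / x = x / x^2; both sides are 0 at x = 0. *)
Lemma measR_inv (f : T -> rR) : measurable_fun setT f ->
  measurable_fun setT (fun x => (f x)^-1 : rR).
Proof.
move=> mf; apply: (eq_measurable_fun (fun x => f x * (f x ^+ 2) `^ (-1) : rR)).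
  move=> x _; rewrite powR_inv1 ?sqr_ge0//.
  have [->|fx0] := eqVneq (f x) 0; first by rewrite invr0 mul0r.
  by rewrite expr2 invfM mulrA mulfV// mul1r.
by apply: measR_mul => //; apply: measR_powR; exact: measR_exp.
Qed.

Lemma measR_sum k (f : 'I_k -> T -> rR) : (forall i, measurable_fun setT (f i)) ->
  measurable_fun setT (fun x => \sum_i f i x : rR).
Proof. move=> mf; exact: measurable_sum. Qed.

Lemma measR_coord k (f : T -> 'rV[rR]_k) i : measurable_fun setT f ->
  measurable_fun setT (fun x => f x ord0 i : rR).
Proof. move=> mf; exact: (measurableT_comp (measurable_coord_rV i) mf). Qed.

Lemma measR_dot k (f g : T -> 'rV[rR]_k) : measurable_fun setT f ->
  measurable_fun setT g -> measurable_fun setT (fun x => dot (f x) (g x) : rR).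
Proof.
by move=> mf mg; apply: measR_sum => i; apply: measR_mul; exact: measR_coord.
Qed.

Lemma measV_add k (f g : T -> 'rV[rR]_k) : measurable_fun setT f ->
  measurable_fun setT g -> measurable_fun setT (fun x => f x + g x : 'rV[rR]_k).
Proof.
move=> mf mg; apply: measurable_fun_rVP => i.
apply: (eq_measurable_fun (fun x => f x ord0 i + g x ord0 i : rR)).
  by move=> x _; rewrite mxE.
by apply: measR_add; exact: measR_coord.
Qed.

Lemma measV_scale k (a : T -> rR) (f : T -> 'rV[rR]_k) : measurable_fun setT a ->
  measurable_fun setT f -> measurable_fun setT (fun x => a x *: f x : 'rV[rR]_k).
Proof.
move=> ma mf; apply: measurable_fun_rVP => i.
apply: (eq_measurable_fun (fun x => a x * f x ord0 i : rR)).
  by move=> x _; rewrite mxE.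
by apply: measR_mul => //; exact: measR_coord.
Qed.

Lemma measV_cons k (a : T -> rR) (f : T -> 'rV[rR]_k) : measurable_fun setT a ->
  measurable_fun setT f -> measurable_fun setT (fun x => cons_rV (a x, f x)).
Proof.
move=> ma mf; apply: (measurableT_comp (@measurable_cons_rV R k)).
exact: measurable_fun_pair.
Qed.

Lemma measurable_lt (f g : T -> rR) : measurable_fun setT f -> measurable_fun setT g ->
  measurable_fun setT (fun x => f x < g x).
Proof. move=> mf mg; exact: measurable_fun_ltr. Qed.

Lemma measurable_triple d1 d2 d3 (A : measurableType d1) (B : measurableType d2)
    (C : measurableType d3) (f : T -> A * B * C) : measurable_fun setT f ->
  [/\ measurable_fun setT (fun x => (f x).1.1), measurable_fun setT (fun x => (f x).1.2) &
      measurable_fun setT (fun x => (f x).2)].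
Proof.
move=> mf; have mf1 := measurableT_comp measurable_fst mf.
split; last exact: (measurableT_comp measurable_snd mf).
  exact: (measurableT_comp measurable_fst mf1).
exact: (measurableT_comp measurable_snd mf1).
Qed.

End measurability.

(** * Translations and the chart of the half-space below a point *)

Section heis_change.
Context {R : realType}.
Local Notation rR := (measurableTypeR R).
Local Notation mu := (@lebesgue_measure R).
Local Notation H n := ('rV[rR]_n * 'rV[rR]_n * rR)%type.

Lemma measurable_heis_mul d (T : measurableType d) n (f g : T -> H n) :
  measurable_fun setT f -> measurable_fun setT g ->
  measurable_fun setT (fun x => heis_mul (f x) (g x) : H n).
Proof.
move=> mf mg.
have [mf11 mf12 mf2] := measurable_triple mf; have [mg11 mg12 mg2] := measurable_triple mg.
apply: measurable_fun_pair.
  by apply: measurable_fun_pair; exact: measV_add.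
apply: measR_sub.
  apply: measR_add; first exact: measR_add.
  by apply: measR_mul; [exact: measurable_cst|exact: measR_dot].
by apply: measR_mul; [exact: measurable_cst|exact: measR_dot].
Qed.

Lemma integral_heis_mul n (xi : heis n) (f : H n -> \bar R) :
  measurable_fun setT f -> (forall x, 0 <= f x)%E ->
  (\int[lebesgue_heis n]_eta f eta =
   \int[lebesgue_heis n]_eta f (heis_mul xi eta))%E.
Proof.
move=> mf f0.
have mm : measurable_fun setT (fun eta : H n => heis_mul xi eta : H n).
  by apply: measurable_heis_mul; [exact: measurable_cst|exact: measurable_id].
rewrite (ge0_integral_heis mf f0).
rewrite (ge0_integral_heis (measurableT_comp mf mm) (fun=> f0 _)).
pose ct (z : 'rV[rR]_n * 'rV[rR]_n) : rR :=
  xi.2 + 2 * dot xi.1.2 z.1 - 2 * dot xi.1.1 z.2.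
have mct : measurable_fun setT ct.
  apply: measR_sub.
    apply: measR_add; first exact: measurable_cst.
    apply: measR_mul; first exact: measurable_cst.
    by apply: measR_dot; [exact: measurable_cst|exact: measurable_fst].
  apply: measR_mul; first exact: measurable_cst.
  by apply: measR_dot; [exact: measurable_cst|exact: measurable_snd].
have mkt : measurable_fun setT (fun _ : 'rV[rR]_n * 'rV[rR]_n => 1 : rR).
  exact: measurable_cst.
rewrite (integral_triangular xi.1.1 xi.1.2 ltr01 ltr01 (fun=> ltr01) mct mkt mf f0).
apply: eq_integral => x _; apply: eq_integral => y _; apply: eq_integral => t _.
rewrite !expr1n !mulr1 mul1e /triangular_map /heis_mul /= !scale1r mul1r.
congr (f (_, _)); rewrite /ct /=; ring.
Qed.

Section succ.
Variable m : nat.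
Local Notation n := m.+1.

Definition height (xi : @heis R n) : R := xi.1.1 ord0 ord0.

Definition tail_rV (x : 'rV[rR]_n) : 'rV[rR]_m := \row_i x ord0 (lift ord0 i).

Lemma tail_cons_rV (a : rR) u : tail_rV (cons_rV (a, u)) = u.
Proof. by apply/rowP => i; rewrite mxE cons_rVS. Qed.

Lemma height_cons a u y t : height (cons_rV (a, u), y, t) = a.
Proof. by rewrite /height cons_rV0. Qed.

Lemma measurable_tail_rV d (T : measurableType d) (f : T -> 'rV[rR]_n) :
  measurable_fun setT f -> measurable_fun setT (fun x => tail_rV (f x)).
Proof.
move=> mf; apply: measurable_fun_rVP => i.
apply: (eq_measurable_fun (fun x => f x ord0 (lift ord0 i) : rR)).
  by move=> x _; rewrite mxE.
exact: measR_coord.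
Qed.

(** |(1, u, y)|^2 for eta = ((sigma, u), y, t). *)
Definition wsqr (eta : @heis R n) : R :=
  1 + dot (tail_rV eta.1.1) (tail_rV eta.1.1) + dot eta.1.2 eta.1.2.

(** Coordinates on the set of points of negative height.  The scale is
    a * height eta, the direction (- 1, u, y), and the vertical coordinate is
    measured in units of the squared length of the horizontal part, which makes
    the homogeneous norm a product (heis_norm_chart). *)
Definition chart (a : R) (eta : @heis R n) : @heis R n :=
  (cons_rV (- a * height eta : rR, (a * height eta) *: tail_rV eta.1.1 : 'rV[rR]_m),
   (a * height eta) *: eta.1.2, (a * height eta) ^+ 2 * wsqr eta * eta.2).

Definition chart_jac (a : R) (eta : @heis R n) : R :=
  (a * height eta) ^+ m * (a * height eta) ^+ n * ((a * height eta) ^+ 2 * wsqr eta).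

Lemma dot_ge0 k (x : 'rV[R]_k) : 0 <= dot x x.
Proof. by apply: sumr_ge0 => i _; rewrite -expr2 sqr_ge0. Qed.

Lemma wsqr_ge1 eta : 1 <= wsqr eta.
Proof. by rewrite /wsqr -addrA lerDl addr_ge0 ?dot_ge0. Qed.

Lemma measurable_height d (T : measurableType d) (f : T -> H n) :
  measurable_fun setT f -> measurable_fun setT (fun x => height (f x) : rR).
Proof.
move=> mf; apply: measR_coord.
exact: (measurableT_comp measurable_fst (measurableT_comp measurable_fst mf)).
Qed.

Lemma measurable_wsqr d (T : measurableType d) (f : T -> H n) :
  measurable_fun setT f -> measurable_fun setT (fun x => wsqr (f x) : rR).
Proof.
move=> mf.
have [mf11 mf12 _] := measurable_triple mf.
apply: measR_add; last exact: measR_dot.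
apply: measR_add; first exact: measurable_cst.
by apply: measR_dot; exact: measurable_tail_rV.
Qed.

Lemma measurable_chart d (T : measurableType d) (a : T -> rR) (f : T -> H n) :
  measurable_fun setT a -> measurable_fun setT f ->
  measurable_fun setT (fun x => chart (a x) (f x) : H n).
Proof.
move=> ma mf.
have [mf11 mf12 mf2] := measurable_triple mf.
have mh := measurable_height mf.
have mah := measR_mul ma mh.
apply: measurable_fun_pair.
  apply: measurable_fun_pair; last exact: measV_scale.
  apply: measV_cons; first exact: (measR_mul (measR_opp ma) mh).
  by apply: measV_scale => //; exact: measurable_tail_rV.
apply: measR_mul => //; apply: measR_mul; first exact: measR_exp.
exact: measurable_wsqr.
Qed.

Lemma measurable_chart_jac d (T : measurableType d) (a : T -> rR) (f : T -> H n) :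
  measurable_fun setT a -> measurable_fun setT f ->
  measurable_fun setT (fun x => chart_jac (a x) (f x) : rR).
Proof.
move=> ma mf.
have mah := measR_mul ma (measurable_height mf).
apply: measR_mul; first by apply: measR_mul; exact: measR_exp.
apply: measR_mul; first exact: measR_exp.
exact: measurable_wsqr.
Qed.

Lemma chart_jac_ge0 a eta : 0 < a -> 0 < height eta -> 0 <= chart_jac a eta.
Proof.
move=> a0 h0; have ah0 : 0 <= a * height eta by rewrite mulr_ge0 ?ltW.
have W0 : 0 <= wsqr eta by apply: le_trans (wsqr_ge1 _).
by apply: mulr_ge0; apply: mulr_ge0 => //; rewrite exprn_ge0.
Qed.

Definition hyperplane_integral (f : H n -> \bar R) (x : rR) :=
  (\int[lebesgue_rV m]_u \int[lebesgue_rV n]_y \int[mu]_t f (cons_rV (x, u), y, t))%E.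

Lemma measurable_hyperplane_integral (f : H n -> \bar R) : measurable_fun setT f ->
  (forall x, 0 <= f x)%E -> measurable_fun setT (hyperplane_integral f) /\ (forall x, 0 <= hyperplane_integral f x)%E.
Proof.
move=> mf f0.
  have mG : measurable_fun [set: rR * 'rV[rR]_m * 'rV[rR]_n * rR]
      (fun w => f (cons_rV (w.1.1.1, w.1.1.2), w.1.2, w.2)).
    apply: (measurableT_comp mf).
    have m1 := measurable_fst (T1 := (rR * 'rV[rR]_m * 'rV[rR]_n)%type) (T2 := rR).
    have m11 := measurableT_comp (measurable_fst (T1 := (rR * 'rV[rR]_m)%type) (T2 := 'rV[rR]_n)) m1.
    have m12 := measurableT_comp (measurable_snd (T1 := (rR * 'rV[rR]_m)%type) (T2 := 'rV[rR]_n)) m1.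
    have m111 := measurableT_comp (measurable_fst (T1 := rR) (T2 := 'rV[rR]_m)) m11.
    have m112 := measurableT_comp (measurable_snd (T1 := rR) (T2 := 'rV[rR]_m)) m11.
    apply: measurable_fun_pair; last exact: measurable_snd.
    by apply: measurable_fun_pair => //; exact: measV_cons.
  have G0 w : (0 <= f (cons_rV (w.1.1.1, w.1.1.2), w.1.2, w.2))%E by exact: f0.
  have m3 := measurable_fun_fubini_tonelli_F (m2 := mu) _ mG G0.
  have h3 z : (0 <= fubini_F (T1:=(rR * 'rV[rR]_m * 'rV[rR]_n)%type) mu (fun w => f (cons_rV (w.1.1.1, w.1.1.2), w.1.2, w.2)) z)%E.
    by apply: integral_ge0 => t _; exact: f0.
  have m2 := measurable_fun_fubini_tonelli_F (m2 := lebesgue_rV n) _ m3 h3.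
  have h2 z : (0 <= fubini_F (T1:=(rR * 'rV[rR]_m)%type) (lebesgue_rV n) (fubini_F (T1:=(rR * 'rV[rR]_m * 'rV[rR]_n)%type) mu (fun w => f (cons_rV (w.1.1.1, w.1.1.2), w.1.2, w.2))) z)%E.
    by apply: integral_ge0 => t _; exact: h3.
  have m1 : measurable_fun setT (hyperplane_integral f) := measurable_fun_fubini_tonelli_F (m2 := lebesgue_rV m) _ m2 h2.
  have h1 z : (0 <= hyperplane_integral f z)%E by do 3 (apply: integral_ge0 => ? _); exact: f0.
  by split.
Qed.

(** In the height the substitution is x |-> - a x, in the remaining variables it
    is triangular, with factors that depend on the height. *)
Lemma integral_chart (a : R) (f : H n -> \bar R) : 0 < a ->
  measurable_fun setT f -> (forall x, 0 <= f x)%E ->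
  (forall x, 0 <= height x -> f x = 0%E) ->
  (\int[lebesgue_heis n]_z f z =
   a%:E * \int[lebesgue_heis n]_eta
     (if (0 < height eta)%R then (chart_jac a eta)%:E * f (chart a eta) else 0))%E.
Proof.
move=> a0 mf f0 fx.
pose g (eta : H n) := (if (0 < height eta)%R then (chart_jac a eta)%:E * f (chart a eta) else 0)%E.
have mfz := measurableT_comp mf (measurable_chart (measurable_cst a) (@measurable_id _ (H n) setT)).
have mj := measurable_chart_jac (measurable_cst a) (@measurable_id _ (H n) setT).
have mhx := measurable_height (@measurable_id _ (H n) setT).
have mg : measurable_fun setT g.
  apply: measurable_fun_ifT.
  - by apply: measurable_lt; [exact: measurable_cst|exact: mhx].
  - by apply: emeasurable_funM; [exact/measurable_EFinP|exact: mfz].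
  - exact: measurable_cst.
have g0 eta : (0 <= g eta)%E.
  rewrite /g; case: ifPn => // h0; apply: mule_ge0; last exact: f0.
  by rewrite lee_fin chart_jac_ge0.
rewrite (ge0_integral_heis_cons mf f0) (ge0_integral_heis_cons mg g0).
pose K := hyperplane_integral f.
have KE : (\int[mu]_x K x = a%:E * \int[mu]_x K (- a * x)%R)%E.
  have [m1 h1] := measurable_hyperplane_integral mf f0.
  have na0 : - a != 0 by rewrite oppr_eq0 gt_eqF.
  apply: (etrans (ge0_integral_affine 0 na0 m1 h1)).
  rewrite normrN (gtr0_norm a0).
  by apply: (congr1 (mule a%:E)); apply: eq_integral => x _; rewrite add0r.
apply: (etrans KE).
apply: (congr1 (mule a%:E)); apply: eq_integral => x _.
have [x0|x0] := ltP 0 x; last first.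
  transitivity (0 : \bar R)%E.
    rewrite /K /hyperplane_integral integral0_eq// => u _; rewrite integral0_eq// => y _.
    by rewrite integral0_eq// => t _; apply: fx; rewrite height_cons mulNr oppr_ge0 pmulr_rle0.
  apply/esym; rewrite integral0_eq// => u _; rewrite integral0_eq// => y _.
  by rewrite integral0_eq// => t _; rewrite /g height_cons ltNge x0.
have ax0 : 0 < a * x by rewrite mulr_gt0.
pose kt (z : 'rV[rR]_m * 'rV[rR]_n) : rR := (a * x) ^+ 2 * (1 + dot z.1 z.1 + dot z.2 z.2).
have kt0 z : 0 < kt z.
  by rewrite mulr_gt0 ?exprn_gt0// -addrA ltr_pwDl ?addr_ge0 ?dot_ge0.
have mkt : measurable_fun setT kt.
  apply: measR_mul; first exact: measurable_cst.
  apply: measR_add; last by apply: measR_dot; exact: measurable_snd.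
  apply: measR_add; first exact: measurable_cst.
  by apply: measR_dot; exact: measurable_fst.
have mG : measurable_fun setT (fun w : 'rV[rR]_m * 'rV[rR]_n * rR => f (cons_rV (- a * x : rR, w.1.1), w.1.2, w.2)).
  apply: (measurableT_comp mf).
  have [m11 m12 _] := measurable_triple (@measurable_id _ ('rV[rR]_m * 'rV[rR]_n * rR)%type setT).
  apply: measurable_fun_pair; last exact: measurable_snd.
  apply: measurable_fun_pair => //; apply: measV_cons => //; exact: measurable_cst.
have mct : measurable_fun setT (fun _ : 'rV[rR]_m * 'rV[rR]_n => 0 : rR).
  exact: measurable_cst.
rewrite /K /hyperplane_integral (integral_triangular 0 0 ax0 ax0 kt0 mct mkt mG (fun _ => f0 _)).
apply: eq_integral => u _; apply: eq_integral => y _; apply: eq_integral => t _.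
rewrite /g height_cons x0 /chart_jac /chart /wsqr height_cons /= tail_cons_rV !add0r.
by rewrite /kt /=.
Qed.

End succ.
End heis_change.

Section psi.
Context {R : realType}.
Variable m : nat.
Local Notation n := m.+1.
Local Notation rR := (measurableTypeR R).
Local Notation mu := (@lebesgue_measure R).
Local Notation H n := ('rV[rR]_n * 'rV[rR]_n * rR)%type.

(** The point of height height xi * (1 - height eta) that eta represents as seen
    from xi. *)
Definition displace (xi eta : @heis R n) : @heis R n :=
  heis_mul xi (chart (height xi) eta).

Lemma height_chart a (eta : @heis R n) : height (chart a eta) = - (a * height eta).
Proof. by rewrite height_cons mulNr. Qed.

Lemma height_mul (xi eta : @heis R n) : height (heis_mul xi eta) = height xi + height eta.
Proof. by rewrite /height /= mxE. Qed.

Lemma height_displace (xi eta : @heis R n) : height (displace xi eta) = height xi * (1 - height eta).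
Proof. by rewrite height_mul height_chart mulrBr mulr1. Qed.

Lemma measurable_displace d (T : measurableType d) (f g : T -> H n) :
  measurable_fun setT f -> measurable_fun setT g ->
  measurable_fun setT (fun x => displace (f x) (g x) : H n).
Proof.
move=> mf mg; apply: measurable_heis_mul => //; apply: measurable_chart => //.
exact: measurable_height.
Qed.

(** For fixed eta the height is multiplied by 1 - height eta and the other
    coordinates are only shifted, by amounts that depend on the previous ones. *)
Lemma integral_displace (eta : H n) (f : H n -> \bar R) : height eta < 1 ->
  measurable_fun setT f -> (forall x, 0 <= f x)%E ->
  (\int[lebesgue_heis n]_xi f xi =
   (1 - height eta)%:E * \int[lebesgue_heis n]_xi f (displace xi eta))%E.
Proof.
move=> h1 mf f0.
have mP : measurable_fun setT (fun xi : H n => displace xi eta : H n).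
  by apply: measurable_displace; [exact: measurable_id|exact: measurable_cst].
have mfP := measurableT_comp mf mP.
rewrite (ge0_integral_heis_cons mf f0) (ge0_integral_heis_cons mfP (fun=> f0 _)).
have [ms s0] := measurable_hyperplane_integral mf f0.
have t0 : 0 < 1 - height eta by rewrite subr_gt0.
apply: (etrans (ge0_integral_affine 0 (lt0r_neq0 t0) ms s0)).
rewrite (gtr0_norm t0).
apply: (congr1 (mule (1 - height eta)%:E)); apply: eq_integral => x _.
rewrite add0r /hyperplane_integral.
have mG : measurable_fun setT (fun w : 'rV[rR]_m * 'rV[rR]_n * rR =>
    f (cons_rV ((1 - height eta) * x : rR, w.1.1), w.1.2, w.2)).
  apply: (measurableT_comp mf).
  have [m11 m12 _] := measurable_triple (@measurable_id _ ('rV[rR]_m * 'rV[rR]_n * rR)%type setT).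
  apply: measurable_fun_pair; last exact: measurable_snd.
  by apply: measurable_fun_pair; [apply: measV_cons; [exact: measurable_cst|exact: m11]|exact: m12].
pose z := chart x eta.
have mid1 := measurable_fst (T1 := 'rV[rR]_m) (T2 := 'rV[rR]_n).
have mid2 := measurable_snd (T1 := 'rV[rR]_m) (T2 := 'rV[rR]_n).
pose ct' (w : 'rV[rR]_m * 'rV[rR]_n) : rR :=
  z.2 + 2 * dot w.2 z.1.1 - 2 * dot (cons_rV (x : rR, w.1)) z.1.2.
have mct : measurable_fun setT ct'.
  apply: measR_sub.
    apply: measR_add; first exact: measurable_cst.
    apply: measR_mul; first exact: measurable_cst.
    by apply: measR_dot; [exact: mid2|exact: measurable_cst].
  apply: measR_mul; first exact: measurable_cst.
  apply: measR_dot; last exact: measurable_cst.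
  by apply: measV_cons; [exact: measurable_cst|exact: mid1].
have mkt : measurable_fun setT (fun _ : 'rV[rR]_m * 'rV[rR]_n => 1 : rR).
  exact: measurable_cst.
apply: (etrans (integral_triangular (tail_rV z.1.1) z.1.2 ltr01 ltr01
  (fun=> ltr01) mct mkt mG (fun=> f0 _))).
apply: eq_integral => u _; apply: eq_integral => y _; apply: eq_integral => t _.
rewrite !expr1n !mulr1 mul1e; congr f.
rewrite /displace height_cons -/z /triangular_map /heis_mul /= !scale1r mul1r.
congr (_, _, _); last by rewrite /ct' /=; ring.
- apply/rowP => i; rewrite [RHS]mxE; case: (unliftP ord0 i) => [j|] ->.
    by rewrite !cons_rVS /= tail_cons_rV [LHS]mxE addrC.
  by rewrite !cons_rV0 /= mulrDl mul1r !mulNr (mulrC x).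
- by rewrite addrC.
Qed.

Lemma integral_hyperplane0 (c : R) (f : H n -> \bar R) :
  measurable_fun setT f -> (forall x, 0 <= f x)%E ->
  (forall x, height x != c -> f x = 0%E) ->
  (\int[lebesgue_heis n]_xi f xi = 0)%E.
Proof.
move=> mf f0 fc; rewrite (ge0_integral_heis_cons mf f0).
have [ms s0] := measurable_hyperplane_integral mf f0.
rewrite -(@integral_setD1 R _ c); last 2 first.
- by apply: measurableD.
- exact: measurable_funTS.
apply: integral0_eq => x [_ /= /eqP xc].
rewrite integral0_eq// => u _; rewrite integral0_eq// => y _.
by rewrite integral0_eq// => t _; apply: fc; rewrite height_cons.
Qed.

Lemma dot_cons_rV k (a b : R) (u v : 'rV[R]_k) :
  dot (cons_rV (a : rR, u)) (cons_rV (b : rR, v)) = a * b + dot u v.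
Proof.
rewrite /dot big_ord_recl !cons_rV0; congr (_ + _).
by apply: eq_bigr => i _; rewrite !cons_rVS.
Qed.

Lemma dotZ k (a b : R) (u v : 'rV[R]_k) : dot (a *: u) (b *: v) = a * b * dot u v.
Proof.
rewrite /dot mulr_sumr; apply: eq_bigr => i _; rewrite !mxE; ring.
Qed.

Lemma dotN k (u v : 'rV[R]_k) : dot (- u) v = - dot u v.
Proof. by rewrite -scaleN1r -[X in dot _ X = _]scale1r dotZ mulr1 mulN1r. Qed.

Lemma dotC k (u v : 'rV[R]_k) : dot u v = dot v u.
Proof. by apply: eq_bigr => i _; rewrite mulrC. Qed.

Lemma dotDr k (u v w : 'rV[R]_k) : dot u (v + w) = dot u v + dot u w.
Proof. by rewrite /dot -big_split; apply: eq_bigr => i _; rewrite mxE mulrDr. Qed.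

Lemma heis_mulKV k (xi z : @heis R k) :
  heis_mul (heis_inv xi) (heis_mul xi z) = z.
Proof.
case: xi => -[x y] t; case: z => -[x' y'] t'.
rewrite /heis_mul /heis_inv /= !addKr; congr (_, _, _).
rewrite !dotDr !dotN (dotC y x); ring.
Qed.

Lemma znorm_chart a (eta : @heis R n) : 0 < a -> 0 < height eta ->
  znorm (chart a eta).1 = a * height eta * wsqr eta `^ 2^-1.
Proof.
move=> a0 h0; rewrite /znorm /= dot_cons_rV !dotZ.
have -> : - a * height eta * (- a * height eta) +
   a * height eta * (a * height eta) * dot (tail_rV eta.1.1) (tail_rV eta.1.1) +
   a * height eta * (a * height eta) * dot eta.1.2 eta.1.2 = (a * height eta) ^+ 2 * wsqr eta.
  by rewrite /wsqr; ring.
rewrite sqrtrM ?sqr_ge0// sqrtr_sqr gtr0_norm ?mulr_gt0// powR12_sqrt//.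
exact: le_trans (wsqr_ge1 _).
Qed.

Lemma heis_norm_chart a (eta : @heis R n) : 0 < a -> 0 < height eta ->
  heis_norm (chart a eta) =
  a * height eta * wsqr eta `^ 2^-1 * (1 + eta.2 ^+ 2) `^ (1 / 4).
Proof.
move=> a0 h0; rewrite /heis_norm znorm_chart//.
have W0 : 0 <= wsqr eta by exact: le_trans (wsqr_ge1 _).
set A := a * height eta; have A0 : 0 < A by rewrite mulr_gt0.
have -> : (chart a eta).2 = A ^+ 2 * wsqr eta * eta.2 by [].
set w := wsqr eta `^ 2^-1.
have ww : w ^+ 2 = wsqr eta by rewrite /w powR12_sqrt// sqr_sqrtr.
have -> : (A * w) ^+ 4 + (A ^+ 2 * wsqr eta * eta.2) ^+ 2 =
    (A * w) ^+ 4 * (1 + eta.2 ^+ 2) by rewrite -ww; ring.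
have Aw : 0 <= A * w by rewrite mulr_ge0 ?powR_ge0// ltW.
rewrite powRM ?exprn_ge0// ?addr_ge0 ?sqr_ge0//; congr (_ * _).
by rewrite -powR_mulrn// -powRrM mul1r mulfV// powRr1.
Qed.

Lemma znorm_sub_mul k (xi z : @heis R k) :
  znorm (xi.1 - (heis_mul xi z).1) = znorm z.1.
Proof.
have E (u v : 'rV[R]_k) : u - (u + v) = - v by rewrite opprD addrA subrr add0r.
rewrite /znorm.
have -> : (xi.1 - (heis_mul xi z).1).1 = - z.1.1 by exact: E.
have -> : (xi.1 - (heis_mul xi z).1).2 = - z.1.2 by exact: E.
by rewrite !dotN ![dot _ (- _)]dotC !dotN !opprK.
Qed.

(** The density in eta that the kernel leaves once its dependence on xi is
    factored out. *)
Definition rho (s p alpha : R) (eta : @heis R n) : R :=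
  height eta `^ (- (1 + (s * p + alpha))) *
  wsqr eta `^ (- (((n + n)%:R + (s * p + alpha)) / 2)) *
  (1 + eta.2 ^+ 2) `^ (- ((n + n)%:R + 2 + s * p) / 4).

(** Left invariance reduces the kernel to the norms of chart (height xi) eta;
    then both sides are products of powers of the same four positive numbers. *)
Lemma kernel_displace (s p alpha : R) (xi eta : @heis R n) : 0 < height xi -> 0 < height eta ->
  height xi * chart_jac (height xi) eta *
  (heis_norm (heis_mul (heis_inv xi) (displace xi eta)) `^ ((hom_dim n)%:R + s * p) *
      znorm (xi.1 - (displace xi eta).1) `^ alpha)^-1 =
  height xi `^ (- (s * p + alpha)) * rho s p alpha eta.
Proof.
move=> a0 h0; rewrite /displace heis_mulKV znorm_sub_mul heis_norm_chart// znorm_chart//.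
rewrite /chart_jac /rho.
have V0 : 0 < 1 + eta.2 ^+ 2 by rewrite ltr_pwDl// sqr_ge0.
have W0 : 0 < wsqr eta by exact: lt_le_trans (wsqr_ge1 _).
have [la <-] := expR_total a0; have [lh <-] := expR_total h0.
have [lv <-] := expR_total V0; have [lw <-] := expR_total W0.
rewrite -!expRM -!expRD -!expRM -!expRM_natr -!expRD -!expRN -!expRD; congr expR.
rewrite /hom_dim !natrD !natrM !mulrS.
by field.
Qed.

End psi.

(** * The double integral as an integral of slice energies *)

Section representation.
Context {R : realType}.
Variable m : nat.
Local Notation n := m.+1.
Local Notation rR := (measurableTypeR R).
Local Notation mu := (@lebesgue_measure R).
Local Notation H := ('rV[rR]_n * 'rV[rR]_n * rR)%type.
Local Notation L := (@lebesgue_heis R n).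

Variables s p alpha : R.

Definition gagliardo_kernel (xi xi' : @heis R n) : R :=
  (heis_norm (heis_mul (heis_inv xi) xi') `^ ((hom_dim n)%:R + s * p) *
      znorm (xi.1 - xi'.1) `^ alpha)^-1.

Lemma measurable_znorm d (T : measurableType d) (f : T -> ('rV[rR]_n * 'rV[rR]_n)%type) :
  measurable_fun setT f -> measurable_fun setT (fun x => znorm (f x) : rR).
Proof.
move=> mf; apply: measR_sqrt.
have mf1 := measurableT_comp measurable_fst mf.
have mf2 := measurableT_comp measurable_snd mf.
by apply: measR_add; exact: measR_dot.
Qed.

Lemma measurable_heis_norm d (T : measurableType d) (f : T -> H) :
  measurable_fun setT f -> measurable_fun setT (fun x => heis_norm (f x) : rR).
Proof.
move=> mf; apply: measR_powR.
have mf1 := measurableT_comp measurable_fst mf.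
have mf2 := measurableT_comp measurable_snd mf.
by apply: measR_add; apply: measR_exp => //; exact: measurable_znorm.
Qed.

Lemma measurable_heis_inv d (T : measurableType d) (f : T -> H) :
  measurable_fun setT f -> measurable_fun setT (fun x => heis_inv (f x) : H).
Proof.
move=> mf.
have [mf11 mf12 mf2] := measurable_triple mf.
have mN (g : T -> 'rV[rR]_n) : measurable_fun setT g ->
    measurable_fun setT (fun x => - g x : 'rV[rR]_n).
  move=> mg; apply: measurable_fun_rVP => i.
  apply: (eq_measurable_fun (fun x => - g x ord0 i : rR)).
    by move=> x _; rewrite mxE.
  by apply: measR_opp; exact: measR_coord.
apply: measurable_fun_pair; last exact: measR_opp.
by apply: measurable_fun_pair; exact: mN.
Qed.

Lemma measurable_gagliardo_kernel d (T : measurableType d) (f g : T -> H) :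
  measurable_fun setT f -> measurable_fun setT g ->
  measurable_fun setT (fun x => gagliardo_kernel (f x) (g x) : rR).
Proof.
move=> mf mg.
have [mf11 mf12 _] := measurable_triple mf.
have [mg11 mg12 _] := measurable_triple mg.
have mS (u v : T -> 'rV[rR]_n) : measurable_fun setT u -> measurable_fun setT v ->
    measurable_fun setT (fun x => u x - v x : 'rV[rR]_n).
  move=> mu mv; apply: measurable_fun_rVP => i.
  apply: (eq_measurable_fun (fun x => u x ord0 i - v x ord0 i : rR)).
    by move=> x _; rewrite !mxE.
  by apply: measR_sub; exact: measR_coord.
apply: measR_inv; apply: measR_mul; apply: measR_powR.
  by apply: measurable_heis_norm; apply: measurable_heis_mul => //; exact: measurable_heis_inv.
by apply: measurable_znorm; apply: measurable_fun_pair; exact: mS.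
Qed.

Lemma gagliardo_kernel_ge0 xi xi' : 0 <= gagliardo_kernel xi xi'.
Proof. by rewrite /gagliardo_kernel invr_ge0 mulr_ge0 ?powR_ge0. Qed.

Lemma gagliardo_kernelC xi xi' : gagliardo_kernel xi xi' = gagliardo_kernel xi' xi.
Proof.
have znormN (z : 'rV[R]_n * 'rV[R]_n) : znorm (- z.1, - z.2) = znorm z.
  by rewrite /znorm /= !dotN ![dot _ (- _)]dotC !dotN !opprK.
have zE : znorm (xi.1 - xi'.1) = znorm (xi'.1 - xi.1).
  rewrite -(znormN (xi'.1 - xi.1)).
  case: xi.1 => a b; case: xi'.1 => a' b'.
  have -> : (- ((a', b') - (a, b)).1, - ((a', b') - (a, b)).2) = (a, b) - (a', b').
    by apply: (congr2 pair); rewrite opprB.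
  by [].
have hE : heis_mul (heis_inv xi') xi =
    ((- (heis_mul (heis_inv xi) xi').1.1, - (heis_mul (heis_inv xi) xi').1.2),
     - (heis_mul (heis_inv xi) xi').2).
  case: xi {zE} => -[x y] t; case: xi' => -[x' y'] t'.
  rewrite /heis_mul /heis_inv /= !opprD !opprK.
  apply: (congr2 pair); first by apply: (congr2 pair); rewrite addrC.
  by rewrite !dotN (dotC y') (dotC x'); ring.
have nE : heis_norm (heis_mul (heis_inv xi) xi') = heis_norm (heis_mul (heis_inv xi') xi).
  by rewrite hE /heis_norm znormN sqrrN.
by rewrite /gagliardo_kernel nE zE.
Qed.

Variable f : @heis R n -> R.
Hypothesis mf : measurable_fun [set: H] (f : H -> rR).
Hypothesis f0 : forall xi, height xi <= 0 -> f xi = 0.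
Hypothesis p0 : p != 0.

(** The share of the energy due to the pairs (xi, displace xi eta), with eta
    fixed. *)
Definition slice_energy (eta : @heis R n) : \bar R :=
  (\int[L]_xi (if (0 < height xi)%R then
     (`|f xi - f (displace xi eta)| `^ p * height xi `^ (- (s * p + alpha)))%:E else 0))%E.

Let g (w : H * H) : \bar R := (`|f w.1 - f w.2| `^ p * gagliardo_kernel w.1 w.2)%:E.

Let mg d (T : measurableType d) (a b : T -> H) : measurable_fun setT a ->
  measurable_fun setT b -> measurable_fun setT (fun x => g (a x, b x)).
Proof.
move=> ma mb; apply/measurable_EFinP; apply: measR_mul; last exact: measurable_gagliardo_kernel.
apply: measR_powR; apply: measR_norm; apply: measR_sub.
  exact: (measurableT_comp mf ma).
exact: (measurableT_comp mf mb).
Qed.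

Let g0 w : (0 <= g w)%E.
Proof. by rewrite lee_fin mulr_ge0 ?powR_ge0 ?gagliardo_kernel_ge0. Qed.

Let glt (w : H * H) : \bar R := if height w.2 < height w.1 then g w else 0%E.

Let mlt d (T : measurableType d) (a b : T -> H) : measurable_fun setT a ->
  measurable_fun setT b -> measurable_fun setT (fun x => glt (a x, b x)).
Proof.
move=> ma mb; apply: measurable_fun_ifT.
- by apply: measurable_lt; exact: measurable_height.
- exact: mg.
- exact: measurable_cst.
Qed.

Let glt0 w : (0 <= glt w)%E.
Proof. by rewrite /glt; case: ifP => // _; exact: g0. Qed.

Let gC a b : g (a, b) = g (b, a).
Proof. by rewrite /g /= distrC gagliardo_kernelC. Qed.

(** Pairs of equal height form a null set and the integrand is symmetric. *)
Let gag_half : (\int[L]_xi \int[L]_xi' g (xi, xi') =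
  2%:E * \int[L]_xi \int[L]_xi' glt (xi, xi'))%E.
Proof.
have mid := @measurable_id _ H setT.
have split3 xi : (\int[L]_xi' g (xi, xi') =
    \int[L]_xi' glt (xi, xi') + \int[L]_xi' glt (xi', xi))%E.
  (* the part of the integral on the hyperplane of points at the height of xi *)
  pose geq xi' : \bar R := if height xi' == height xi then g (xi, xi') else 0%E.
  have mc := measurable_cst (T1 := H) (D := setT) (xi : H).
  have m1 := mlt mc mid.
  have m2 := mlt mid mc.
  have m3 : measurable_fun setT geq.
    apply: measurable_fun_ifT.
    - by apply: measurable_fun_eqr; [exact: measurable_height|exact: measurable_cst].
    - exact: (mg mc mid).
    - exact: measurable_cst.
  have geq0 x : (0 <= geq x)%E by rewrite /geq; case: ifP => // _; exact: g0.
  have z : (\int[L]_xi' geq xi' = 0)%E.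
    by apply: (integral_hyperplane0 (c := height xi) m3 geq0) => x /negbTE xn; rewrite /geq xn.
  rewrite -(ge0_integralD L measurableT (fun x _ => glt0 _) m1 (fun x _ => glt0 _) m2).
  have m12 := emeasurable_funD m1 m2.
  rewrite -[RHS]adde0 -z -(ge0_integralD L measurableT
    (fun x _ => adde_ge0 (glt0 _) (glt0 _)) m12 (fun x _ => geq0 x) m3).
  apply: eq_integral => x _; rewrite /glt /geq /=.
  by case: ltgtP => h; rewrite ?add0e ?adde0//; exact: gC.
under eq_integral do rewrite split3.
have mw := @measurable_id _ (H * H)%type setT.
have mw1 := measurableT_comp (measurable_fst (T1 := H) (T2 := H)) mw.
have mw2 := measurableT_comp (measurable_snd (T1 := H) (T2 := H)) mw.
pose F1 (w : H * H) := glt (w.1, w.2).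
pose F2 (w : H * H) := glt (w.2, w.1).
have mF1 : measurable_fun setT F1 := mlt mw1 mw2.
have mF2 : measurable_fun setT F2 := mlt mw2 mw1.
have mi1 := measurable_fun_fubini_tonelli_F (m2 := L) F1 mF1 (fun=> glt0 _).
have mi2 := measurable_fun_fubini_tonelli_F (m2 := L) F2 mF2 (fun=> glt0 _).
apply: (etrans (ge0_integralD L measurableT
  (fun x _ => integral_ge0 L (fun y _ => glt0 (x, y))) mi1
  (fun x _ => integral_ge0 L (fun y _ => glt0 (y, x))) mi2)).
have sw : (\int[L]_xi \int[L]_xi' F2 (xi, xi') = \int[L]_xi \int[L]_xi' F1 (xi, xi'))%E.
  exact: (fubini_tonelli F2 mF2 (fun=> glt0 _)).
rewrite mule_natl mule2n.
exact: (congr1 (fun x => _ + x)%E sw).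
Qed.

Let h (w : H * H) : \bar R :=
  if (0 < height w.1) && (0 < height w.2) then
    ((rho s p alpha w.2)%:E * (`|f w.1 - f (displace w.1 w.2)| `^ p * height w.1 `^ (- (s * p + alpha)))%:E)%E
  else 0%E.

Let integral_half (xi : H) (F : H -> \bar R) : 0 < height xi ->
  measurable_fun setT F -> (forall x, 0 <= F x)%E ->
  (forall x, height xi <= height x -> F x = 0%E) ->
  (\int[L]_x F x = (height xi)%:E * \int[L]_eta
     (if (0 < height eta)%R then (chart_jac (height xi) eta)%:E * F (displace xi eta) else 0))%E.
Proof.
move=> a0 mF F0 Fx; rewrite (integral_heis_mul xi mF F0).
have mm : measurable_fun setT (fun z : H => heis_mul xi z : H).
  by apply: measurable_heis_mul; [exact: measurable_cst|exact: measurable_id].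
apply: (integral_chart a0 (measurableT_comp mF mm) (fun=> F0 _)) => x hx0.
by apply: Fx; rewrite height_mul lerDl.
Qed.

Lemma measurable_rho d (T : measurableType d) (a : T -> H) : measurable_fun setT a ->
  measurable_fun setT (fun x => rho s p alpha (a x) : rR).
Proof.
move=> ma; apply: measR_mul; [apply: measR_mul|]; apply: measR_powR.
- exact: measurable_height.
- exact: measurable_wsqr.
- apply: measR_add; first exact: measurable_cst.
  exact: (measR_exp _ (measurableT_comp measurable_snd ma)).
Qed.

Lemma rho_ge0 (eta : @heis R n) : 0 <= rho s p alpha eta.
Proof. by rewrite !mulr_ge0 ?powR_ge0. Qed.

Let menergy d (T : measurableType d) (a b : T -> H) : measurable_fun setT a ->
  measurable_fun setT b -> measurable_fun setT (fun x =>
    `|f (a x) - f (displace (a x) (b x))| `^ p * height (a x) `^ (- (s * p + alpha)) : rR).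
Proof.
move=> ma mb; apply: measR_mul; last by apply: measR_powR; exact: measurable_height.
apply: measR_powR; apply: measR_norm; apply: measR_sub.
  exact: (measurableT_comp mf ma).
exact: (measurableT_comp mf (measurable_displace ma mb)).
Qed.

Let mh d (T : measurableType d) (a b : T -> H) : measurable_fun setT a ->
  measurable_fun setT b -> measurable_fun setT (fun x => h (a x, b x)).
Proof.
move=> ma mb; apply: measurable_fun_ifT; last exact: measurable_cst.
  by apply: measurable_and; apply: measurable_lt; try exact: measurable_cst; exact: measurable_height.
apply: emeasurable_funM; apply/measurable_EFinP; last exact: menergy.
exact: measurable_rho.
Qed.

Let h0 w : (0 <= h w)%E.
Proof.
rewrite /h; case: ifP => // _; apply: mule_ge0.
  by rewrite lee_fin rho_ge0.
by rewrite lee_fin mulr_ge0 ?powR_ge0.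
Qed.

Let glt_h xi : (\int[L]_xi' glt (xi, xi') = \int[L]_eta h (xi, eta))%E.
Proof.
have mid := @measurable_id _ H setT.
have mc := measurable_cst (T1 := H) (D := setT) (xi : H).
have [xi0|xi0] := ltP 0 (height xi); last first.
  rewrite integral0_eq => [|x _]; last first.
    rewrite /glt /=; case: ifP => // xl; rewrite /g /= !f0//; last first.
      exact: le_trans (ltW xl) xi0.
    by rewrite subrr normr0 powR0// mul0r.
  by rewrite integral0_eq// => x _; rewrite /h /= ltNge xi0.
have vF x : height xi <= height x -> glt (xi, x) = 0%E by move=> xx; rewrite /glt /= ltNge xx.
rewrite (integral_half xi0 (mlt mc mid) (fun=> glt0 _) vF).
have mj : measurable_fun setT (fun eta : H =>
    (if (0 < height eta)%R then (chart_jac (height xi) eta)%:E * glt (xi, displace xi eta) else 0)%E).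
  apply: measurable_fun_ifT; last exact: measurable_cst.
    by apply: measurable_lt; [exact: measurable_cst|exact: measurable_height].
  apply: emeasurable_funM; last exact: (mlt mc (measurable_displace mc mid)).
  by apply/measurable_EFinP; apply: measurable_chart_jac; [exact: measurable_cst|exact: mid].
have j0 (eta : H) : True -> (0 <= (if (0 < height eta)%R then (chart_jac (height xi) eta)%:E * glt (xi, displace xi eta) else 0))%E.
  move=> _; case: ifP => // e0; apply: mule_ge0; last exact: glt0.
  by rewrite lee_fin chart_jac_ge0.
have a0 : (0 <= (height xi)%:E)%E by rewrite lee_fin ltW.
rewrite -(ge0_integralZl L measurableT mj (fun x _ => j0 x I) a0).
apply: eq_integral => eta _; rewrite /h /= xi0 /=.
case: ifP => e0; last by rewrite mule0.
have -> : glt (xi, displace xi eta) = g (xi, displace xi eta).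
  by rewrite /glt /= height_displace gtr_pMr// gtrBl e0.
rewrite /g /= -!EFinM; congr EFin.
have := kernel_displace s p alpha xi0 e0; rewrite -/(gagliardo_kernel _ _) => kE.
rewrite mulrA mulrCA kE; ring.
Qed.

(** For fixed xi the substitution xi' = displace xi eta is a translation followed
    by the chart; Tonelli then exchanges the order of integration. *)
Lemma integral_gagliardo : (\int[L]_xi \int[L]_xi' g (xi, xi') =
  2%:E * \int[L]_eta
    (if (0 < height eta)%R then (rho s p alpha eta)%:E * slice_energy eta else 0))%E.
Proof.
rewrite gag_half; apply: (congr1 (mule 2%:E)).
under eq_integral do rewrite glt_h.
have mw := @measurable_id _ (H * H)%type setT.
have mw1 := measurableT_comp (measurable_fst (T1 := H) (T2 := H)) mw.
have mw2 := measurableT_comp (measurable_snd (T1 := H) (T2 := H)) mw.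
pose F1 (w : H * H) := h (w.1, w.2).
have mF1 : measurable_fun setT F1 := mh mw1 mw2.
apply: (etrans (fubini_tonelli (m1 := L) (m2 := L) F1 mF1 (fun=> h0 _))).
apply: eq_integral => eta _; rewrite /F1 /h /=.
have [e0|e0] := ltP 0 (height eta); last first.
  by apply: integral0_eq => x _; rewrite andbF.
have mid := @measurable_id _ H setT.
have mc := measurable_cst (T1 := H) (D := setT) (eta : H).
have me : measurable_fun setT (fun xi : H => (if (0 < height xi)%R then
     (`|f xi - f (displace xi eta)| `^ p * height xi `^ (- (s * p + alpha)))%:E else 0)%E).
  apply: measurable_fun_ifT; last exact: measurable_cst.
    by apply: measurable_lt; [exact: measurable_cst|exact: measurable_height].
  by apply/measurable_EFinP; exact: (menergy mid mc).
have en0 xi : (0 <= (if (0 < height xi)%R then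
     (`|f xi - f (displace xi eta)| `^ p * height xi `^ (- (s * p + alpha)))%:E else 0))%E.
  by case: ifP => // _; rewrite lee_fin mulr_ge0 ?powR_ge0.
have r0 : (0 <= (rho s p alpha eta)%:E)%E by rewrite lee_fin rho_ge0.
rewrite -(ge0_integralZl L measurableT me (fun x _ => en0 x) r0).
by apply: eq_integral => x _; rewrite andbT; case: ifP; rewrite ?mule0.
Qed.

Lemma measurable_energy_density eta : measurable_fun [set: H] (fun xi : H =>
  (if (0 < height xi)%R then
     (`|f xi - f (displace xi eta)| `^ p * height xi `^ (- (s * p + alpha)))%:E else 0)%E).
Proof.
apply: measurable_fun_ifT; last exact: measurable_cst.
  by apply: measurable_lt; [exact: measurable_cst|exact: (measurable_height (@measurable_id _ H setT))].
apply/measurable_EFinP; apply: (menergy (b := fun=> eta)).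
  exact: measurable_id.
exact: measurable_cst.
Qed.

Lemma measurable_rho_energy : measurable_fun [set: H] (fun eta : H =>
  (if (0 < height eta)%R then (rho s p alpha eta)%:E * slice_energy eta else 0)%E).
Proof.
have mid := @measurable_id _ H setT.
have mw := @measurable_id _ (H * H)%type setT.
have mw1 := measurableT_comp (measurable_fst (T1 := H) (T2 := H)) mw.
have mw2 := measurableT_comp (measurable_snd (T1 := H) (T2 := H)) mw.
pose F1 (w : H * H) : \bar R := (if (0 < height w.2)%R then
     (`|f w.2 - f (displace w.2 w.1)| `^ p * height w.2 `^ (- (s * p + alpha)))%:E else 0)%E.
have mF1 : measurable_fun setT F1.
  apply: measurable_fun_ifT; last exact: measurable_cst.
    by apply: measurable_lt; [exact: measurable_cst|exact: measurable_height].
  by apply/measurable_EFinP; exact: (menergy mw2 mw1).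
have F10 w : (0 <= F1 w)%E.
  by rewrite /F1; case: ifP => // _; rewrite lee_fin mulr_ge0 ?powR_ge0.
have me := measurable_fun_fubini_tonelli_F (m2 := L) F1 mF1 F10.
apply: measurable_fun_ifT; last exact: measurable_cst.
  by apply: measurable_lt; [exact: measurable_cst|exact: measurable_height].
apply: emeasurable_funM; last exact: me.
by apply/measurable_EFinP; exact: measurable_rho.
Qed.

Lemma slice_energy_ge0 eta : (0 <= slice_energy eta)%E.
Proof.
apply: integral_ge0 => xi _.
by case: ifP => // _; rewrite lee_fin mulr_ge0 ?powR_ge0.
Qed.

End representation.

(** * Integrals of powers on the line *)

Section lineint.
Context {R : realType}.
Local Notation rR := (measurableTypeR R).
Local Notation mu := (@lebesgue_measure R).

(** A form of the fundamental theorem that takes a primitive on the closed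
    interval, so that no one-sided limits have to be checked. *)
Lemma FTC_is_derive (f F : R -> R) (a b : R) : a < b ->
  (forall x, a <= x <= b -> is_derive x 1 F (f x)) ->
  (forall x, a <= x <= b -> derivable f x 1) ->
  (\int[mu]_(x in `[a, b]) (f x)%:E = (F b - F a)%:E)%E.
Proof.
move=> ab dF df.
have iab x : x \in `]a, b[ -> a <= x <= b.
  by rewrite in_itv /= => /andP[/ltW -> /ltW ->].
rewrite (@continuous_FTC2 _ f F)//.
- apply: derivable_within_continuous => x; rewrite in_itv => xab; exact: df.
- have c x : a <= x <= b -> {for x, continuous F}.
    move=> xab; apply: differentiable_continuous; apply/derivable1_diffP.
    by have [] := dF _ xab.
  split => [x xab| |].
  + by have [] := dF _ (iab _ xab).
  + by apply: cvg_at_right_filter; apply: c; rewrite lexx ltW.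
  + by apply: cvg_at_left_filter; apply: c; rewrite lexx ltW.
- move=> x xab; rewrite derive1E; have [_] := dF _ (iab _ xab); exact.
Qed.

Lemma integral_exprn k (r : R) : 0 <= r ->
  (\int[mu]_(x in `]0%R, r]) (x ^+ k)%:E = (r ^+ k.+1 / k.+1%:R)%:E)%E.
Proof.
rewrite le_eqVlt => /predU1P[<-|r0].
  by rewrite set_itvoc0 integral_set0 expr0n /= mul0r.
rewrite integral_itv_obnd_cbnd; last first.
  by apply/measurable_EFinP; apply: measurable_funTS; exact: exprn_measurable.
have dF x : 0 <= x <= r -> is_derive x 1 (fun x : R => k.+1%:R^-1 * x ^+ k.+1) (x ^+ k).
  move=> _; have H := is_deriveZ (k.+1%:R^-1 : R) (is_deriveX k.+1 (is_derive_id (x : R^o) 1)).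
  rewrite [X in is_derive _ _ X](_ : _ = k.+1%:R^-1 \*: (@id R ^+ k.+1 : R -> R)); last first.
    by apply/funext => y; rewrite /= fctE.
  apply: (is_derive_eq H).
  by rewrite -[LHS]/(_ * (_ * _)) /= mulr1 mulrA mulVf ?mul1r// pnatr_eq0.
have df x : 0 <= x <= r -> derivable (fun x : R => x ^+ k) x 1.
  by move=> _; exact: exprn_derivable.
by rewrite (FTC_is_derive r0 dF df) /= expr0n /= mulr0 subr0 mulrC.
Qed.

Lemma derivable_powR1 (c x : R) : 0 < x -> derivable (@powR R ^~ c) x 1.
Proof. by move=> x0; apply: derivable_powR; rewrite in_itv /= x0. Qed.

Lemma is_derive_powR_prim (c x : R) : c != 0 -> 0 < x ->
  is_derive x 1 (fun x => c^-1 * x `^ c) (x `^ (c - 1)).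
Proof.
move=> c0 x0; have := is_derive1_powR c x0 => H.
apply: (is_derive_eq (is_deriveZ c^-1 H)).
by rewrite -[LHS]/(_ * _) mulrA mulVf// mul1r.
Qed.

Lemma integral_powR_bnd (c a b : R) : c != 0 -> 0 < a -> a < b ->
  (\int[mu]_(x in `[a, b]) (x `^ (c - 1))%:E = ((b `^ c - a `^ c) / c)%:E)%E.
Proof.
move=> c0 a0 ab; have dF x : a <= x <= b -> is_derive x 1 (fun x => c^-1 * x `^ c) (x `^ (c - 1)).
  by move=> /andP[ax _]; apply: is_derive_powR_prim => //; exact: lt_le_trans ax.
have df x : a <= x <= b -> derivable (@powR R ^~ (c - 1)) x 1.
  by move=> /andP[ax _]; apply: derivable_powR1; exact: lt_le_trans ax.
by rewrite (FTC_is_derive ab dF df) -mulrBr mulrC.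
Qed.

Lemma integral_powR_near0 (c : R) : 0 < c ->
  (\int[mu]_(x in `]0%R, 1%R]) (x `^ (c - 1))%:E <= (c^-1)%:E)%E.
Proof.
move=> c0.
pose F (k : nat) : set rR := `[k.+2%:R^-1, 1]%classic.
have -> : `]0%R, 1%R]%classic = \bigcup_k F k.
  apply/seteqP; split => x /=.
    rewrite in_itv /= => /andP[x0 x1].
    exists (Num.truncn x^-1) => //; rewrite /F /= in_itv /= x1 andbT.
    rewrite -[leRHS]invrK lef_pV2 ?posrE ?invr_gt0//.
    apply: le_trans (ltW (truncnS_gt _)) _; by rewrite ler_nat.
  move=> [k _]; rewrite /F /= !in_itv /= => /andP[kx ->]; rewrite andbT.
  by apply: lt_le_trans kx; rewrite invr_gt0.
have cv := @ge0_nondecreasing_set_cvg_integral _ rR R F (fun x : rR => (x `^ (c - 1))%:E) mu.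
have mp : measurable_fun setT (fun x : rR => (x `^ (c - 1))%:E).
  apply/measurable_EFinP; exact: (measR_powR _ (@measurable_id _ rR setT)).
have {}cv := cv _ (fun i => measurable_itv _) (fun i => measurable_funTS mp)
  (fun i x _ => powR_ge0 _ _).
rewrite -(cvg_lim _ (cv _))//; last first.
  move=> i j ij; apply/subsetPset => x; rewrite /F /= !in_itv /= => /andP[ix ->].
  rewrite andbT; apply: le_trans ix; rewrite lef_pV2 ?posrE// ler_nat !ltnS//.
apply: lime_le.
  apply: cvgP; apply: cv => i j ij; apply/subsetPset => x; rewrite /F /= !in_itv /= => /andP[ix ->].
  by rewrite andbT; apply: le_trans ix; rewrite lef_pV2 ?posrE// ler_nat !ltnS//.
apply: nearW => k; rewrite integral_powR_bnd ?gt_eqF ?invr_gt0// ?invf_lt1// ?ltr1n//.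
rewrite lee_fin powR1 ler_pdivrMr// mulVf ?gt_eqF// gerBl powR_ge0//.
Qed.

Lemma integral_powR_neary (c : R) : 0 < c ->
  (\int[mu]_(x in `[1%R, +oo[) (x `^ (- c - 1))%:E = (c^-1)%:E)%E.
Proof.
move=> c0.
have nc0 : - c != 0 by rewrite oppr_eq0 gt_eqF.
rewrite (@ge0_continuous_FTC2y _ _ (fun x => (- c)^-1 * x `^ (- c)) 1 0).
- by rewrite powR1 mulr1 sub0e invrN -EFinN opprK.
- by move=> x _; exact: powR_ge0.
- apply: derivable_within_continuous => x; rewrite in_itv /= andbT => x1.
  by apply: derivable_powR1; exact: lt_le_trans x1.
- rewrite -[X in _ --> X](mulr0 ((- c)^-1)); apply: cvgMr.
  apply/cvgr0Pnorm_lt => e e0.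
  near=> x.
  have x0 : 0 < x by near: x; apply: nbhs_pinfty_gt; exact: num_real.
  have xe : e^-1 `^ c^-1 < x by near: x; apply: nbhs_pinfty_gt; exact: num_real.
  rewrite ger0_norm ?powR_ge0// powRN invf_plt ?posrE ?powR_gt0//.
  have -> : e^-1 = (e^-1 `^ c^-1) `^ c.
    by rewrite -powRrM mulVf ?gt_eqF// powRr1 ?invr_ge0 ?ltW.
  by apply: gt0_ltr_powR; rewrite ?nnegrE ?powR_ge0// ?ltW.
- move=> x x1; have x0 : 0 < x by exact: lt_trans x1.
  by have [] := is_derive_powR_prim nc0 x0.
- have cF : {for (1 : R), continuous (fun x : R => (- c)^-1 * x `^ (- c))}.
    apply: differentiable_continuous; apply/derivable1_diffP.
    by have [] := is_derive_powR_prim nc0 (@ltr01 R).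
  by apply: cvg_at_right_filter; exact: cF.
- move=> x; rewrite in_itv /= andbT => x1; have x0 : 0 < x by exact: lt_trans x1.
  by rewrite derive1E; have [_] := is_derive_powR_prim nc0 x0; exact.
Unshelve. all: by end_near.
Qed.

End lineint.

(** * Integrals of radial functions *)

Section polar.
Context {R : realType}.
Local Notation rR := (measurableTypeR R).
Local Notation mu := (@lebesgue_measure R).
Local Open Scope ereal_scope.

Lemma integral_rV_hyperplane d (c : R) (f : 'rV[rR]_d.+1 -> \bar R) :
  measurable_fun setT f -> (forall x, 0 <= f x) ->
  (forall x : 'rV[rR]_d.+1, x ord0 ord0 != c -> f x = 0) ->
  \int[lebesgue_rV d.+1]_x f x = 0.
Proof.
move=> mf f0 fc; rewrite (ge0_integral_cons_rV mf f0).
have mfc := measurableT_comp mf (@measurable_cons_rV R d).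
have ms := measurable_fun_fubini_tonelli_F (m2 := lebesgue_rV d) _ mfc (fun=> f0 _).
rewrite -(@integral_setD1 R _ c); last 2 first.
- by apply: measurableD.
- exact: measurable_funTS.
apply: integral0_eq => x [_ /= /eqP xc].
by rewrite integral0_eq// => u _; apply: fc; rewrite cons_rV0.
Qed.

Lemma dot_gt0 k (x : 'rV[R]_k) : (0 < dot x x)%R = (x != 0%R).
Proof.
rewrite lt_neqAle dot_ge0 andbT eq_sym; congr (~~ _); apply/idP/eqP => [/eqP d0|->].
  apply/rowP => i; rewrite mxE; apply/eqP; rewrite -sqrf_eq0 expr2.
  move: d0 => /eqP; rewrite /dot psumr_eq0; last by move=> j _; rewrite -expr2 sqr_ge0.
  by move=> /allP/(_ i (mem_index_enum _)).
by rewrite /dot big1// => i _; rewrite mxE mul0r.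
Qed.

Lemma coneE k : cone (@unit_sphere R k) = [set x | (0 < dot x x <= 1)%R].
Proof.
apply/seteqP; split => x /=.
  move=> [r]; rewrite /= in_itv /= => /andP[r0 r1] [w w1 <-].
  have ww : dot w w = 1%R.
    by rewrite -(sqr_sqrtr (dot_ge0 w)) w1 expr1n.
  by rewrite dotZ ww mulr1 mulr_gt0//= mulr_ile1// ltW.
move=> /andP[d0 d1].
pose r := Num.sqrt (dot x x).
have r0 : (0 < r)%R by rewrite sqrtr_gt0.
exists r; first by rewrite /= in_itv /= r0 -(sqrtr1 R) ler_wsqrtr.
exists (r^-1 *: x)%R; last by rewrite scalerA mulfV ?gt_eqF// scale1r.
rewrite /unit_sphere /= dotZ -invfM -expr2 sqr_sqrtr ?dot_ge0//.
by rewrite mulVf ?sqrtr1// gt_eqF.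
Qed.

Let ball_ind k (c : R) (x : 'rV[rR]_k) : \bar R := if (dot x x <= c)%R then 1 else 0.

Let mdot k : measurable_fun setT (fun x : 'rV[rR]_k => dot x x : rR).
Proof. by apply: measR_dot; exact: measurable_id. Qed.

Let mball k c : measurable_fun setT (@ball_ind k c).
Proof.
apply: measurable_fun_ifT; try exact: measurable_cst.
by apply: measurable_fun_ler; [exact: mdot|exact: measurable_cst].
Qed.

Let ball0 k c x : 0 <= @ball_ind k c x.
Proof. by rewrite /ball_ind; case: ifP. Qed.

Lemma measurable_cone k : measurable (cone (@unit_sphere R k) : set 'rV[rR]_k).
Proof.
rewrite coneE.
have -> : [set x : 'rV[R]_k | (0 < dot x x <= 1)%R] =
    setT `&` (fun x : 'rV[rR]_k => dot x x : rR) @^-1` `]0%R, 1%R]%classic.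
  by rewrite setTI; apply/seteqP; split => x /=; rewrite in_itv.
by apply: (@mdot k measurableT); exact: measurable_itv.
Qed.

(** Dilation to the unit ball; the centre, missing from the cone, lies in a null
    hyperplane. *)
Lemma integral_ball k (r : R) : (0 <= r)%R ->
  \int[lebesgue_rV k.+1]_x ball_ind (r ^+ 2) x =
  (r ^+ k.+1)%:E * lebesgue_rV k.+1 (cone (@unit_sphere R k.+1)).
Proof.
rewrite le_eqVlt => /predU1P[<-|r0].
  rewrite !expr0n /= mul0e; apply: (integral_rV_hyperplane (c := 0) (mball _) (@ball0 _ _)).
  move=> x x0; rewrite /ball_ind ifF//; apply/negbTE; rewrite -ltNge dot_gt0.
  by apply: contra x0 => /eqP ->; rewrite mxE.
rewrite (ge0_integral_affine_rV 0 r0 (mball _) (@ball0 _ _)); apply: (congr1 (mule _)).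
rewrite -[in RHS](setIT (cone _)) -(integral_indic _ measurableT (@measurable_cone k.+1)).
pose o (x : 'rV[rR]_k.+1) : \bar R := if x == 0%R then 1 else 0.
have mi : measurable_fun setT (fun x : 'rV[rR]_k.+1 => (\1_(cone (@unit_sphere R k.+1)) x)%:E : \bar R).
  apply/measurable_EFinP; exact: (measurable_indic (@measurable_cone k.+1)).
have mo : measurable_fun setT o.
  apply: (eq_measurable_fun (fun x : 'rV[rR]_k.+1 => if (dot x x <= 0)%R then 1 else 0 : \bar R)).
    by move=> x _; rewrite /o leNgt dot_gt0 negbK.
  exact: mball.
have o0 x : 0 <= o x by rewrite /o; case: ifP.
rewrite -[RHS]adde0 -[X in _ + X](_ : \int[lebesgue_rV k.+1]_x o x = 0); last first.
  apply: (integral_rV_hyperplane (c := 0) mo o0) => x x0; rewrite /o ifF//.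
  by apply/negbTE; apply: contra x0 => /eqP ->; rewrite mxE.
have i0 (x : 'rV[rR]_k.+1) : setT x -> 0 <= (\1_(cone (@unit_sphere R k.+1)) x)%:E :> \bar R.
  by move=> _; rewrite lee_fin.
rewrite -(ge0_integralD (lebesgue_rV k.+1) measurableT i0 mi (fun x _ => o0 x) mo).
apply: eq_integral => x _; rewrite /ball_ind add0r dotZ -expr2 ger_pMr ?exprn_gt0//.
rewrite indicE coneE /o; have [x0|x0] := eqVneq x 0%R.
  have d0 : dot x x = 0%R.
    by apply/eqP; rewrite eq_le dot_ge0 andbT leNgt dot_gt0 x0 eqxx.
  by rewrite memNset /= d0 ?ltxx// ler01 add0e.
rewrite adde0; case: ifP => d1; first by rewrite mem_set//= dot_gt0 x0.
by rewrite memNset//= d1 andbF.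
Qed.


Section layer.
Variables (k : nat) (a : R).
Hypothesis a0 : (0 < a)%R.

Let psi (u : R) : R := ((1 + u) `^ (- a))%R.
Let c (s : R) : R := (s `^ (- a^-1) - 1)%R.

(** Superlevel sets of (1 + |x|^2)^(- a) are balls. *)
Lemma psi_level (s u : R) : (0 < s)%R -> (0 <= u)%R -> (s <= psi u)%R = (u <= c s)%R.
Proof.
move=> s0 u0; have u1 : (0 < 1 + u)%R by rewrite ltr_pwDl.
rewrite /psi /c lerBrDl.
have sE : s = ((s `^ (- a^-1)) `^ (- a))%R.
  by rewrite -powRrM mulrNN mulVf ?gt_eqF// powRr1// ltW.
have : (0 < s `^ (- a^-1))%R by rewrite powR_gt0.
rewrite [in LHS]sE; move: (s `^ (- a^-1))%R => t t0.
rewrite !powRN lef_pV2 ?posrE ?powR_gt0//.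
have n1 : (1 + u)%R \in Num.nneg by rewrite nnegrE ltW.
have n2 : t \in Num.nneg by rewrite nnegrE ltW.
apply/idP/idP => [|h]; last exact: (ge0_ler_powR (ltW a0) n1 n2).
rewrite !leNgt; apply: contra => h; exact: (gt0_ltr_powR a0 n2 n1).
Qed.

Let ind (s u : R) : \bar R := if ((0 < s) && (s <= psi u))%R then 1 else 0.

Lemma integral_layer u : (0 <= u)%R -> \int[mu]_s ind s u = (psi u)%:E.
Proof.
move=> u0.
rewrite (_ : ind^~ u = EFin \o \1_(`]0%R, psi u]%classic : set rR)); last first.
  apply/funext => s; rewrite /ind /= indicE mem_setE in_itv /=.
  by case: ifP.
rewrite integral_indic//= setIT lebesgue_measure_itv /= lte_fin powR_gt0 ?ltr_pwDl//.
by rewrite sube0.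
Qed.

Let B (s : R) : R := if ((0 < s) && (0 <= c s))%R then (Num.sqrt (c s) ^+ k.+1)%R else 0%R.

Let mc : measurable_fun setT (c : rR -> rR).
Proof.
apply: measR_sub; last exact: measurable_cst.
exact: (measR_powR _ (@measurable_id _ rR setT)).
Qed.

Let mB : measurable_fun setT (B : rR -> rR).
Proof.
apply: measurable_fun_ifT; last exact: measurable_cst.
  apply: measurable_and; first by apply: measurable_lt; [exact: measurable_cst|exact: measurable_id].
  by apply: measurable_fun_ler; [exact: measurable_cst|exact: mc].
by apply: measR_exp; apply: measR_sqrt; exact: mc.
Qed.

Let B0 s : (0 <= B s)%R.
Proof. by rewrite /B; case: ifP => // _; rewrite exprn_ge0// sqrtr_ge0. Qed.

Let mind d (T : measurableType d) (s u : T -> rR) : measurable_fun setT s ->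
  measurable_fun setT u -> measurable_fun setT (fun x => ind (s x) (u x)).
Proof.
move=> ms mu'; apply: measurable_fun_ifT; try exact: measurable_cst.
apply: measurable_and; first by apply: measurable_lt; [exact: measurable_cst|exact: ms].
apply: measurable_fun_ler; first exact: ms.
by apply: measR_powR; apply: measR_add; [exact: measurable_cst|exact: mu'].
Qed.

Let ind0 s u : 0 <= ind s u. Proof. by rewrite /ind; case: ifP. Qed.

Let omega := lebesgue_rV k.+1 (cone (@unit_sphere R k.+1)).

Lemma integral_radial_rV : \int[lebesgue_rV k.+1]_x (psi (dot x x))%:E =
  \int[mu]_s (B s)%:E * omega.
Proof.
transitivity (\int[lebesgue_rV k.+1]_x \int[mu]_s ind s (dot x x)).
  by apply: eq_integral => x _; rewrite integral_layer ?dot_ge0.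
pose F (w : 'rV[rR]_k.+1 * rR) := ind w.2 (dot w.1 w.1).
have mF : measurable_fun setT F.
  apply: mind; first exact: measurable_snd.
  by apply: measR_dot; exact: measurable_fst.
apply: (etrans (fubini_tonelli (m1 := lebesgue_rV k.+1) (m2 := mu) F mF (fun=> ind0 _ _))).
have w0 : 0 <= omega by exact: measure_ge0.
have mBE : measurable_fun setT (fun s : rR => (B s)%:E) by apply/measurable_EFinP.
rewrite -(ge0_integralZr mu measurableT mBE (fun _ _ => B0 _) w0).
apply: eq_integral => s _; rewrite /F /= /B.
have [s0|s0] := ltP 0%R s; last first.
  by rewrite /= mul0e; apply: integral0_eq => x _; rewrite /ind ltNge s0.
have E x : ind s (dot x x) = if (dot x x <= c s)%R then 1 else 0.
  by rewrite /ind s0 /= psi_level ?dot_ge0.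
have [c0|c0] := leP 0%R (c s).
  rewrite -(integral_ball k (sqrtr_ge0 (c s))).
  by apply: eq_integral => x _; rewrite E /ball_ind sqr_sqrtr.
rewrite /= mul0e; apply: integral0_eq => x _; rewrite E ifF//; apply/negbTE; rewrite -ltNge.
exact: lt_le_trans (dot_ge0 _).
Qed.

Lemma integral_radial_line : \int[mu]_(r in `]0%R, +oo[) (r ^+ k * psi (r ^+ 2))%:E =
  k.+1%:R^-1%:E * \int[mu]_s (B s)%:E.
Proof.
rewrite integral_mkcond.
pose F (w : rR * rR) : \bar R := (if (0 < w.1)%R then (w.1 ^+ k)%:E * ind w.2 (w.1 ^+ 2) else 0).
have mF : measurable_fun setT F.
  apply: measurable_fun_ifT; last exact: measurable_cst.
    by apply: measurable_lt; [exact: measurable_cst|exact: measurable_fst].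
  apply: emeasurable_funM.
    by apply/measurable_EFinP; apply: measR_exp; exact: measurable_fst.
  apply: mind; first exact: measurable_snd.
  by apply: measR_exp; exact: measurable_fst.
have F0 w : 0 <= F w.
  rewrite /F; case: ifP => // w0; apply: mule_ge0; last exact: ind0.
  by rewrite lee_fin exprn_ge0// ltW.
transitivity (\int[mu]_r \int[mu]_s F (r, s)).
  apply: eq_integral => r _; rewrite patchE mem_setE in_itv /= andbT /F /=.
  case: ifP => r0; last by rewrite integral0.
  have rk0 : 0 <= (r ^+ k)%:E by rewrite lee_fin exprn_ge0// ltW.
  have mi : measurable_fun setT (fun s : rR => ind s (r ^+ 2)).
    by apply: mind; [exact: measurable_id|exact: measurable_cst].
  rewrite (ge0_integralZl mu measurableT mi (fun _ _ => ind0 _ _) rk0).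
  by rewrite integral_layer ?sqr_ge0// EFinM.
apply: (etrans (fubini_tonelli (m1 := mu) (m2 := mu) F mF F0)).
have k0 : 0 <= k.+1%:R^-1%:E :> \bar R by rewrite lee_fin invr_ge0.
have mBE : measurable_fun setT (fun s : rR => (B s)%:E) by apply/measurable_EFinP.
rewrite -(ge0_integralZl mu measurableT mBE (fun _ _ => B0 _) k0).
apply: eq_integral => s _; rewrite /F /= /B.
have [s0|s0] := ltP 0%R s; last first.
  rewrite /= mule0; apply: integral0_eq => r _; case: ifP => // _.
  by rewrite /ind (ltNge 0%R s) s0 /= mule0.
have [c0|c0] := leP 0%R (c s); last first.
  rewrite /= mule0; apply: integral0_eq => r _; case: ifP => // _.
  rewrite /ind s0 /= psi_level ?sqr_ge0//.
  by rewrite ifF ?mule0//; apply/negbTE; rewrite -ltNge (lt_le_trans c0)// sqr_ge0.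
rewrite /= -EFinM mulrC -(integral_exprn k (sqrtr_ge0 (c s))) [RHS]integral_mkcond.
apply: eq_integral => r _; rewrite patchE mem_setE in_itv /=.
case: ifP => r0 //=; rewrite /ind s0 /= psi_level ?sqr_ge0//.
have -> : (r ^+ 2 <= c s)%R = (r <= Num.sqrt (c s))%R.
  rewrite -[in LHS](sqr_sqrtr c0) ler_pXn2r// ?nnegrE ?sqrtr_ge0// ltW//.
by case: ifP; rewrite ?mule1 ?mule0.
Qed.

(** Polar coordinates by the layer-cake formula.  Both integrals are integrals
    over s of the superlevel set at s, which is a ball of radius sqrt (c s) on the
    left and the interval from 0 to sqrt (c s) on the right; its measures
    omega r^(k + 1) and r^(k + 1) / (k + 1) are proportional. *)
Lemma integral_radial : \int[lebesgue_rV k.+1]_x (psi (dot x x))%:E =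
  sphere_area R k.+1 *
  \int[mu]_(r in `]0%R, +oo[) (r ^+ k * psi (r ^+ 2))%:E.
Proof.
rewrite integral_radial_rV integral_radial_line /sphere_area /surface_measure -/omega.
rewrite muleA (muleC _%:E omega) -(muleA omega) -EFinM mulfV ?pnatr_eq0// mule1.
exact: muleC.
Qed.

End layer.
End polar.

(** * The two constants as an integral of the density *)

Section constants.
Context {R : realType}.
Variable m : nat.
Local Notation n := m.+1.
Local Notation rR := (measurableTypeR R).
Local Notation mu := (@lebesgue_measure R).
Local Notation H := ('rV[rR]_n * 'rV[rR]_n * rR)%type.
Local Notation L := (@lebesgue_heis R n).
Local Open Scope ereal_scope.

Lemma integral_separable (phi b chi : rR -> rR) :
  measurable_fun setT phi -> measurable_fun setT b -> measurable_fun setT chi ->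
  (forall x, 0 <= phi x)%R -> (forall x, 0 <= b x)%R -> (forall x, 0 <= chi x)%R ->
  \int[L]_eta (phi (height eta) * b (wsqr eta) * chi eta.2)%:E =
  \int[mu]_x (phi x)%:E * \int[lebesgue_rV (m + n)]_x (b (1 + dot x x))%:E *
  \int[mu]_x (chi x)%:E.
Proof.
move=> mphi mb mchi phi0 b0 chi0.
have mid := @measurable_id _ H setT.
have mF : measurable_fun setT (fun eta : H => (phi (height eta) * b (wsqr eta) * chi eta.2)%:E).
  apply/measurable_EFinP; apply: measR_mul; first apply: measR_mul.
  - exact: (measurableT_comp mphi (measurable_height mid)).
  - exact: (measurableT_comp mb (measurable_wsqr mid)).
  - exact: (measurableT_comp mchi measurable_snd).
rewrite (ge0_integral_heis_cons mF); last first.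
  by move=> x; rewrite lee_fin !mulr_ge0.
have mphiE : measurable_fun setT (fun x : rR => (phi x)%:E) by apply/measurable_EFinP.
have mchiE : measurable_fun setT (fun x : rR => (chi x)%:E) by apply/measurable_EFinP.
pose B (w : 'rV[rR]_m * 'rV[rR]_n) : R := b (1 + dot w.1 w.1 + dot w.2 w.2)%R.
have mB : measurable_fun setT (fun w => (B w)%:E).
  apply/measurable_EFinP; apply: (measurableT_comp mb).
  apply: measR_add; last by apply: measR_dot; exact: measurable_snd.
  by apply: measR_add; [exact: measurable_cst|apply: measR_dot; exact: measurable_fst].
set X := \int[mu]_x (chi x)%:E.
have X0 : 0 <= X by apply: integral_ge0 => x _; rewrite lee_fin.
set Y := \int[lebesgue_rV (m + n)]_x (b (1 + dot x x))%:E.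
have Y0 : 0 <= Y by apply: integral_ge0 => x _; rewrite lee_fin.
have YE : Y = \int[lebesgue_rV m]_u \int[lebesgue_rV n]_y (B (u, y))%:E.
  rewrite /Y ge0_integral_row_mx; last 2 first.
  - apply/measurable_EFinP; apply: (measurableT_comp mb).
    apply: measR_add; first exact: measurable_cst.
    by apply: measR_dot; exact: measurable_id.
  - by move=> x; rewrite lee_fin.
  apply: eq_integral => u _; apply: eq_integral => y _; rewrite /B /=.
  congr (b _)%:E; rewrite -addrA; congr (1 + _)%R.
  rewrite /dot big_split_ord /=; congr (_ + _)%R.
    by apply: eq_bigr => i _; rewrite row_mxEl.
  by apply: eq_bigr => i _; rewrite row_mxEr.
rewrite -muleA -(ge0_integralZr mu measurableT mphiE (fun _ _ => phi0 _) (mule_ge0 Y0 X0)).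
apply: eq_integral => a _.
transitivity (\int[lebesgue_rV m]_u \int[lebesgue_rV n]_y ((phi a)%:E * X * (B (u, y))%:E)).
  apply: eq_integral => u _; apply: eq_integral => y _.
  have k0 : 0 <= (phi a * B (u, y))%:E by rewrite lee_fin; apply: mulr_ge0; [exact: phi0|exact: b0].
  rewrite -muleA (muleC X) muleA -EFinM.
  rewrite -(ge0_integralZl mu measurableT mchiE (fun _ _ => chi0 _) k0).
  apply: eq_integral => t _; rewrite height_cons /wsqr /= tail_cons_rV -EFinM.
  by congr (EFin _).
have aX0 : 0 <= (phi a)%:E * X by rewrite mule_ge0// lee_fin.
have mBu u := measurableT_comp mB (pair1_measurable u).
have B0 u y : 0 <= (B (u, y))%:E by rewrite lee_fin; exact: b0.
have mB1 := measurable_fun_fubini_tonelli_F (m2 := lebesgue_rV n) _ mB (fun _ => b0 _).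
rewrite [in RHS]muleA [in RHS](muleC _%:E Y) -[in RHS]muleA [in RHS](muleC Y) YE.
rewrite -(ge0_integralZl (lebesgue_rV m) measurableT mB1 (fun u _ => integral_ge0 (lebesgue_rV n) (fun y _ => B0 u y)) aX0).
apply: eq_integral => u _.
exact: (ge0_integralZl (lebesgue_rV n) measurableT (mBu u) (fun _ _ => B0 _ _) aX0).
Qed.

Lemma measurable_1Dsqr_powR (a : R) :
  measurable_fun setT (fun v : rR => (1 + v ^+ 2) `^ a : rR)%R.
Proof.
apply: measR_powR; apply: measR_add; first exact: measurable_cst.
exact: (measR_exp _ (@measurable_id _ rR setT)).
Qed.

Lemma integral_even (f : rR -> \bar R) : measurable_fun setT f ->
  (forall x, 0 <= f x) -> (forall x, f (- x)%R = f x) ->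
  \int[mu]_x f x = 2%:E * \int[mu]_(x in `]0%R, +oo[) f x.
Proof.
move=> mf f0 fN.
rewrite mule_natl mule2n.
have -> : [set: rR] = `]-oo, 0%R]%classic `|` `]0%R, +oo[%classic.
  apply/seteqP; split => x //= _; rewrite !in_itv /= andbT.
  by have [] := leP x 0%R; [left|right].
rewrite ge0_integral_setU//=.
- congr (_ + _).
  rewrite integral_itv_obnd_cbnd; last exact: measurable_funTS.
  rewrite (@ge0_integration_by_substitution0 R f mf f0).
  by apply: eq_integral => x _; rewrite fN.
- exact: measurable_funTS.
- rewrite disj_set2E; apply/eqP; rewrite -subset0 => x /=.
  by rewrite !in_itv /= andbT ltNge => -[-> ].
Qed.

Variables s p alpha : R.
Let beta := (s * p + alpha)%R.
Let gam := ((beta - 1) / p)%R.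
Hypothesis beta1 : (1 < beta)%R.
Hypothesis sp0 : (0 < s * p)%R.
Hypothesis alpha0 : (0 <= alpha)%R.

(** rho separates the variables.  The factor in (u, y), of dimension 2 n - 1, is
    radial and gives the sphere area and the second factor of cal_I; the factor
    in t gives the first, doubled by parity. *)
Lemma integral_rho (phi : rR -> rR) : measurable_fun setT phi ->
  (forall x, 0 <= phi x)%R ->
  2%:E * \int[L]_eta (if (0 < height eta)%R then (rho s p alpha eta)%:E * (phi (height eta))%:E else 0) =
  C_const n s p alpha *
  (2%:E * \int[mu]_x (if (0 < x)%R then (phi x * x `^ (- (1 + beta)))%:E else 0)).
Proof.
move=> mphi phi0.
(* all powers of the height, those of rho included *)
pose phi' (x : rR) : rR := if (0 < x)%R then (phi x * x `^ (- (1 + beta)))%R else 0%R.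
have mphi' : measurable_fun setT phi'.
  apply: measurable_fun_ifT; last exact: measurable_cst.
    by apply: measurable_lt; [exact: measurable_cst|exact: measurable_id].
  by apply: measR_mul => //; apply: measR_powR; exact: measurable_id.
have phi'0 x : (0 <= phi' x)%R.
  by rewrite /phi'; case: ifP => // _; rewrite mulr_ge0 ?powR_ge0.
pose e1 := (((n + n)%:R + beta) / 2)%R.
pose e2 := (((n + n)%:R + 2 + s * p) / 4)%R.
transitivity (2%:E * \int[L]_eta (phi' (height eta) * (wsqr eta) `^ (- e1) *
     (1 + eta.2 ^+ 2) `^ (- e2))%:E).
  apply: (congr1 (mule 2%:E)); apply: eq_integral => eta _; rewrite /phi'.
  case: ifP => h0; last by rewrite !mul0r.
  rewrite -EFinM /rho; congr EFin.
  have -> : (- ((n + n)%:R + 2 + s * p) / 4 = - e2)%R by rewrite /e2 mulNr.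
  by rewrite -/beta -/e1; ring.
have mb : measurable_fun setT (fun x : rR => x `^ (- e1) : rR)%R.
  by apply: measR_powR; exact: measurable_id.
have b0 (x : rR) : (0 <= x `^ (- e1))%R by exact: powR_ge0.
have mchi := measurable_1Dsqr_powR (- e2).
have chi0 (x : rR) : (0 <= (1 + x ^+ 2) `^ (- e2))%R by exact: powR_ge0.
rewrite (integral_separable mphi' mb mchi phi'0 b0 chi0).
have mchiE : measurable_fun setT (fun v : rR => ((1 + v ^+ 2) `^ (- e2))%:E)%R.
  exact/measurable_EFinP.
rewrite (integral_even mchiE (fun _ => chi0 _)); last by move=> x; rewrite sqrrN.
have -> : (\int[mu]_x (phi' x)%:E = \int[mu]_x (if (0 < x)%R then (phi x * x `^ (- (1 + beta)))%:E else 0)).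
  by apply: eq_integral => x _; rewrite /phi'; case: ifP.
have e10 : (0 < e1)%R by rewrite divr_gt0// ltr_wpDl// (lt_trans ltr01).
rewrite addnS (integral_radial (m + m) e10) -addSn.
rewrite /C_const /cal_I.
have -> : (hom_dim n - 2 = n + n)%N by rewrite /hom_dim addnK mul2n addnn.
have -> : (2 * n - 1 = m.+1 + m)%N by rewrite mul2n -addnn addnS subn1.
have -> : (n + n - 2 = m + m)%N by rewrite addnS addSn subn2.
have -> : \int[mu]_(t in `]0%R, +oo[) ((1 + t ^+ 2) `^ (((n + n)%:R + 2 + s * p) / 4))^-1%:E =
   \int[mu]_(t in `]0%R, +oo[) ((1 + t ^+ 2) `^ (- e2))%:E.
  by apply: eq_integral => x _; rewrite powRN.
have -> : \int[mu]_(r in `]0%R, +oo[) (r ^+ (m + m) / (1 + r ^+ 2) `^ (((n + n)%:R + s * p + alpha) / 2))%:E =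
   \int[mu]_(r in `]0%R, +oo[) (r ^+ (m + m) * (1 + r ^+ 2) `^ (- e1))%:E.
  by apply: eq_integral => x _; rewrite powRN /e1 /beta addrA.
rewrite (addSn m m).
set A := \int[mu]_x _; set S := sphere_area _ _; set I1 := \int[mu]_(_ in _) _; set I2 := \int[mu]_(_ in _) _.
rewrite (muleC A (S * I1)) -!muleA.
by rewrite (muleCA A) (muleCA I2 I1) (muleCA I2) (muleC I2).
Qed.

(** The part x < 1 becomes the integral of Lambda_const by tau = 1 - x, the part
    x >= 1 gives 1 / beta. *)
Lemma integral_Lambda :
  2%:E * \int[mu]_x (if (0 < x)%R then
     ((if (x < 1)%R then `|1 - (1 - x) `^ gam| `^ p else 1) * x `^ (- (1 + beta)))%:E else 0) =
  Lambda_const s p alpha.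
Proof.
have beta0 : (0 < beta)%R by exact: lt_trans beta1.
have mid := @measurable_id _ rR setT.
have mp : measurable_fun setT (fun x : rR => x `^ (- (1 + beta)) : rR)%R by exact: measR_powR.
have mq : measurable_fun setT (fun x : rR => `|1 - (1 - x) `^ gam| `^ p * x `^ (- (1 + beta)) : rR)%R.
  apply: measR_mul => //; apply: measR_powR; apply: measR_norm.
  apply: measR_sub; first exact: measurable_cst.
  by apply: measR_powR; apply: measR_sub; [exact: measurable_cst|exact: mid].
pose G (x : rR) : \bar R := if ((0 < x) && (x < 1))%R then
   (`|1 - (1 - x) `^ gam| `^ p * x `^ (- (1 + beta)))%:E else 0.
pose K (x : rR) : \bar R := if (1 <= x)%R then (x `^ (- beta - 1))%:E else 0.
have mG : measurable_fun setT G.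
  apply: measurable_fun_ifT; last exact: measurable_cst.
    by apply: measurable_and; apply: measurable_lt; try exact: measurable_cst; exact: mid.
  exact/measurable_EFinP.
have mK : measurable_fun setT K.
  apply: measurable_fun_ifT; last exact: measurable_cst.
    by apply: measurable_fun_ler; [exact: measurable_cst|exact: mid].
  by apply/measurable_EFinP; exact: measR_powR.
have G0 x : 0 <= G x by rewrite /G; case: ifP => // _; rewrite lee_fin mulr_ge0 ?powR_ge0.
have K0 x : 0 <= K x by rewrite /K; case: ifP => // _; rewrite lee_fin powR_ge0.
transitivity (2%:E * (\int[mu]_x G x + \int[mu]_x K x)).
  rewrite -(ge0_integralD mu measurableT (fun x _ => G0 x) mG (fun x _ => K0 x) mK).
  apply: (congr1 (mule 2%:E)); apply: eq_integral => x _; rewrite /G /K.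
  rewrite leNgt; have [x0|x0] /= := ltP 0%R x.
    case: ltP => x1 /=; first by rewrite adde0.
    by rewrite add0e mul1r; congr (_ `^ _)%:E; ring.
  by rewrite (le_lt_trans x0 ltr01) adde0.
have -> : \int[mu]_x K x = (beta^-1)%:E.
  rewrite -(integral_powR_neary beta0) [RHS]integral_mkcond.
  by apply: eq_integral => x _; rewrite patchE mem_setE in_itv /= andbT.
rewrite ge0_muleDr ?lee_fin ?invr_ge0 ?(ltW beta0)//; last exact: integral_ge0.
rewrite /Lambda_const -EFinM -/beta; congr (_ * _ + _).
have n1 : (- 1 : R)%R != 0%R by rewrite oppr_eq0 oner_eq0.
rewrite (ge0_integral_affine 1 n1 mG G0) normrN1 mul1e [RHS]integral_mkcond.
apply: eq_integral => x _; rewrite patchE mem_setE in_itv /= mulN1r /G.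
rewrite subr_gt0 gtrBl andbC; case: ifP => // _.
have -> : (1 - (1 - x) = x)%R by ring.
by rewrite powRN /gam /beta addrA.
Qed.

End constants.

(** * Continuous functions are measurable *)

Section continuous_measurable.
Context {R : realType}.
Variable n : nat.
Local Notation rR := (measurableTypeR R).
Local Notation H := ('rV[rR]_n * 'rV[rR]_n * rR)%type.

Let Q := ('rV[int]_n * 'rV[int]_n * int)%type.

Let cell (k : nat) (x : R) : int := Num.floor (x * k.+1%:R).

Let cellH k (xi : H) : Q :=
  (\row_i cell k (xi.1.1 ord0 i), \row_i cell k (xi.1.2 ord0 i), cell k xi.2).

Let pt k (q : int) : R := q%:~R / k.+1%:R.

Let ptH k (q : Q) : @heis R n :=
  (\row_i pt k (q.1.1 ord0 i), \row_i pt k (q.1.2 ord0 i), pt k q.2).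

Let measurable_cell d (T : measurableType d) k (g : T -> rR) q : measurable_fun setT g ->
  measurable [set x | cell k (g x) = q].
Proof.
move=> mg.
have -> : [set x | cell k (g x) = q] =
    setT `&` (fun x => g x * k.+1%:R : rR) @^-1` `[q%:~R, (q + 1)%:~R[%classic.
  rewrite setTI; apply/seteqP; split => x /=; rewrite in_itv /=.
    by move=> <-; exact: Num.Theory.floor_itv.
  by move=> /Num.Theory.floor_def.
have mm : measurable_fun setT (fun x => g x * k.+1%:R : rR).
  by apply: measR_mul => //; exact: measurable_cst.
by apply: mm => //; exact: measurable_itv.
Qed.

Let measurable_cellH k q : measurable [set xi : H | cellH k xi = q].
Proof.
case: q => -[a b] c.
have mid := @measurable_id _ H setT.
have [m11 m12 _] := measurable_triple mid.
have -> : [set xi : H | cellH k xi = (a, b, c)] =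
   (\bigcap_(i in [set: 'I_n]) [set xi : H | cell k (xi.1.1 ord0 i) = a ord0 i] `&`
    \bigcap_(i in [set: 'I_n]) [set xi : H | cell k (xi.1.2 ord0 i) = b ord0 i]) `&`
   [set xi : H | cell k xi.2 = c].
  apply/seteqP; split => xi /=.
    by case=> <- <- <-; split; [split|] => // i _ /=; rewrite mxE.
  move=> [[h1 h2] <-]; rewrite /cellH; congr (_, _, _); apply/rowP => i; rewrite mxE.
    exact: h1.
  exact: h2.
apply: measurableI; last exact: (measurable_cell _ _ measurable_snd).
apply: measurableI; apply: fin_bigcap_measurable; try exact: finite_finset.
  by move=> i _; exact: (measurable_cell _ _ (measR_coord i m11)).
by move=> i _; exact: (measurable_cell _ _ (measR_coord i m12)).
Qed.

Let pt_near k x : `|x - pt k (cell k x)| < k.+1%:R^-1.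
Proof.
have k0 : 0 < k.+1%:R :> R by rewrite ltr0n.
have /andP[h1 h2] := Num.Theory.floor_itv (x * k.+1%:R).
have h3 : pt k (cell k x) <= x by rewrite /pt ler_pdivrMr.
rewrite ger0_norm ?subr_ge0// ltrBlDl /pt -[X in _ + X]mul1r -mulrDl ltr_pdivlMr//.
by move: h2; rewrite intrD.
Qed.

(** The sigma-algebra is generated by the coordinates, not by the open sets.  A
    continuous function is the limit of its values on finer and finer grids,
    which take countably many values on measurable cells. *)
Lemma continuous_measurable_heis (f : @heis R n -> R) :
  continuous f -> measurable_fun [set: H] (f : H -> rR).
Proof.
move=> cf.
apply: (measurable_fun_cvg (h := fun k xi => f (ptH k (cellH k xi)))) => [k|xi _].
  move=> _ B mB; rewrite setTI.
  have -> : (fun xi => f (ptH k (cellH k xi))) @^-1` B =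
     \bigcup_(q in [set: Q]) ([set xi : H | cellH k xi = q] `&` [set xi : H | B (f (ptH k q))]).
    apply/seteqP; split => xi /=; first by move=> h; exists (cellH k xi).
    by move=> [q _ [/= ->]].
  apply: countable_bigcupT_measurable => [|q].
    exact: (@countableP ('rV[int]_n * 'rV[int]_n * int)%type).
  apply: measurableI; first exact: measurable_cellH.
  have [h|h] := pselect (B (f (ptH k q))).
    by rewrite (_ : [set _ | _] = setT)//; apply/seteqP; split.
  by rewrite (_ : [set _ | _] = set0)//; apply/seteqP; split.
apply: (@cvg_comp _ _ _ (fun k => ptH k (cellH k xi)) f _ (nbhs (xi : heis n))); last exact: cf.
apply/cvg_ballP => e e0.
near=> k.
have ke : k.+1%:R^-1 < e :> R.
  near: k; exact: near_infty_natSinv_lt (PosNum e0).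
have bb (x : R) : ball x e (pt k (cell k x)).
  by rewrite -ball_normE /ball_ /=; exact: lt_trans ke.
by split; [split; split => // i j; rewrite !ord1 !mxE|]; exact: bb.
Unshelve. all: by end_near.
Qed.

End continuous_measurable.

(** * Slice energies of normalized functions *)

Section lower.
Context {R : realType}.
Variable m : nat.
Local Notation n := m.+1.
Local Notation rR := (measurableTypeR R).
Local Notation H := ('rV[rR]_n * 'rV[rR]_n * rR)%type.
Local Notation L := (@lebesgue_heis R n).

Definition hardy_density (beta p : R) (f : @heis R n -> R) (xi : @heis R n) : \bar R :=
  if 0 < height xi then (`|f xi| `^ p * height xi `^ (- beta))%:E else 0%E.

Variables s p alpha : R.
Let beta := s * p + alpha.
Let gam := (beta - 1) / p.
Hypothesis p1 : 1 < p.

Variable f : @heis R n -> R.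
Hypothesis mf : measurable_fun [set: H] (f : H -> rR).

Lemma hardy_density_ge0 b xi : (0 <= hardy_density b p f xi)%E.
Proof. by rewrite /hardy_density; case: ifP => // _; rewrite lee_fin mulr_ge0 ?powR_ge0. Qed.

Lemma measurable_hardy_density b : measurable_fun [set: H] (hardy_density b p f).
Proof.
apply: measurable_fun_ifT; last exact: measurable_cst.
  by apply: measurable_lt; [exact: measurable_cst|exact: (measurable_height (@measurable_id _ H setT))].
apply/measurable_EFinP; apply: measR_mul; apply: measR_powR; first exact: measR_norm.
exact: (measurable_height (@measurable_id _ H setT)).
Qed.

Lemma integral_hardy_density_displace b (eta : @heis R n) : height eta < 1 ->
  (\int[L]_xi (if (0 < height xi)%R then
     (`|f (displace xi eta)| `^ p * height xi `^ (- b))%:E else 0) =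
   ((1 - height eta) `^ (b - 1))%:E * \int[L]_xi hardy_density b p f xi)%E.
Proof.
move=> h1; set tau := 1 - height eta; have t0 : 0 < tau by rewrite subr_gt0.
have mP : measurable_fun setT (fun xi : H => displace xi eta : H).
  by apply: measurable_displace; [exact: measurable_id|exact: measurable_cst].
rewrite (integral_displace h1 (measurable_hardy_density b) (hardy_density_ge0 b)) -/tau.
rewrite muleA -EFinM -(ge0_integralZl L measurableT (measurableT_comp (measurable_hardy_density b) mP)
  (fun _ _ => hardy_density_ge0 _ _)); last by rewrite lee_fin mulr_ge0 ?powR_ge0// ltW.
apply: eq_integral => xi _; rewrite /hardy_density /= height_displace -/tau pmulr_lgt0//.
case: ifP => x0; last by rewrite mule0.
rewrite -EFinM; congr EFin.
rewrite [RHS]mulrCA; congr (_ * _).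
have [l lE] := expR_total t0; have [a aE] := expR_total x0.
rewrite -lE -aE -!expRD -!expRM -!expRD; congr expR; ring.
Qed.

Hypothesis f0 : forall xi, height xi <= 0 -> f xi = 0.
Let p0 : 0 < p. Proof. exact: lt_trans p1. Qed.

(** If height eta >= 1 then displace xi eta has nonpositive height, where f is 0. *)
Lemma slice_energy_ge1 (eta : @heis R n) : 1 <= height eta ->
  slice_energy s p alpha f eta = (\int[L]_xi hardy_density beta p f xi)%E.
Proof.
move=> h1; apply: eq_integral => xi _; rewrite /hardy_density.
case: ifP => x0 //; rewrite [f (displace _ _)]f0 ?subr0// height_displace.
by rewrite pmulr_rle0// subr_le0.
Qed.

Hypothesis beta1 : 1 < beta.
Hypothesis fN : (\int[L]_xi hardy_density beta p f xi = 1)%E.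

(** Triangle inequality in L^p for the weight (height xi)^(- beta): f has norm 1
    and f (displace xi eta) has norm (1 - height eta)^gam. *)
Lemma slice_energy_lt1 (eta : @heis R n) : 0 < height eta < 1 ->
  ((`|1 - (1 - height eta) `^ gam| `^ p)%:E <= slice_energy s p alpha f eta)%E.
Proof.
move=> /andP[h0 h1].
set tau := 1 - height eta; have t0 : 0 < tau by rewrite subr_gt0.
have mid := @measurable_id _ H setT.
have mP : measurable_fun setT (fun xi : H => displace xi eta : H).
  by apply: measurable_displace; [exact: mid|exact: measurable_cst].
have mfP := measurableT_comp mf mP.
(* functions whose plain L^p norm is the weighted norm *)
pose cut (g : H -> rR) (xi : H) : rR := if 0 < height xi then g xi * height xi `^ (- (beta / p)) else 0.
have mcut (g : H -> rR) : measurable_fun setT g -> measurable_fun setT (cut g).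
  move=> mg; apply: measurable_fun_ifT; last exact: measurable_cst.
    by apply: measurable_lt; [exact: measurable_cst|exact: measurable_height].
  by apply: measR_mul => //; apply: measR_powR; exact: measurable_height.
have cutE (g : H -> rR) xi : ((`|(cut g xi)%:E| `^ p)%E =
    if (0 < height xi)%R then (`|g xi| `^ p * height xi `^ (- beta))%:E else 0)%E.
  rewrite /cut; case: ifP => x0; last first.
    by rewrite abse0 poweR0r// gt_eqF.
  rewrite abse_EFin poweR_EFin normrM powRM//; congr (_ * _)%:E.
  by rewrite ger0_norm ?powR_ge0// -powRrM mulNr divfK// gt_eqF.
have NE (g : H -> rR) : ('N[L]_p%:E[EFin \o cut g] `^ p = \int[L]_xi
    (if (0 < height xi)%R then (`|g xi| `^ p * height xi `^ (- beta))%:E else 0))%E.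
  rewrite poweR_Lnorm ?gt_eqF//; apply: eq_integral => xi _; exact: cutE.
pose u := cut f; pose v := cut (fun xi => f (displace xi eta)).
pose w := cut (fun xi => f xi - f (displace xi eta)).
have uvw : u = w \+ v.
  apply/funext => xi; rewrite /u /v /w /cut /=; case: ifP => _; last by rewrite addr0.
  by rewrite -mulrDl subrK.
have mw : measurable_fun setT w by apply: mcut; exact: measR_sub.
have mv : measurable_fun setT v by apply: mcut; exact: mfP.
have := minkowski_EFin L mw mv (ltW p1); rewrite -uvw.
have Nu : ('N[L]_p%:E[EFin \o u] = 1)%E.
  have H1 : ('N[L]_p%:E[EFin \o u] `^ p = 1)%E by rewrite NE.
  have := congr1 (fun x => x `^ p^-1)%E H1.
  by rewrite -poweRrM mulfV ?gt_eqF// poweR1r poweRe1// Lnorm_ge0.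
have Nv : ('N[L]_p%:E[EFin \o v] = (tau `^ gam)%:E)%E.
  have H1 : ('N[L]_p%:E[EFin \o v] `^ p = (tau `^ (beta - 1))%:E)%E.
    by rewrite NE (integral_hardy_density_displace _ h1) fN mule1.
  have := congr1 (fun x => x `^ p^-1)%E H1.
  by rewrite -poweRrM mulfV ?gt_eqF// poweRe1 ?Lnorm_ge0// poweR_EFin -powRrM.
rewrite Nu Nv => H1.
have -> : slice_energy s p alpha f eta = ('N[L]_p%:E[EFin \o w] `^ p)%E.
  by rewrite NE.
have tg1 : tau `^ gam <= 1.
  have e : (1 : R) `^ gam = 1 by rewrite powR1.
  rewrite -e; apply: ge0_ler_powR; rewrite ?nnegrE ?(ltW t0)//.
    by rewrite divr_ge0 ?subr_ge0 ?ltW.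
  by rewrite /tau gerBl ltW.
rewrite ger0_norm ?subr_ge0// -poweR_EFin.
apply: gt0_ler_poweR; rewrite ?(ltW p0)//.
- by rewrite in_itv /= lee_fin subr_ge0 tg1 leey.
- by rewrite in_itv /= Lnorm_ge0 leey.
- by rewrite EFinB leeBlDr.
Qed.

End lower.

(** * Smooth functions and cutoffs *)

Section classC.
Context {R : realType} {V : normedModType R}.
Implicit Types f g : V -> R.

Lemma class_C_continuous k f : class_C k f -> continuous f.
Proof. by case: k => [//|k] []. Qed.

Lemma class_CW k f : class_C k.+1 f -> class_C k f.
Proof.
elim: k f => [|k IH] f; first by case.
by move=> [cf df Df]; split => // v; apply: IH; exact: Df.
Qed.

Lemma class_C_cst k (c : R) : class_C k (cst c : V -> R).
Proof.
elim: k c => [|k IH] c /=; first by move=> x; exact: cvg_cst.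
split => [x|x v|v]; first exact: cvg_cst.
  exact: derivable_cst.
rewrite (_ : 'D_v (cst c) = cst 0); first exact: IH.
by apply/funext => x; rewrite derive_cst.
Qed.

Lemma class_C_add k f g : class_C k f -> class_C k g -> class_C k (f + g).
Proof.
elim: k f g => [|k IH] f g /= Cf Cg.
  by move=> x; apply: cvgD; [exact: Cf|exact: Cg].
move: Cf Cg => [cf df Df] [cg dg Dg]; split => [x|x v|v].
- by apply: cvgD; [exact: cf|exact: cg].
- exact: derivableD.
rewrite (_ : 'D_v (f + g) = 'D_v f + 'D_v g); first exact: IH.
by apply/funext => x; rewrite deriveD.
Qed.

Lemma class_C_mul k f g : class_C k f -> class_C k g -> class_C k (f * g).
Proof.
elim: k f g => [|k IH] f g Cf Cg.
  by move=> x; apply: cvgM; [exact: Cf|exact: Cg].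
move: (Cf) (Cg) => [cf df Df] [cg dg Dg]; split => [x|x v|v].
- by apply: cvgM; [exact: cf|exact: cg].
- exact: derivableM.
rewrite (_ : 'D_v (f * g) = f * 'D_v g + g * 'D_v f).
  apply: class_C_add; first exact: (IH _ _ (class_CW Cf) (Dg v)).
  exact: (IH _ _ (class_CW Cg) (Df v)).
by apply/funext => x; rewrite deriveM.
Qed.

Lemma class_C_prod k (I : Type) (r : seq I) (F : I -> V -> R) :
  (forall i, class_C k (F i)) -> class_C k (fun x => \prod_(i <- r) F i x).
Proof.
move=> CF; elim: r => [|i r IH].
  rewrite (_ : (fun _ => _) = cst 1); first exact: class_C_cst.
  by apply/funext => x; rewrite big_nil.
rewrite (_ : (fun _ => _) = F i * (fun x => \prod_(j <- r) F j x)).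
  exact: class_C_mul.
by apply/funext => x; rewrite big_cons.
Qed.

(** For an affine inner function the difference quotients of the composite are
    those of phi in the image direction. *)
Lemma class_C_affine k (phi : R -> R) (l lin : V -> R) : class_C k phi ->
  continuous l -> (forall h x v, l (h *: v + x) = h * lin v + l x) ->
  class_C k (fun x => phi (l x)).
Proof.
move=> + cl lE; elim: k phi => [|k IH] phi.
  move=> cphi x; apply: (@continuous_comp _ _ _ l phi x); [exact: cl|exact: cphi].
move=> [cphi dphi Dphi].
have qE x v : (fun h : R => h^-1 *: (((fun x => phi (l x)) \o shift x) (h *: v) - phi (l x))) =
              (fun h : R => h^-1 *: ((phi \o shift (l x)) (h *: lin v) - phi (l x))).
  by apply/funext => h /=; rewrite lE.
split => [x|x v|v].
- apply: (@continuous_comp _ _ _ l phi x); [exact: cl|exact: cphi].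
- by rewrite /derivable qE; exact: dphi.
rewrite (_ : 'D_v _ = fun x => 'D_(lin v) phi (l x)); first exact: (IH _ (Dphi (lin v))).
by apply/funext => x; rewrite /derive qE.
Qed.

End classC.

Section line_smooth.
Context {R : realType}.
Implicit Types phi psi : R -> R.

Lemma is_derive_continuous phi x d : is_derive x (1 : R) phi d -> {for x, continuous phi}.
Proof.
by move=> [h _]; apply: differentiable_continuous; apply/derivable1_diffP.
Qed.

(** On the line every directional derivative is a multiple of the derivative. *)
Lemma class_C_line k phi (phi' : R -> R) : (forall x, is_derive x (1 : R) phi (phi' x)) ->
  class_C k phi' -> class_C k.+1 phi.
Proof.
move=> dphi C'; split => [x|x v|v].
- exact: is_derive_continuous.
- apply: diff_derivable; apply/derivable1_diffP; by have [] := dphi x.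
rewrite (_ : 'D_v phi = cst v * phi').
  by apply: class_C_mul => //; exact: class_C_cst.
apply/funext => x; rewrite -[RHS]/(v * phi' x); have [h <-] := dphi x.
have dx : differentiable phi x by apply/derivable1_diffP.
rewrite !deriveE// -[in LHS](mulr1 v) -[v * 1]/(v *: 1) linearZ//.
Qed.

Lemma smooth_expR : smooth (@expR R).
Proof.
by elim=> [|k IH]; [exact: continuous_expR|exact: (class_C_line (phi' := expR))].
Qed.

Lemma smooth_mul (V : normedModType R) (f g : V -> R) : smooth f -> smooth g -> smooth (f * g).
Proof. by move=> sf sg k; exact: class_C_mul. Qed.

Lemma smooth_affine (phi : R -> R) (a b : R) : smooth phi -> smooth (fun x => phi (a * x + b)).
Proof.
move=> sphi k; apply: (class_C_affine (l := fun x : R => a * x + b) (lin := fun v : R => a * v)) => //.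
- move=> x; apply: cvgD; last exact: cvg_cst.
  by apply: cvgM; [exact: cvg_cst|exact: cvg_id].
- by move=> h x v; rewrite mulrDr -addrA mulrCA.
Qed.

(** The functions x^(- k) exp (- 1 / x), extended by 0 to x <= 0: the span of
    this family is closed under differentiation, which gives smoothness by
    induction. *)
Definition flat (k : nat) (x : R) : R := if 0 < x then x^-1 ^+ k * expR (- x^-1) else 0.

Lemma flat_le k x : flat k x <= k.+1`!%:R * `|x|.
Proof.
rewrite /flat; case: ifPn => x0; last by rewrite mulr_ge0.
rewrite gtr0_norm//; have xV0 : 0 <= x^-1 by rewrite invr_ge0 ltW.
rewrite expRN ler_pdivrMr ?expR_gt0// -ler_pdivrMl; last by rewrite mulr_gt0 ?ltr0n ?fact_gt0.
apply: le_trans (expR_ge1Dxn k xV0).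
rewrite invfM -mulrA (mulrC x^-1) -exprSr mulrC.
by rewrite lerDr.
Qed.

Lemma is_derive_near (f g : R -> R) (x d : R) : (\near x, f x = g x) ->
  is_derive x (1 : R) g d -> is_derive x (1 : R) f d.
Proof.
move=> fg [dg <-]; split; last exact: near_eq_derive.
by apply: near_eq_derivable dg; near=> y; apply/esym; near: y.
Unshelve. all: by end_near.
Qed.

Lemma is_derive_flat_gt0 (k : nat) (x : R) : 0 < x ->
  is_derive x (1 : R) (flat k) (- k%:R * flat k.+1 x + flat k.+2 x).
Proof.
move=> x0.
apply: (@is_derive_near _ ((@id R ^+ k * (expR \o -%R) : R -> R) \o (fun y => y^-1))).
  near=> y; rewrite /flat ifT; last by near: y; exact: lt_nbhsr.
  by rewrite -[RHS]/((id ^+ k) (y^-1) * expR (- y^-1)) fctE.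
have xn : (@id R) x != 0 by rewrite /= gt_eqF.
have dV := is_deriveV xn (is_derive_id (x : R^o) 1).
have dE := is_derive1_comp (is_derive_expR (- x^-1)) (is_deriveN (is_derive_id (x^-1 : R^o) 1)).
have dX := is_deriveX k (is_derive_id (x^-1 : R^o) 1).
have dM := is_deriveM dX dE.
apply: (is_derive_eq (is_derive1_comp dM dV)).
rewrite /flat x0 !fctE /=.
rewrite -![_ *: _]/(_ * _) !mulr1.
set y := x^-1; set E := expR _; rewrite -(exprVn x 2) -/y.
case: k {dX dM} => [|k] /=; first by rewrite !expr0; ring.
by rewrite !exprS; ring.
Unshelve. all: by end_near.
Qed.

(** At 0 the difference quotient of flat k is flat k.+1, which tends to 0. *)
Lemma is_derive_flat (k : nat) (x : R) :
  is_derive x (1 : R) (flat k) (- k%:R * flat k.+1 x + flat k.+2 x).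
Proof.
have [x0|x0|->] := ltgtP x 0; last first.
- have f0 j : flat j 0 = 0 by rewrite /flat ltxx.
  have Q : (fun h => h^-1 *: ((flat k \o shift 0) (h *: (1 : R)) - flat k 0)) @ 0^' --> (0 : R).
    apply/cvgr0Pnorm_lt => e e0.
    have c0 : 0 < k.+2`!%:R :> R by rewrite ltr0n fact_gt0.
    near=> h.
    have hn : h != 0 by near: h; exact: nbhs_dnbhs_neq.
    rewrite f0 subr0 /= addr0 -[h *: 1]/(h * 1) mulr1 -[_ *: _]/(_ * _).
    have -> : h^-1 * flat k h = flat k.+1 h.
      by rewrite /flat; case: ifP => _; rewrite ?mulr0// exprS mulrA.
    rewrite ger0_norm; last first.
      rewrite /flat; case: ifP => // h0.
      by rewrite mulr_ge0 ?expR_ge0// exprn_ge0// invr_ge0 ltW.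
    apply: le_lt_trans (flat_le _ _) _.
    rewrite -ltr_pdivlMl// mulrC; near: h; apply: dnbhs0_lt; exact: divr_gt0.
  rewrite !f0 mulr0 addr0; split; first exact: cvgP Q.
  exact: cvg_lim Q.
- exact: is_derive_flat_gt0.
- have fl j : flat j x = 0 by rewrite /flat ltNge (ltW x0).
  rewrite !fl mulr0 addr0.
  apply: (@is_derive_near _ (cst 0)).
  near=> y; rewrite /flat ifF//; apply/negbTE; rewrite -leNgt ltW//.
  near: y; exact: lt_nbhsl.
Unshelve. all: by end_near.
Qed.

Lemma smooth_flat k : smooth (flat k).
Proof.
move=> j; elim: j k => [|j IH] k.
  by move=> x; exact: is_derive_continuous (is_derive_flat k x).
apply: (class_C_line (is_derive_flat k)).
rewrite (_ : (fun x => _) = cst (- k%:R) * flat k.+1 + flat k.+2)//.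
by apply: class_C_add => //; apply: class_C_mul => //; exact: class_C_cst.
Qed.


(** A cutoff supported in [-1, 1].  It is not 1 on a smaller interval: a lower
    bound there is enough, since the test functions are normalized. *)
Definition chi (u : R) : R := flat 0 (1 - u) * flat 0 (1 + u).

Lemma smooth_chi : smooth chi.
Proof.
rewrite (_ : chi = (fun u => flat 0 (-1 * u + 1)) * (fun u => flat 0 (1 * u + 1))).
  by apply: smooth_mul; apply: smooth_affine; exact: smooth_flat.
by apply/funext => u; rewrite /chi fctE mulN1r mul1r (addrC _ 1) (addrC _ 1).
Qed.

Lemma flat0_ge0 x : 0 <= flat 0 x.
Proof. by rewrite /flat; case: ifP => // _; rewrite mulr_ge0 ?expR_ge0. Qed.

Lemma flat0_le1 x : flat 0 x <= 1.
Proof.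
rewrite /flat; case: ifP => // x0; rewrite expr0 mul1r -expR0 ler_expR.
by rewrite oppr_le0 invr_ge0 ltW.
Qed.

Lemma chi_ge0 u : 0 <= chi u.
Proof. by rewrite mulr_ge0 ?flat0_ge0. Qed.

Lemma chi_le1 u : chi u <= 1.
Proof. by rewrite mulr_ile1 ?flat0_ge0 ?flat0_le1. Qed.

Lemma chi_neq0 u : chi u != 0 -> `|u| < 1.
Proof.
apply: contraR; rewrite -leNgt => u1; rewrite /chi /flat.
have [u0|u0] := leP 0 u.
  rewrite ger0_norm// in u1; rewrite ifF ?mul0r//.
  by apply/negbTE; rewrite -leNgt subr_le0.
rewrite ltr0_norm// in u1; rewrite [X in _ * X]ifF ?mulr0//.
by apply/negbTE; rewrite -leNgt -lerBrDl sub0r lerNr.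
Qed.

Definition chi_low : R := expR (-4).

Lemma chi_ge_low u : `|u| <= 2^-1 -> chi_low <= chi u.
Proof.
rewrite ler_norml => /andP[h1 h2].
have f2 (x : R) : 2^-1 <= x -> expR (-2) <= flat 0 x.
  move=> x2; have x0 : 0 < x by exact: lt_le_trans x2.
  rewrite /flat x0 expr0 mul1r ler_expR lerN2.
  by rewrite -[leRHS]invrK lef_pV2 ?posrE.
rewrite /chi_low (_ : -4 = -2 + -2 :> R) ?expRD; last by rewrite -opprD -natrD.
by apply: ler_pM; rewrite ?expR_ge0//; apply: f2; lra.
Qed.

Lemma flat2_le2 x : `|flat 2 x| <= 2.
Proof.
rewrite /flat; case: ifP => [x0|_]; last by rewrite normr0.
have y0 : 0 <= x^-1 by rewrite invr_ge0 ltW.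
rewrite ger0_norm ?mulr_ge0 ?exprn_ge0 ?expR_ge0// expRN ler_pdivrMr ?expR_gt0//.
have := expR_ge1Dxn 1 y0; rewrite (_ : 2`!%:R = 2 :> R)// => h.
rewrite -ler_pdivrMl// mulrC; apply: le_trans h; by rewrite lerDr.
Qed.

Lemma flat_lip x y : `|flat 0 x - flat 0 y| <= 2 * `|x - y|.
Proof.
wlog xy : x y / x <= y => [hw|].
  by have [/hw//|/ltW/hw] := leP x y; rewrite distrC (distrC y).
have [c _ cE] := MVT_segment xy (fun z _ => is_derive_flat 0 z)
  (continuous_subspaceT (fun z => is_derive_continuous (is_derive_flat 0 z))).
rewrite distrC cE normrM (distrC x) oppr0 mul0r add0r.
by rewrite ler_wpM2r// flat2_le2.
Qed.

Lemma chi_lip u v : `|chi u - chi v| <= 4 * `|u - v|.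
Proof.
have -> : chi u - chi v = (flat 0 (1 - u) - flat 0 (1 - v)) * flat 0 (1 + u) +
    flat 0 (1 - v) * (flat 0 (1 + u) - flat 0 (1 + v)) by rewrite /chi; ring.
apply: le_trans (ler_normD _ _) _; rewrite !normrM (ger0_norm (flat0_ge0 _)) (ger0_norm (flat0_ge0 _)).
have h1 : `|flat 0 (1 - u) - flat 0 (1 - v)| * flat 0 (1 + u) <= 2 * `|u - v|.
  apply: le_trans (ler_piMr _ (flat0_le1 _)) _ => //.
  apply: le_trans (flat_lip _ _) _.
  by rewrite (_ : 1 - u - (1 - v) = v - u) 1?distrC//; ring.
have h2 : flat 0 (1 - v) * `|flat 0 (1 + u) - flat 0 (1 + v)| <= 2 * `|u - v|.
  apply: le_trans (ler_piMl _ (flat0_le1 _)) _ => //.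
  apply: le_trans (flat_lip _ _) _.
  by rewrite (_ : 1 + u - (1 + v) = u - v)//; ring.
lra.
Qed.

Definition comp_ln (psi : R -> R) (x : R) : R := if 0 < x then psi (ln x) else 0.

Lemma is_derive_comp_ln (psi : R -> R) A x : smooth psi -> (forall u, u < A -> psi u = 0) ->
  is_derive x (1 : R) (comp_ln psi) (comp_ln (fun u => expR (- u) * 'D_1 psi u) x).
Proof.
move=> spsi psiA.
have [x0|x0] := ltP 0 x.
  rewrite /comp_ln x0.
  apply: (@is_derive_near _ (psi \o @ln R)).
    by near=> y; rewrite /= ifT//; near: y; exact: lt_nbhsr.
  have [_ dpsi _] := spsi 1%N.
  have d1 : is_derive (ln x) (1 : R) psi ('D_1 psi (ln x)) by split.
  apply: (is_derive_eq (is_derive1_comp d1 (is_derive1_ln x0))).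
  by rewrite mulrC expRN lnK.
rewrite {2}/comp_ln ltNge x0 /=.
apply: (@is_derive_near _ (cst 0)).
near=> y; rewrite /comp_ln; case: ifP => // y0; apply: psiA.
rewrite -[A]expRK ltr_ln ?posrE ?expR_gt0//.
by near: y; apply: lt_nbhsl; exact: le_lt_trans (expR_gt0 _).
Unshelve. all: by end_near.
Qed.

Lemma smooth_derive (psi : R -> R) : smooth psi -> smooth ('D_(1 : R) psi).
Proof. by move=> spsi k; have [_ _] := spsi k.+1; exact. Qed.

(** The derivative of psi (ln x) is exp (- u) psi'(u) at u = ln x, again of this
    form; near x = 0 the function is 0. *)
Lemma smooth_comp_ln (psi : R -> R) A : smooth psi -> (forall u, u < A -> psi u = 0) ->
  smooth (comp_ln psi).
Proof.
move=> + + k; elim: k psi => [|k IH] psi spsi psiA.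
  by move=> x; exact: is_derive_continuous (is_derive_comp_ln x spsi psiA).
apply: (class_C_line (fun x => is_derive_comp_ln x spsi psiA)).
apply: IH => [|u uA].
  rewrite (_ : (fun u => _) = (fun u => expR (-1 * u + 0)) * 'D_1 psi).
    by apply: smooth_mul; [apply: smooth_affine; exact: smooth_expR|exact: smooth_derive].
  by apply/funext => u; rewrite fctE mulN1r addr0.
rewrite (@near_eq_derive _ _ _ _ (cst 0)) ?derive_cst ?mulr0//.
by near=> y; apply: psiA; near: y; exact: lt_nbhsl.
Unshelve. all: by end_near.
Qed.

End line_smooth.

(** * The test functions *)

Section testfun.
Context {R : realType}.
Variable m : nat.
Local Notation n := m.+1.
Local Notation rR := (measurableTypeR R).
Variables (gam j Lr : R).
Hypotheses (j0 : 0 < j) (L0 : 0 < Lr).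

(** The variables other than the height are cut at the scales L and L^2 of the
    Heisenberg dilations. *)
Definition cut_rest (xi : @heis R n) : R :=
  \prod_(i < m) chi (xi.1.1 ord0 (lift ord0 i) / Lr) *
  \prod_(i < n) chi (xi.1.2 ord0 i / Lr) * chi (xi.2 / Lr ^+ 2).

Definition cut_all (xi : @heis R n) : R := chi (ln (height xi) / j) * cut_rest xi.

Let psi (u : R) : R := expR (gam * u) * chi (u / j).

(** (height xi)^gam times the cutoff cut_all (test_funE), written as a function
    of ln (height xi) so that smooth_comp_ln applies. *)
Definition test_fun (xi : @heis R n) : R := comp_ln psi (height xi) * cut_rest xi.

Lemma test_funE xi : 0 < height xi -> test_fun xi = height xi `^ gam * cut_all xi.
Proof.
by move=> x0; rewrite /test_fun /comp_ln x0 /psi /cut_all mulrA /powR gt_eqF.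
Qed.

Lemma test_fun0 xi : height xi <= 0 -> test_fun xi = 0.
Proof. by move=> x0; rewrite /test_fun /comp_ln ltNge x0 mul0r. Qed.

Let psi0 u : u < - j -> psi u = 0.
Proof.
move=> uj; rewrite /psi; apply/eqP; rewrite mulf_eq0; apply/orP; right.
apply: contraTT uj => /chi_neq0; rewrite normrM normfV (gtr0_norm j0) ltr_pdivrMr// mul1r.
by rewrite ltr_norml -leNgt => /andP[/ltW].
Qed.

Lemma smooth_coord1 (phi : R -> R) (a : R) (i : 'I_n) : smooth phi ->
  smooth (fun xi : @heis R n => phi (xi.1.1 ord0 i / a)).
Proof.
move=> sphi k; apply: (class_C_affine (l := fun xi : @heis R n => xi.1.1 ord0 i / a)
  (lin := fun xi : @heis R n => xi.1.1 ord0 i / a)) => //.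
- move=> xi; apply: cvgM; last exact: cvg_cst.
  apply: (@continuous_comp _ _ _ (fun xi : heis n => xi.1.1) (fun M : 'rV[R]_n => M ord0 i)).
    by apply: continuous_comp; exact: cvg_fst.
  exact: coord_continuous.
- by move=> h x v; rewrite !mxE mulrDl -mulrA.
Qed.

Lemma smooth_coord2 (phi : R -> R) (a : R) (i : 'I_n) : smooth phi ->
  smooth (fun xi : @heis R n => phi (xi.1.2 ord0 i / a)).
Proof.
move=> sphi k; apply: (class_C_affine (l := fun xi : @heis R n => xi.1.2 ord0 i / a)
  (lin := fun xi : @heis R n => xi.1.2 ord0 i / a)) => //.
- move=> xi; apply: cvgM; last exact: cvg_cst.
  apply: (@continuous_comp _ _ _ (fun xi : heis n => xi.1.2) (fun M : 'rV[R]_n => M ord0 i)).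
    by apply: continuous_comp; [exact: cvg_fst|exact: cvg_snd].
  exact: coord_continuous.
- by move=> h x v; rewrite !mxE mulrDl -mulrA.
Qed.

Lemma smooth_coord3 (phi : R -> R) (a : R) : smooth phi ->
  smooth (fun xi : @heis R n => phi (xi.2 / a)).
Proof.
move=> sphi k; apply: (class_C_affine (l := fun xi : @heis R n => xi.2 / a)
  (lin := fun xi : @heis R n => xi.2 / a)) => //.
- by move=> xi; apply: cvgM; [exact: cvg_snd|exact: cvg_cst].
- by move=> h x v /=; rewrite mulrDl -mulrA.
Qed.

Lemma smooth_test_fun : smooth test_fun.
Proof.
have spsi : smooth psi.
  rewrite (_ : psi = (fun u => expR (gam * u + 0)) * (fun u => chi (j^-1 * u + 0))).
    apply: smooth_mul; first exact: (smooth_affine _ _ (@smooth_expR R)).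
    exact: (smooth_affine _ _ (@smooth_chi R)).
  by apply/funext => u; rewrite fctE /psi !addr0 (mulrC j^-1).
have s1 := smooth_comp_ln spsi psi0.
move=> k.
rewrite (_ : test_fun = (fun xi : heis n => comp_ln psi (xi.1.1 ord0 ord0 / 1)) *
  (((fun xi : heis n => \prod_(i < m) chi (xi.1.1 ord0 (lift ord0 i) / Lr)) *
   (fun xi : heis n => \prod_(i < n) chi (xi.1.2 ord0 i / Lr))) *
   (fun xi : heis n => chi (xi.2 / Lr ^+ 2)))); last first.
  by apply/funext => xi; rewrite !fctE divr1.
apply: class_C_mul; first exact: (smooth_coord1 1 ord0 s1).
apply: class_C_mul; last exact: (smooth_coord3 (Lr ^+ 2) (@smooth_chi R)).
apply: class_C_mul; apply: class_C_prod => i.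
  exact: (smooth_coord1 Lr (lift ord0 i) (@smooth_chi R)).
exact: (smooth_coord2 Lr i (@smooth_chi R)).
Qed.

Definition box (xi : @heis R n) : Prop :=
  [/\ expR (- j) <= height xi <= expR j,
      (forall i, `|xi.1.1 ord0 (lift ord0 i)| <= Lr),
      (forall i, `|xi.1.2 ord0 i| <= Lr) &
      `|xi.2| <= Lr ^+ 2].

Lemma chi_div_neq0 (x a : R) : 0 < a -> chi (x / a) != 0 -> `|x| <= a.
Proof.
by move=> a0 /chi_neq0; rewrite normrM normfV (gtr0_norm a0) ltr_pdivrMr// mul1r => /ltW.
Qed.

Lemma cut_all_box xi : 0 < height xi -> cut_all xi != 0 -> box xi.
Proof.
have sp (a b : R) : a * b != 0 -> a != 0 /\ b != 0.
  by rewrite mulf_eq0 negb_or => /andP[].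
move=> x0 /sp[h1 /sp[/sp[h2 h3] h4]]; split.
- have := chi_div_neq0 j0 h1; rewrite ler_norml => /andP[a b].
  by rewrite -{1}(lnK x0) -{2}(lnK x0) !ler_expR a b.
- move=> i; apply: chi_div_neq0 => //; apply: contra h2 => h.
  by apply/prodf_eq0; exists i.
- move=> i; apply: chi_div_neq0 => //; apply: contra h3 => h.
  by apply/prodf_eq0; exists i.
- by apply: chi_div_neq0 => //; rewrite exprn_gt0.
Qed.

Lemma test_fun_box xi : test_fun xi != 0 -> box xi.
Proof.
have [x0|x0] := ltP 0 (height xi); last by rewrite test_fun0// eqxx.
rewrite test_funE// mulf_eq0 negb_or => /andP[_]; exact: cut_all_box.
Qed.

Lemma compact_box : compact [set xi | box xi].
Proof.
pose A (i : 'I_n) : set R := if i == ord0 then `[expR (- j), expR j]%classic else `[- Lr, Lr]%classic.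
have A0 : A ord0 = `[expR (- j), expR j]%classic by rewrite /A eqxx.
have AS k : A (lift ord0 k) = `[- Lr, Lr]%classic by rewrite /A eq_sym (negbTE (neq_lift _ _)).
have -> : [set xi | box xi] = ([set v : 'rV[R]_n | forall i, A i (v ord0 i)] `*`
    [set v : 'rV[R]_n | forall i, `[- Lr, Lr]%classic (v ord0 i)]) `*`
    `[- Lr ^+ 2, Lr ^+ 2]%classic.
  apply/seteqP; split => xi /=.
    move=> [h1 h2 h3 h4]; split; [split|] => /= [i|i|].
    - case: (unliftP ord0 i) => [k|] ->; last by rewrite A0 /= in_itv.
      by rewrite AS /= in_itv /= -ler_norml.
    - by rewrite in_itv /= -ler_norml.
    - by rewrite in_itv /= -ler_norml.
  rewrite !in_itv /= -ler_norml => -[[h1 h2] h3]; split => //.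
  - by have := h1 ord0; rewrite A0 /= in_itv.
  - by move=> i; have := h1 (lift ord0 i); rewrite AS /= in_itv /= -ler_norml.
  - by move=> i; have := h2 i; rewrite in_itv /= -ler_norml.
apply: compact_setX; last exact: segment_compact.
apply: compact_setX.
  apply: (rV_compact (A := A)) => i; rewrite /A; case: ifP => _; exact: segment_compact.
apply: (rV_compact (A := fun=> `[- Lr, Lr]%classic)) => i; exact: segment_compact.
Qed.

(** The support lies in a compact box whose points have height at least
    exp (- j). *)
Lemma test_fun_Cc (n_gt0 : (0 < n)%N) (c : R) :
  Cc_infty (half_space n_gt0) (fun xi => c * test_fun xi).
Proof.
have cb : closed [set xi | box xi].
  apply: compact_closed; last exact: compact_box.
  exact: norm_hausdorff.
have sb : closure [set xi | c * test_fun xi != 0] `<=` [set xi | box xi].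
  rewrite [X in _ `<=` X](_ : _ = closure [set xi | box xi]); last exact/closure_id.
  apply: closure_subset => xi /=.
  by rewrite mulf_eq0 negb_or => /andP[_ /test_fun_box].
split.
- move=> k; rewrite (_ : (fun xi => _) = cst c * test_fun)//.
  by apply: class_C_mul; [exact: class_C_cst|exact: smooth_test_fun].
- apply: (subclosed_compact _ compact_box) => //.
  exact: closed_closure.
- apply: (subset_trans sb) => xi [/andP[h _] _ _ _].
  rewrite /half_space /= /x1 (_ : Ordinal n_gt0 = ord0); last exact/val_inj.
  by apply: lt_le_trans h; exact: expR_gt0.
Qed.

End testfun.

(** * Boxes and their mass *)

Section volume.
Context {R : realType}.
Variable m : nat.
Local Notation n := m.+1.
Local Notation rR := (measurableTypeR R).
Local Notation mu := (@lebesgue_measure R).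
Local Notation H := ('rV[rR]_n * 'rV[rR]_n * rR)%type.
Local Notation L := (@lebesgue_heis R n).

Definition cube k (l : R) (u : 'rV[R]_k) : bool := [forall i, `|u ord0 i| <= l].

Lemma cube_cons k l (a : rR) (u : 'rV[rR]_k) : cube l (cons_rV (a, u)) = (`|a| <= l) && cube l u.
Proof.
apply/forallP/andP => [h|[h1 /forallP h2] i].
  split; first by have := h ord0; rewrite cons_rV0.
  by apply/forallP => i; have := h (lift ord0 i); rewrite cons_rVS.
by case: (unliftP ord0 i) => [j|] ->; rewrite ?cons_rVS ?cons_rV0//; exact: h2.
Qed.

Lemma measurable_cube d (T : measurableType d) k l (f : T -> 'rV[rR]_k) : measurable_fun setT f ->
  measurable_fun setT (fun x => cube l (f x)).
Proof.
move=> mf.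
apply: (@measurable_fun_bool _ _ _ _ true).
rewrite setTI.
have -> : (fun x => cube l (f x)) @^-1` [set true] =
   \bigcap_(i in [set: 'I_k]) (setT `&` (fun x => `|f x ord0 i| : rR) @^-1` `]-oo, l]%classic).
  apply/seteqP; split => x /=.
    by move=> /forallP h i _; split => //=; rewrite in_itv /=.
  by move=> h; apply/forallP => i; have [_ /=] := h i I; rewrite in_itv.
apply: fin_bigcap_measurable; first exact: finite_finset.
move=> i _; apply: (measR_norm (measR_coord i mf)) => //; exact: measurable_itv.
Qed.

Lemma integral_interval (l : R) : 0 <= l ->
  (\int[mu]_x (if (`|x| <= l)%R then 1 else 0) = (2 * l)%:E)%E.
Proof.
move=> l0.
rewrite (_ : (fun x : R => if (`|x| <= l)%R then 1 else 0)%E = EFin \o \1_(`[- l, l]%classic : set rR)); last first.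
  apply/funext => x; rewrite /= indicE mem_setE in_itv /= ler_norml.
  by case: ifP.
rewrite integral_indic//= setIT lebesgue_measure_itv /= lte_fin.
case: ifPn => h; first by rewrite -EFinB; congr EFin; ring.
have -> : l = 0 by apply/eqP; rewrite eq_le l0 andbT; move: h; rewrite -leNgt; lra.
by rewrite mulr0.
Qed.

Lemma integral_cube k (l : R) : 0 <= l ->
  (\int[lebesgue_rV k]_u (if cube l u then 1 else 0) = ((2 * l) ^+ k)%:E)%E.
Proof.
move=> l0; have mi k' : measurable_fun setT (fun u : 'rV[rR]_k' => if cube l u then 1 else 0 : \bar R)%E.
  apply: measurable_fun_ifT; try exact: measurable_cst.
  by apply: measurable_cube; exact: measurable_id.
have i0 k' (u : 'rV[rR]_k') : (0 <= (if cube l u then 1 else 0 : \bar R))%E by case: ifP.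
elim: k => [|k IH].
  by rewrite integral_rV0// ifT ?expr0//; apply/forallP => -[].
rewrite (ge0_integral_cons_rV (mi k.+1) (i0 k.+1)).
transitivity (\int[mu]_a ((if (`|a| <= l)%R then 1 else 0) * ((2 * l) ^+ k)%:E))%E.
  apply: eq_integral => a _; rewrite -IH.
  case: ifP => al.
    by rewrite mul1e; apply: eq_integral => u _; rewrite cube_cons al.
  by rewrite mul0e; apply: integral0_eq => u _; rewrite cube_cons al.
have mI : measurable_fun setT (fun a : rR => if (`|a| <= l)%R then 1 else 0 : \bar R)%E.
  apply: measurable_fun_ifT; try exact: measurable_cst.
  by apply: measurable_fun_ler; [exact: (measR_norm (@measurable_id _ rR setT))|exact: measurable_cst].
have I0 (a : R) : (0 <= (if (`|a| <= l)%R then 1 else 0 : \bar R))%E by case: ifP.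
have l20 : (0 <= ((2 * l) ^+ k)%:E)%E by rewrite lee_fin exprn_ge0// mulr_ge0.
rewrite (ge0_integralZr mu measurableT mI (fun a _ => I0 a) l20).
by rewrite integral_interval// -EFinM exprS.
Qed.

(** The height is bounded on a logarithmic scale, by a. *)
Definition boxb (a l t : R) (xi : @heis R n) : bool :=
  [&& expR (- a) <= height xi <= expR a, cube l (tail_rV xi.1.1), cube l xi.1.2 & `|xi.2| <= t].

Lemma measurable_box a l t : measurable_fun setT (boxb a l t : H -> bool).
Proof.
have mid := @measurable_id _ H setT.
have [m11 m12 _] := measurable_triple mid.
apply: measurable_and.
  apply: measurable_and; apply: measurable_fun_ler; try exact: measurable_cst; exact: measurable_height.
apply: measurable_and; first by apply: measurable_cube; exact: measurable_tail_rV.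
apply: measurable_and; first exact: measurable_cube.
apply: measurable_fun_ler; last exact: measurable_cst.
exact: (measR_norm measurable_snd).
Qed.

(** The density 1 / x_1 is invariant under dilations of the height, so the mass
    grows only linearly in the logarithmic size. *)
Lemma integral_inv (a : R) : 0 < a ->
  (\int[mu]_x (if (expR (- a) <= x <= expR a)%R then (x `^ (- 1))%:E else 0) = (2 * a)%:E)%E.
Proof.
move=> a0.
transitivity (\int[mu]_(x in `[expR (- a), expR a]) (x `^ (- 1))%:E)%E.
  rewrite [RHS]integral_mkcond; apply: eq_integral => x _.
  by rewrite patchE mem_setE in_itv.
have ab : expR (- a) < expR a by rewrite ltr_expR; lra.
have x0 x : expR (- a) <= x <= expR a -> 0 < x.
  by move=> /andP[h _]; exact: lt_le_trans (expR_gt0 _) h.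
have dF x : expR (- a) <= x <= expR a -> is_derive x (1 : R) (@ln R) (x `^ (- 1)).
  move=> /x0 xg; rewrite powR_inv1 ?ltW//; exact: is_derive1_ln.
have df x : expR (- a) <= x <= expR a -> derivable (@powR R ^~ (- 1)) x 1.
  by move=> /x0 xg; exact: derivable_powR1.
by rewrite (FTC_is_derive ab dF df) !expRK; congr EFin; ring.
Qed.

Lemma integral_box a l t : 0 < a -> 0 <= l -> 0 <= t ->
  (\int[L]_xi (if boxb a l t xi then (height xi `^ (- 1))%:E else 0) =
   (2 * a * (2 * l) ^+ m * (2 * l) ^+ n * (2 * t))%:E)%E.
Proof.
move=> a0 l0 t0.
have mf : measurable_fun setT (fun xi : H => if boxb a l t xi then (height xi `^ (- 1))%:E else 0 : \bar R)%E.
  apply: measurable_fun_ifT; [exact: measurable_box| |exact: measurable_cst].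
  apply/measurable_EFinP; apply: measR_powR; exact: (measurable_height (@measurable_id _ H setT)).
have f0 xi : (0 <= (if boxb a l t xi then (height xi `^ (- 1))%:E else 0))%E.
  by case: ifP => // _; rewrite lee_fin powR_ge0.
rewrite (ge0_integral_heis_cons mf f0).
have cm k : measurable_fun setT (fun u : 'rV[rR]_k => if cube l u then 1 else 0 : \bar R)%E.
  apply: measurable_fun_ifT; try exact: measurable_cst.
  by apply: measurable_cube; exact: measurable_id.
have c0 k (u : 'rV[rR]_k) : (0 <= (if cube l u then 1 else 0 : \bar R))%E by case: ifP.
pose w (x : R) : \bar R := if (expR (- a) <= x <= expR a)%R then (x `^ (- 1))%:E else 0%E.
have w0 x : (0 <= w x)%E by rewrite /w; case: ifP => // _; rewrite lee_fin powR_ge0.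
have mw : measurable_fun setT (w : rR -> _).
  apply: measurable_fun_ifT; last exact: measurable_cst.
    by apply: measurable_and; apply: measurable_fun_ler; try exact: measurable_cst; exact: measurable_id.
  by apply/measurable_EFinP; exact: (measR_powR _ (@measurable_id _ rR setT)).
transitivity (\int[mu]_x (w x * ((2 * l) ^+ m * (2 * l) ^+ n * (2 * t))%:E))%E; last first.
  rewrite (ge0_integralZr mu measurableT mw (fun x _ => w0 x)); last first.
    by rewrite lee_fin !mulr_ge0 ?exprn_ge0 ?mulr_ge0.
  by rewrite integral_inv// -EFinM !mulrA.
apply: eq_integral => x _.
have k1 : (0 <= w x * ((2 * l) ^+ n * (2 * t))%:E)%E.
  by apply: mule_ge0 => //; rewrite lee_fin mulr_ge0 ?exprn_ge0 ?mulr_ge0.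
have k2 : (0 <= w x * (2 * t)%:E)%E.
  by apply: mule_ge0 => //; rewrite lee_fin mulr_ge0.
transitivity (\int[lebesgue_rV m]_u (w x * ((2 * l) ^+ n * (2 * t))%:E * (if cube l u then 1 else 0)))%E; last first.
  rewrite (ge0_integralZl (lebesgue_rV m) measurableT (cm m) (fun u _ => c0 m u) k1).
  by rewrite integral_cube// -muleA -EFinM; congr (_ * _%:E)%E; ring.
apply: eq_integral => u _.
transitivity (\int[lebesgue_rV n]_y ((if cube l u then 1 else 0) * (w x * (2 * t)%:E) * (if cube l y then 1 else 0)))%E; last first.
  rewrite (ge0_integralZl (lebesgue_rV n) measurableT (cm n) (fun u _ => c0 n u)); last exact: mule_ge0.
  rewrite integral_cube//; case: ifP => _; rewrite ?mul0e ?mule0// !mul1e mule1.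
  by rewrite -muleA -EFinM (mulrC (2 * t)).
apply: eq_integral => y _.
have mI : measurable_fun setT (fun v : rR => if (`|v| <= t)%R then 1 else 0 : \bar R)%E.
  apply: measurable_fun_ifT; try exact: measurable_cst.
  by apply: measurable_fun_ler; [exact: (measR_norm (@measurable_id _ rR setT))|exact: measurable_cst].
have I0 (v : R) : (0 <= (if (`|v| <= t)%R then 1 else 0 : \bar R))%E by case: ifP.
rewrite -(integral_interval t0) /boxb.
under eq_integral do rewrite height_cons /= tail_cons_rV.
rewrite /w; case: (expR (- a) <= x <= expR a) => /=; last first.
  by rewrite integral0 mul0e mule0 mul0e.
case: (cube l u) => /=; last by rewrite integral0 !mul0e.
case: (cube l y) => /=; last by rewrite integral0 mule0.
rewrite mul1e mule1 -(ge0_integralZl mu measurableT mI (fun v _ => I0 v)) ?lee_fin ?powR_ge0//.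
by apply: eq_integral => v _; case: ifP; rewrite ?mule1 ?mule0.
Qed.

End volume.

(** * Displacement of the cutoff *)

Section pointwise.
Context {R : realType}.

Lemma mul_diff (a b a' b' : R) : 0 <= a' <= 1 -> 0 <= b <= 1 ->
  `|a * b - a' * b'| <= `|a - a'| + `|b - b'|.
Proof.
move=> /andP[a0 a1] /andP[b0 b1].
have -> : a * b - a' * b' = (a - a') * b + a' * (b - b') by ring.
apply: le_trans (ler_normD _ _) _; rewrite !normrM (ger0_norm a0) (ger0_norm b0).
by apply: lerD; [rewrite ler_piMr|rewrite ler_piMl].
Qed.

Lemma prod_unit (I : Type) (r : seq I) (a : I -> R) : (forall i, 0 <= a i <= 1) ->
  0 <= \prod_(i <- r) a i <= 1.
Proof.
move=> a01; elim: r => [|i r /andP[h1 h2]]; first by rewrite big_nil ler01 lexx.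
have /andP[a0 a1] := a01 i.
by rewrite big_cons mulr_ge0//= mulr_ile1.
Qed.

Lemma prod_diff (I : Type) (r : seq I) (a b : I -> R) : (forall i, 0 <= a i <= 1) ->
  (forall i, 0 <= b i <= 1) ->
  `|\prod_(i <- r) a i - \prod_(i <- r) b i| <= \sum_(i <- r) `|a i - b i|.
Proof.
move=> a01 b01; elim: r => [|i r IH]; first by rewrite !big_nil subrr normr0.
rewrite !big_cons; apply: le_trans (mul_diff _ _ _ _) _ => //.
  exact: prod_unit.
by rewrite lerD2l.
Qed.

Lemma dot_le k (a b : 'rV[R]_k) (la lb : R) : (forall i, `|a ord0 i| <= la) ->
  (forall i, `|b ord0 i| <= lb) -> `|dot a b| <= k%:R * (la * lb).
Proof.
move=> ha hb; apply: le_trans (ler_norm_sum _ _ _) _.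
apply: (@le_trans _ _ (\sum_(i < k) la * lb)).
  by apply: ler_sum => i _; rewrite normrM ler_pM.
by rewrite sumr_const card_ord mulr_natl.
Qed.

Lemma coord_le_dot k (a : 'rV[R]_k) i : a ord0 i ^+ 2 <= dot a a.
Proof.
rewrite /dot (bigD1 i)//= -expr2 lerDl; apply: sumr_ge0 => l _.
by rewrite -expr2 sqr_ge0.
Qed.

Variable m : nat.
Local Notation n := m.+1.
Implicit Types xi eta : @heis R n.

Definition wnorm eta : R := Num.sqrt (wsqr eta).

Lemma wnorm_ge1 eta : 1 <= wnorm eta.
Proof. by rewrite /wnorm -[leLHS]sqrtr1 ler_wsqrtr// wsqr_ge1. Qed.

Lemma wnorm_sqr eta : wnorm eta ^+ 2 = wsqr eta.
Proof. by rewrite /wnorm sqr_sqrtr// (le_trans ler01)// wsqr_ge1. Qed.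

Lemma tail_le_wnorm eta i : `|tail_rV eta.1.1 ord0 i| <= wnorm eta.
Proof.
rewrite -sqrtr_sqr; apply: ler_wsqrtr; apply: le_trans (coord_le_dot _ i) _.
by rewrite /wsqr; have := dot_ge0 eta.1.2; lra.
Qed.

Lemma y_le_wnorm eta i : `|eta.1.2 ord0 i| <= wnorm eta.
Proof.
rewrite -sqrtr_sqr; apply: ler_wsqrtr; apply: le_trans (coord_le_dot _ i) _.
by rewrite /wsqr; have := dot_ge0 (tail_rV eta.1.1); lra.
Qed.

Lemma chart_x_le a eta i : 0 <= a * height eta -> `|(chart a eta).1.1 ord0 i| <= a * height eta * wnorm eta.
Proof.
move=> A0; case: (unliftP ord0 i) => [k|] ->.
  by rewrite cons_rVS /= mxE normrM (ger0_norm A0) ler_wpM2l// tail_le_wnorm.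
by rewrite cons_rV0 /= mulNr normrN (ger0_norm A0) ler_peMr// wnorm_ge1.
Qed.

Lemma chart_y_le a eta i : 0 <= a * height eta -> `|(chart a eta).1.2 ord0 i| <= a * height eta * wnorm eta.
Proof. by move=> A0; rewrite /= mxE normrM (ger0_norm A0) ler_wpM2l// y_le_wnorm. Qed.

Lemma chart_tE a eta : 0 <= a * height eta ->
  `|(chart a eta).2| = (a * height eta * wnorm eta) ^+ 2 * `|eta.2|.
Proof.
move=> A0; rewrite exprMn wnorm_sqr normrM; congr (_ * _).
by rewrite ger0_norm// mulr_ge0 ?sqr_ge0// (le_trans ler01 (wsqr_ge1 _)).
Qed.

Section params.
Variables (j Lr : R).
Hypotheses (j0 : 0 < j) (L0 : 0 < Lr).

Let chi01 (u : R) : 0 <= chi u <= 1. Proof. by rewrite chi_ge0 chi_le1. Qed.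

Lemma cut_rest_unit xi : 0 <= cut_rest Lr xi <= 1.
Proof.
rewrite /cut_rest.
have /andP[h1 h2] := prod_unit (index_enum 'I_m) (fun i => chi01 (xi.1.1 ord0 (lift ord0 i) / Lr)).
have /andP[h3 h4] := prod_unit (index_enum 'I_n) (fun i => chi01 (xi.1.2 ord0 i / Lr)).
have /andP[h5 h6] := chi01 (xi.2 / Lr ^+ 2).
have q0 := mulr_ge0 h1 h3; have q1 := mulr_ile1 h1 h3 h2 h4.
by rewrite (mulr_ge0 q0 h5) (mulr_ile1 q0 h5 q1 h6).
Qed.

Lemma cut_all_unit xi : 0 <= cut_all j Lr xi <= 1.
Proof.
have /andP[h1 h2] := cut_rest_unit xi; have /andP[h3 h4] := chi01 (ln (height xi) / j).
by rewrite /cut_all mulr_ge0//= mulr_ile1.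
Qed.

Let chi_div_lip (a x y : R) : 0 < a -> `|chi (x / a) - chi (y / a)| <= 4 * (`|x - y| / a).
Proof.
move=> a0; apply: le_trans (chi_lip _ _) _.
by rewrite -mulrBl normrM normfV (gtr0_norm a0).
Qed.

(** chi is Lipschitz and each factor lies in [0, 1], so differences of products
    are bounded by the sums of the differences of their factors. *)
Lemma cut_all_diff xi xi' :
  `|cut_all j Lr xi - cut_all j Lr xi'| <=
  4 * (`|ln (height xi) - ln (height xi')| / j +
       (\sum_(i < m) `|xi.1.1 ord0 (lift ord0 i) - xi'.1.1 ord0 (lift ord0 i)| / Lr +
        \sum_(i < n) `|xi.1.2 ord0 i - xi'.1.2 ord0 i| / Lr +
        `|xi.2 - xi'.2| / Lr ^+ 2)).
Proof.
have P1 x := prod_unit (index_enum 'I_m) (fun i => chi01 (x i / Lr)).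
have P2 x := prod_unit (index_enum 'I_n) (fun i => chi01 (x i / Lr)).
rewrite /cut_all; apply: le_trans (mul_diff _ _ _ _) _ => //; first exact: cut_rest_unit.
rewrite mulrDr; apply: lerD; first exact: chi_div_lip.
rewrite /cut_rest; apply: le_trans (mul_diff _ _ _ _) _ => //.
  have /andP[a0 a1] := P1 (fun i => xi'.1.1 ord0 (lift ord0 i)).
  have /andP[b0 b1] := P2 (fun i => xi'.1.2 ord0 i).
  by rewrite mulr_ge0//= mulr_ile1.
rewrite mulrDr; apply: lerD; last by apply: chi_div_lip; rewrite exprn_gt0.
apply: le_trans (mul_diff _ _ _ _) _.
- exact: (P1 (fun i => xi'.1.1 ord0 (lift ord0 i))).
- exact: (P2 (fun i => xi.1.2 ord0 i)).
rewrite mulrDr !mulr_sumr; apply: lerD.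
  apply: le_trans (prod_diff _ _ _) _ => //.
  by apply: ler_sum => i _; exact: chi_div_lip.
apply: le_trans (prod_diff _ _ _) _ => //.
by apply: ler_sum => i _; exact: chi_div_lip.
Qed.

End params.

Section displacement.
Variables (j : R).
Hypothesis j1 : 1 <= j.
Let Lr := j * expR j.
Let j0 : 0 < j. Proof. exact: lt_le_trans j1. Qed.
Let L0 : 0 < Lr. Proof. by rewrite mulr_gt0 ?expR_gt0. Qed.

Variables (xi eta : @heis R n).
Hypotheses (x0 : 0 < height xi) (s0 : 0 < height eta) (s1 : height eta < 1).
Let tau := 1 - height eta.
Let t0 : 0 < tau. Proof. by rewrite subr_gt0. Qed.
Let A := height xi * height eta.
Let A0 : 0 <= A. Proof. by rewrite mulr_ge0 ?ltW. Qed.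
Let q := height eta / (tau * j).
Let q0 : 0 <= q. Proof. by rewrite divr_ge0 ?mulr_ge0 ?ltW. Qed.
Hypothesis bx : boxb j Lr (Lr ^+ 2) xi || boxb j Lr (Lr ^+ 2) (displace xi eta).

(** Whichever of the two points is in the box, height xi * (1 - height eta) is at
    most exp j. *)
Let A_le : A <= q * Lr.
Proof.
have xt : height xi * tau <= expR j.
  move: bx => /orP[|] /and4P[/andP[_ h] _ _ _].
    by apply: le_trans h; rewrite ler_piMr// ?(ltW x0)// gerBl ltW.
  by rewrite height_displace in h.
rewrite /A /q /Lr.
have -> : height eta / (tau * j) * (j * expR j) = expR j / tau * height eta.
  by field; rewrite !gt_eqF.
by rewrite ler_wpM2r ?(ltW s0)// ler_pdivlMr.
Qed.

Let AW_le : A * wnorm eta <= q * wnorm eta * Lr.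
Proof.
by rewrite (mulrAC q) ler_wpM2r// (le_trans ler01)// wnorm_ge1.
Qed.

Let W0 : 0 <= wnorm eta. Proof. exact: le_trans (wnorm_ge1 _). Qed.

Let coord_box (z : @heis R n) : boxb j Lr (Lr ^+ 2) z ->
  (forall i, `|z.1.1 ord0 i| <= Lr) /\ (forall i, `|z.1.2 ord0 i| <= Lr).
Proof.
move=> /and4P[/andP[h1 h2] /forallP h3 /forallP h4 _]; split => // i.
case: (unliftP ord0 i) => [k|] ->; first by have := h3 k; rewrite mxE.
rewrite ger0_norm; last by apply: le_trans h1; exact: expR_ge0.
by apply: (le_trans h2); rewrite ler_peMl// expR_ge0.
Qed.

(** The symplectic terms of the group law are at most of size L times the
    displacement, because one of the two points is in the box; the form of the
    difference is the same seen from either point. *)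
Let t_le : `|(displace xi eta).2 - xi.2| <=
  (q * wnorm eta * Lr) ^+ 2 * `|eta.2| + 4 * n%:R * (q * wnorm eta * Lr ^+ 2).
Proof.
pose z := chart (height xi) eta.
have zx i : `|z.1.1 ord0 i| <= q * wnorm eta * Lr by exact: le_trans (chart_x_le _ _) AW_le.
have zy i : `|z.1.2 ord0 i| <= q * wnorm eta * Lr by exact: le_trans (chart_y_le _ _) AW_le.
have -> : (displace xi eta).2 - xi.2 = z.2 + 2 * (dot xi.1.2 z.1.1 - dot xi.1.1 z.1.2).
  by rewrite /displace /heis_mul /= -/z; ring.
apply: le_trans (ler_normD _ _) _; apply: lerD.
  have AW0 : 0 <= A * wnorm eta by exact: mulr_ge0.
  have qW0 : 0 <= q * wnorm eta * Lr := mulr_ge0 (mulr_ge0 q0 W0) (ltW L0).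
  rewrite chart_tE//; apply: ler_wpM2r => //.
  by rewrite lerXn2r ?nnegrE.
rewrite normrM ger0_norm//.
have key (a b : 'rV[R]_n) : (forall i, `|a ord0 i| <= Lr) -> (forall i, `|b ord0 i| <= Lr) ->
    2 * `|dot a z.1.1 - dot b z.1.2| <= 4 * n%:R * (q * wnorm eta * Lr ^+ 2).
  move=> ha hb.
  have d1 := dot_le ha zx; have d2 := dot_le hb zy.
  have := ler_normB (dot a z.1.1) (dot b z.1.2).
  have -> : 4 * n%:R * (q * wnorm eta * Lr ^+ 2) = 2 * (n%:R * (Lr * (q * wnorm eta * Lr)) + n%:R * (Lr * (q * wnorm eta * Lr))) by ring.
  move=> h; rewrite ler_pM2l//; apply: (le_trans h); exact: lerD.
move: bx => /orP[|] /coord_box[h1 h2]; first exact: key.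
have -> : dot xi.1.2 z.1.1 - dot xi.1.1 z.1.2 =
    dot (displace xi eta).1.2 z.1.1 - dot (displace xi eta).1.1 z.1.2.
  rewrite (dotC _ z.1.1) (dotC _ z.1.2) (dotC (displace xi eta).1.2) (dotC (displace xi eta).1.1).
  rewrite /displace /heis_mul -/z [(_, _, _).1.2]/= [(_, _, _).1.1]/= !dotDr (dotC z.1.2 z.1.1); ring.
exact: key.
Qed.

Let ln_le : `|ln (height xi) - ln (height (displace xi eta))| / j <= q.
Proof.
rewrite height_displace lnM ?posrE// opprD addrA subrr add0r normrN /q invfM mulrA.
rewrite ler_wpM2r ?invr_ge0 ?(ltW j0)//.
rewrite ler0_norm; last by rewrite ln_le0// gerBl ltW.
rewrite -lnV ?posrE// -/tau.
have e : height eta / tau = tau^-1 - 1.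
  by rewrite /tau; field; rewrite gt_eqF// subr_gt0.
have := @le_ln1Dx R (tau^-1 - 1); have -> : 1 + (tau^-1 - 1) = tau^-1 by ring.
rewrite e; apply.
by rewrite ltrBrDr addNr invr_gt0.
Qed.

Definition displacement_const : R := 8 * (1 + m%:R + n%:R + 4 * n%:R).

(** Up to constants all coordinates move by at most q |(1, u, y)| times their
    scale, with q = sigma / ((1 - sigma) j), except t, where
    (q |(1, u, y)|)^2 |t| appears as well.  This square is harmless: if
    q |(1, u, y)| (1 + t^2)^(1 / 4) >= 1 the bound is trivial, as the cutoff is
    at most 1. *)
Lemma cut_displacement :
  `|cut_all j Lr xi - cut_all j Lr (displace xi eta)| <=
  displacement_const * (q * wnorm eta * (1 + eta.2 ^+ 2) `^ (1 / 4)).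
Proof.
set X := q * wnorm eta; set V := (_ `^ _).
have X0 : 0 <= X by rewrite mulr_ge0.
have V2 : V ^+ 2 = Num.sqrt (1 + eta.2 ^+ 2).
  rewrite /V -powR_mulrn ?powR_ge0// -powRrM -powR12_sqrt ?addr_ge0 ?sqr_ge0//.
  by congr (_ `^ _); field.
have V1 : 1 <= V.
  rewrite /V -[leLHS](powRr0 (1 + eta.2 ^+ 2)); apply: ler_powR => //.
  by rewrite lerDl sqr_ge0.
have vV : `|eta.2| <= V ^+ 2.
  by rewrite V2 -sqrtr_sqr ler_wsqrtr// lerDr.
have V0 : 0 <= V by exact: powR_ge0.
have c8 : 8 <= displacement_const.
  by rewrite /displacement_const; have := ler0n R m; have := ler0n R n; lra.
have h1 : `|cut_all j Lr xi - cut_all j Lr (displace xi eta)| <=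
   4 * ((1 + m%:R + n%:R + 4 * n%:R) * X + X ^+ 2 * `|eta.2|).
  apply: le_trans (cut_all_diff j0 L0 _ _) _; rewrite ler_pM2l//.
  have XL : A * wnorm eta / Lr <= X by rewrite ler_pdivrMr.
  have b1 : \sum_(i < m) `|xi.1.1 ord0 (lift ord0 i) - (displace xi eta).1.1 ord0 (lift ord0 i)| / Lr <= m%:R * X.
    rewrite mulr_natl -[X in _ <= X *+ _]/(X) -[m in X *+ m]card_ord -sumr_const.
    apply: ler_sum => i _; apply: le_trans XL; rewrite ler_wpM2r ?invr_ge0 ?(ltW L0)//.
    rewrite /displace /heis_mul [(_, _, _).1.1]/= mxE opprD addrA subrr add0r normrN; exact: chart_x_le.
  have b2 : \sum_(i < n) `|xi.1.2 ord0 i - (displace xi eta).1.2 ord0 i| / Lr <= n%:R * X.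
    rewrite mulr_natl -[n in X *+ n]card_ord -sumr_const.
    apply: ler_sum => i _; apply: le_trans XL; rewrite ler_wpM2r ?invr_ge0 ?(ltW L0)//.
    rewrite /displace /heis_mul [(_, _, _).1.2]/= mxE opprD addrA subrr add0r normrN; exact: chart_y_le.
  have b3 : `|xi.2 - (displace xi eta).2| / Lr ^+ 2 <= X ^+ 2 * `|eta.2| + 4 * n%:R * X.
    rewrite distrC ler_pdivrMr ?exprn_gt0//; apply: le_trans t_le _.
    by rewrite -/X le_eqVlt; apply/orP; left; apply/eqP; ring.
  have b0 : `|ln (height xi) - ln (height (displace xi eta))| / j <= X.
    by apply: le_trans ln_le _; rewrite ler_peMr// wnorm_ge1.
  have -> : (1 + m%:R + n%:R + 4 * n%:R) * X + X ^+ 2 * `|eta.2| =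
    X + (m%:R * X + n%:R * X + (X ^+ 2 * `|eta.2| + 4 * n%:R * X)) by ring.
  by apply: lerD => //; apply: lerD => //; exact: lerD.
(* when 1 <= X * V the bound exceeds 1 *)
have [XV|XV] := leP 1 (X * V).
  apply: (@le_trans _ _ 1).
    have /andP[a0 a1] := cut_all_unit j Lr xi; have /andP[b0 b1] := cut_all_unit j Lr (displace xi eta).
    by rewrite ler_norml; apply/andP; split; lra.
  apply: (le_trans XV); apply: ler_peMl; first exact: mulr_ge0.
  by apply: le_trans c8; rewrite ler1n.
apply: (le_trans h1).
have XXV : X <= X * V by rewrite ler_peMr.
have X2 : X ^+ 2 * `|eta.2| <= X * V.
  apply: (@le_trans _ _ ((X * V) ^+ 2)).
    by rewrite [leRHS]exprMn; apply: ler_wpM2l => //; exact: sqr_ge0.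
  by rewrite expr2; apply: ler_piMl; [exact: mulr_ge0|exact: ltW].
set c := 1 + m%:R + n%:R + 4 * n%:R.
have c1 : 1 <= c by rewrite /c; have := ler0n R m; have := ler0n R n; lra.
have -> : displacement_const = 8 * c by [].
nra.
Qed.

End displacement.
End pointwise.

(** * Slice energies of the test functions *)

Section energy.
Context {R : realType}.

(** Convexity of x^p at the points a / (1 - e) and b / e. *)
Lemma powR_split (p e a b : R) : 1 <= p -> 0 < e < 1 -> 0 <= a -> 0 <= b ->
  (a + b) `^ p <= (1 - e) `^ (1 - p) * a `^ p + e `^ (1 - p) * b `^ p.
Proof.
move=> p1 /andP[e0 e1] a0 b0.
have f0 : 0 < 1 - e by rewrite subr_gt0.
pose t : {i01 R} := Itv01 (ltW e0) (ltW e1).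
have := convex_powR p1 t (x := b / e) (y := a / (1 - e)).
rewrite !convRE /= => H.
have {}H : (e * (b / e) + (1 - e) * (a / (1 - e))) `^ p <=
   e * (b / e) `^ p + (1 - e) * (a / (1 - e)) `^ p.
  by apply: H; rewrite inE /= in_itv /= andbT divr_ge0// ltW.
have E1 : e * (b / e) + (1 - e) * (a / (1 - e)) = a + b.
  by field; rewrite !gt_eqF.
have E2 (x y : R) : 0 < x -> 0 <= y -> x * (y / x) `^ p = x `^ (1 - p) * y `^ p.
  move=> x0 y0; have [l <-] := expR_total x0.
  rewrite -expRN powRM ?expR_ge0// -!expRM mulrCA -expRD mulrC.
  by congr (expR _ * _); ring.
rewrite E1 in H; apply: (le_trans H).
by rewrite !E2// addrC.
Qed.

(** A number in [0, 1] may be raised to a smaller exponent before it is bounded;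
    this trades decay in the displacement for integrability at infinity. *)
Lemma powR_le_interp (D K p q : R) : 0 <= D <= 1 -> D <= K -> 0 <= q <= p ->
  0 < p -> D `^ p <= K `^ q.
Proof.
move=> /andP[D0 D1] DK /andP[q0 qp] p0.
move: D0; rewrite le_eqVlt => /predU1P[<-|D0].
  by rewrite powR0 ?gt_eqF// powR_ge0.
apply: (@le_trans _ _ (D `^ q)).
  by apply: ger_powR => //; rewrite D0.
by apply: ge0_ler_powR; rewrite ?nnegrE// ltW// (lt_le_trans D0).
Qed.

Variable m : nat.
Local Notation n := m.+1.
Local Notation rR := (measurableTypeR R).
Local Notation H := ('rV[rR]_n * 'rV[rR]_n * rR)%type.
Local Notation L := (@lebesgue_heis R n).

Variables s p alpha : R.
Let beta := s * p + alpha.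
Let gam := (beta - 1) / p.
Hypotheses (p1 : 1 < p) (beta1 : 1 < beta).
Variable q0 : R.
Hypotheses (q01 : 1 <= q0) (q0p : q0 <= p).
Let p0 : 0 < p. Proof. exact: lt_trans p1. Qed.

Variable j : R.
Hypothesis j1 : 1 <= j.
Let j0 : 0 < j. Proof. exact: lt_le_trans j1. Qed.
Let Lr := j * expR j.
Let Lr0 : 0 < Lr. Proof. by rewrite mulr_gt0 ?expR_gt0. Qed.
Let f : @heis R n -> R := test_fun gam j Lr.
Let Theta : @heis R n -> R := cut_all j Lr.
Let bx : @heis R n -> bool := boxb j Lr (Lr ^+ 2).
Let c3 : R := (2 * displacement_const m) `^ q0.

(** For small displacements the power q0 is needed for integrability at 0.  Near
    x = 1 only the first power of 1 / (1 - x) may be used, which stays integrable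
    against (1 - x)^(beta - 1). *)
Definition cutoff_growth (x : R) : R := if x <= 2^-1 then x `^ q0 else (1 - x)^-1.

Let cd8 : 8 <= @displacement_const R m.
Proof. by rewrite /displacement_const; have := ler0n R m; have := ler0n R m.+1; lra. Qed.

Lemma boxP xi : box j Lr xi -> bx xi.
Proof.
move=> [h1 h2 h3 h4]; rewrite /bx /boxb h1 h4 andbT /=; apply/andP; split.
  by apply/forallP => i; rewrite mxE; exact: h2.
by apply/forallP => i; exact: h3.
Qed.

Lemma Theta_out xi : 0 < height xi -> ~~ bx xi -> Theta xi = 0.
Proof.
move=> x0 nb; apply/eqP; apply: contraR nb => T0.
by apply: boxP; apply: cut_all_box.
Qed.

(** cut_displacement to the power q0 where height eta <= 1 / 2 and to the power 1
    elsewhere; since q0 >= 1 and j >= 1 both cases give the factor 1 / j.  The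
    indicators localize the estimate to the box. *)
Lemma cut_all_diff_powR xi eta : 0 < height xi -> 0 < height eta < 1 ->
  `|Theta xi - Theta (displace xi eta)| `^ p <=
  c3 / j * cutoff_growth (height eta) * (wnorm eta * (1 + eta.2 ^+ 2) `^ (1 / 4)) `^ q0 *
  ((bx xi)%:R + (bx (displace xi eta))%:R).
Proof.
move=> x0 /andP[s0 s1]; set tau := 1 - height eta.
have t0 : 0 < tau by rewrite subr_gt0.
set V := (1 + _) `^ _; set D := `| _ - _|.
have V1 : 1 <= V.
  rewrite /V -[leLHS](powRr0 (1 + eta.2 ^+ 2)); apply: ler_powR => //.
  by rewrite lerDl sqr_ge0.
have WV1 : 1 <= wnorm eta * V.
  by rewrite -[leLHS]mulr1 ler_pM// wnorm_ge1.
have WV0 : 0 <= wnorm eta * V by exact: le_trans WV1.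
have h0 : 0 <= cutoff_growth (height eta).
  by rewrite /cutoff_growth; case: ifP => _; [exact: powR_ge0|rewrite invr_ge0 ltW].
have [b|] := boolP (bx xi || bx (displace xi eta)); last first.
  rewrite negb_or => /andP[n1 n2].
  rewrite /D Theta_out// Theta_out//; last by rewrite height_displace mulr_gt0.
  rewrite subrr normr0 powR0 ?gt_eqF//.
  by rewrite !mulr_ge0 ?powR_ge0// ?invr_ge0 ?(ltW j0)// addr_ge0 ?ler0n.
apply: (@le_trans _ _ (c3 / j * cutoff_growth (height eta) * (wnorm eta * V) `^ q0)); last first.
  rewrite ler_peMr//; last by move: b; case: (bx xi); case: (bx _) => //= _; rewrite ?addr0 ?add0r ?lerDl.
  by rewrite !mulr_ge0 ?powR_ge0// ?invr_ge0 ?(ltW j0).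
have D01 : 0 <= D <= 1.
  rewrite normr_ge0 /=.
  have /andP[a0 a1] := cut_all_unit j Lr xi; have /andP[b0 b1] := cut_all_unit j Lr (displace xi eta).
  by rewrite /D ler_norml; apply/andP; split; rewrite /Theta; lra.
have DK : D <= displacement_const m * (height eta / (tau * j) * (wnorm eta * V)).
  have := cut_displacement j1 x0 s0 s1 b; rewrite -/D -/V -/tau.
  by rewrite -(mulrA (_ / _)).
have cd0 : 0 < displacement_const m :> R by exact: lt_le_trans cd8.
have jV1 : j^-1 <= 1 by rewrite invf_le1.
have jV0 : 0 <= j^-1 by rewrite invr_ge0 ltW.
have q00 : 0 <= q0 by exact: le_trans q01.
rewrite /cutoff_growth; case: ifP => sh.
  have DK2 : D <= (2 * displacement_const m) * (j^-1 * (height eta * (wnorm eta * V))).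
    apply: (le_trans DK).
    have -> : displacement_const m * (height eta / (tau * j) * (wnorm eta * V)) =
        tau^-1 * displacement_const m * (j^-1 * (height eta * (wnorm eta * V))).
      by field; rewrite !gt_eqF.
    apply: ler_wpM2r; first by apply: mulr_ge0 => //; apply: mulr_ge0 => //; exact: ltW.
    apply: ler_wpM2r; first exact: ltW.
    rewrite -[leRHS]invrK lef_pV2 ?posrE ?invr_gt0// /tau; lra.
  have qp : 0 <= q0 <= p by rewrite q00.
  apply: (le_trans (powR_le_interp D01 DK2 qp p0)).
  have B1 : 0 <= 2 * displacement_const m :> R by apply: mulr_ge0 => //; exact: ltW.
  have B3 : 0 <= height eta * (wnorm eta * V) by apply: mulr_ge0 => //; exact: ltW.
  rewrite (powRM _ B1 (mulr_ge0 jV0 B3)) (powRM _ jV0 B3) (powRM _ (ltW s0) WV0).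
  rewrite -/c3 -!mulrA; apply: ler_wpM2l; first exact: powR_ge0.
  apply: ler_wpM2r; first by apply: mulr_ge0; exact: powR_ge0.
  by apply: ge1r_powR => //; rewrite invr_gt0 j0.
have qp : 0 <= (1 : R) <= p by apply/andP; split; [exact: ler01|exact: ltW].
apply: (le_trans (powR_le_interp D01 DK qp p0)).
rewrite powRr1; last first.
  apply: mulr_ge0; first exact: ltW.
  by apply: mulr_ge0 => //; apply: divr_ge0; [exact: ltW|apply: mulr_ge0; exact: ltW].
have c3c : displacement_const m <= c3.
  apply: (@le_trans _ _ (2 * displacement_const m)); first by rewrite ler_peMl ?(ltW cd0)// ler1n.
  by apply: le1r_powR => //; have := cd8; lra.
have WVq : wnorm eta * V <= (wnorm eta * V) `^ q0 by exact: le1r_powR.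
have -> : displacement_const m * (height eta / (tau * j) * (wnorm eta * V)) =
    displacement_const m * (j^-1 * tau^-1) * (height eta * (wnorm eta * V)).
  by field; rewrite !gt_eqF.
have tV0 : 0 <= tau^-1 by rewrite invr_ge0 ltW.
rewrite -/tau -(mulrA c3); apply: ler_pM.
- by apply: mulr_ge0; [exact: ltW|exact: mulr_ge0].
- by apply: mulr_ge0 => //; exact: ltW.
- by apply: ler_wpM2r => //; exact: mulr_ge0.
- by apply: le_trans WVq; rewrite ler_piMl// ltW.
Qed.

Variable e : R.
Hypothesis e01 : 0 < e < 1.

(** The difference is (1 - tau^gam) X T + X tau^gam (T - T'), where X is the power
    of the height, T and T' the cutoffs and tau = 1 - height eta.  The first part
    is the homogeneous one, and powR_split makes its coefficient close to 1. *)
Lemma energy_density_le xi eta : 0 < height xi -> 0 < height eta < 1 ->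
  `|f xi - f (displace xi eta)| `^ p * height xi `^ (- beta) <=
  (1 - e) `^ (1 - p) * `|1 - (1 - height eta) `^ gam| `^ p * (`|f xi| `^ p * height xi `^ (- beta)) +
  e `^ (1 - p) * ((1 - height eta) `^ (beta - 1) *
    (c3 / j * cutoff_growth (height eta) * (wnorm eta * (1 + eta.2 ^+ 2) `^ (1 / 4)) `^ q0)) *
  ((bx xi)%:R * height xi `^ (- 1) + (bx (displace xi eta))%:R * height xi `^ (- 1)).
Proof.
move=> x0 s01; move: (s01) => /andP[s0 s1]; set tau := 1 - height eta.
have t0 : 0 < tau by rewrite subr_gt0.
have y0 : 0 < height (displace xi eta) by rewrite height_displace mulr_gt0.
have Tp := cut_all_diff_powR x0 s01.
rewrite /f !test_funE// -/Lr -/(Theta _) -/(Theta _).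
set K := c3 / j * _ * _ in Tp *.
set X := height xi `^ gam.
have X0 : 0 <= X by exact: powR_ge0.
have yE : height (displace xi eta) `^ gam = X * tau `^ gam by rewrite height_displace powRM ?ltW.
rewrite yE.
set T := Theta xi; set T' := Theta (displace xi eta).
have T0 : 0 <= T by have /andP[] := cut_all_unit j Lr xi.
have h1 : `|X * T - X * tau `^ gam * T'| <= `|1 - tau `^ gam| * `|X * T| + X * tau `^ gam * `|T - T'|.
  have -> : X * T - X * tau `^ gam * T' = (1 - tau `^ gam) * (X * T) + X * tau `^ gam * (T - T') by ring.
  apply: le_trans (ler_normD _ _) _.
  by rewrite !normrM (ger0_norm X0) (ger0_norm (powR_ge0 tau gam)).
have h2 : `|X * T - X * tau `^ gam * T'| `^ p <=
   (1 - e) `^ (1 - p) * (`|1 - tau `^ gam| * `|X * T|) `^ p +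
   e `^ (1 - p) * (X * tau `^ gam * `|T - T'|) `^ p.
  have A0 : 0 <= `|1 - tau `^ gam| * `|X * T| by rewrite mulr_ge0.
  have B0 : 0 <= X * tau `^ gam * `|T - T'| by rewrite !mulr_ge0// powR_ge0.
  apply: le_trans (powR_split (ltW p1) e01 A0 B0).
  by apply: ge0_ler_powR; rewrite ?nnegrE ?(ltW p0) ?addr_ge0.
have b0 : 0 <= height xi `^ (- beta) by exact: powR_ge0.
apply: (le_trans (ler_wpM2r b0 h2)).
rewrite mulrDl; apply: lerD.
  by rewrite powRM// -!mulrA.
rewrite (powRM _ (mulr_ge0 X0 (powR_ge0 _ _)) (normr_ge0 _)) (powRM _ X0 (powR_ge0 _ _)).
have XE : X `^ p * height xi `^ (- beta) = height xi `^ (- 1).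
  rewrite /X -powRrM /gam divfK ?gt_eqF// -powRD; last by rewrite (gt_eqF x0) implybT.
  by congr (_ `^ _); ring.
have tE : (tau `^ gam) `^ p = tau `^ (beta - 1) by rewrite -powRrM /gam divfK ?gt_eqF.
rewrite tE.
have -> : e `^ (1 - p) * (X `^ p * tau `^ (beta - 1) * `|T - T'| `^ p) * height xi `^ (- beta) =
   e `^ (1 - p) * tau `^ (beta - 1) * (X `^ p * height xi `^ (- beta)) * `|T - T'| `^ p by ring.
rewrite XE.
have -> : e `^ (1 - p) * (tau `^ (beta - 1) * K) *
  ((bx xi)%:R * height xi `^ (- 1) + (bx (displace xi eta))%:R * height xi `^ (- 1)) =
  e `^ (1 - p) * tau `^ (beta - 1) * height xi `^ (- 1) * (K * ((bx xi)%:R + (bx (displace xi eta))%:R)) by ring.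
by apply: ler_wpM2l => //; rewrite !mulr_ge0 ?powR_ge0.
Qed.

Lemma measurable_test_fun : measurable_fun [set: H] (f : H -> rR).
Proof.
apply: continuous_measurable_heis.
exact: (class_C_continuous (smooth_test_fun m gam Lr j0 0%N)).
Qed.

(** Mass of the box of the support for the density 1 / x_1 (integral_box). *)
Definition box_mass : R := 2 * j * (2 * Lr) ^+ m * (2 * Lr) ^+ n * (2 * Lr ^+ 2).

Lemma box_mass_gt0 : 0 < box_mass.
Proof.
have l2 : 0 < 2 * Lr by exact: mulr_gt0.
rewrite /box_mass; apply: mulr_gt0; last by apply: mulr_gt0 => //; exact: exprn_gt0.
by apply: mulr_gt0; [apply: mulr_gt0; [exact: mulr_gt0|]|]; try exact: exprn_gt0.
Qed.

Let wt (a l t : R) (xi : H) : \bar R := if boxb a l t xi then (height xi `^ (- 1))%:E else 0%E.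

Let wt0 a l t xi : (0 <= wt a l t xi)%E.
Proof. by rewrite /wt; case: ifP => // _; rewrite lee_fin powR_ge0. Qed.

Let mwt a l t : measurable_fun setT (wt a l t).
Proof.
apply: measurable_fun_ifT; [exact: measurable_box| |exact: measurable_cst].
apply/measurable_EFinP; apply: measR_powR; exact: (measurable_height (@measurable_id _ H setT)).
Qed.

Let bx_gt0 a l t (xi : H) : boxb a l t xi -> 0 < height xi.
Proof. by move=> /and4P[/andP[h _] _ _ _]; exact: lt_le_trans (expR_gt0 _) h. Qed.

Let int_box : (\int[L]_xi wt j Lr (Lr ^+ 2) xi = box_mass%:E)%E.
Proof. by rewrite integral_box// ?sqr_ge0// ltW. Qed.

Let hardy_density_test_fun (xi : H) : 0 < height xi ->
  hardy_density beta p f xi = (Theta xi `^ p * height xi `^ (- 1))%:E.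
Proof.
move=> x0; rewrite /hardy_density x0 /f test_funE// -/Lr -/(Theta _).
have /andP[T0 _] := cut_all_unit j Lr xi.
rewrite normrM !ger0_norm ?powR_ge0// powRM ?powR_ge0// -powRrM /gam divfK ?gt_eqF//.
congr EFin; rewrite mulrAC mulrC; congr (_ * _).
rewrite -powRD; last by rewrite (gt_eqF x0) implybT.
by congr (_ `^ _); ring.
Qed.

Let N := (\int[L]_xi hardy_density beta p f xi)%E.

Lemma test_fun_norm_le : (N <= box_mass%:E)%E.
Proof.
rewrite -int_box; apply: (ge0_le_integral L measurableT).
- by move=> xi _; exact: hardy_density_ge0.
- exact: (measurable_hardy_density _ measurable_test_fun).
- exact: mwt.
move=> xi _; have [x0|x0] := ltP 0 (height xi); last first.
  by rewrite /hardy_density ltNge x0 wt0.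
rewrite hardy_density_test_fun// /wt; case: ifP => b.
  have /andP[T0 T1] := cut_all_unit j Lr xi.
  rewrite lee_fin ler_piMl ?powR_ge0//.
  have h1 : (1 : R) `^ p = 1 by rewrite powR1.
  by rewrite -h1; apply: ge0_ler_powR; rewrite ?nnegrE// ltW.
rewrite Theta_out// ?powR0 ?mul0r ?gt_eqF//.
exact: negbT b.
Qed.

(** On the box of half the size in every coordinate the cutoff is at least
    chi_low^(2 n + 1); its mass is 2^(- (2 n + 1)) times box_mass. *)
Definition norm_ratio : R := ((@chi_low R) ^+ (1 + m + n + 1)) `^ p / 2 ^+ (1 + m + n + 1).

Lemma norm_ratio_gt0 : 0 < norm_ratio.
Proof. by rewrite divr_gt0 ?exprn_gt0// powR_gt0 ?exprn_gt0// expR_gt0. Qed.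

Lemma test_fun_norm_ge : ((norm_ratio * box_mass)%:E <= N)%E.
Proof.
(* the integrand is bounded below on the box of half the size *)
pose lp := ((@chi_low R) ^+ (1 + m + n + 1)) `^ p.
have lp0 : (0 <= lp%:E)%E by rewrite lee_fin powR_ge0.
have -> : (norm_ratio * box_mass)%:E = (lp%:E * \int[L]_xi wt (j / 2) (Lr / 2) (Lr ^+ 2 / 2) xi)%E.
  rewrite integral_box ?divr_ge0 ?sqr_ge0 ?(ltW Lr0)// ?divr_gt0//.
  have d2 (x : R) : 2 * (x / 2) = x by field.
  rewrite !d2 -EFinM /norm_ratio /box_mass -/lp; congr EFin.
  rewrite !exprMn !exprD !expr1; field.
  by rewrite ?expf_neq0// ?mulf_neq0// ?expf_neq0.
rewrite -(ge0_integralZl L measurableT (mwt _ _ _) (fun _ _ => wt0 _ _ _ _) lp0).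
apply: (ge0_le_integral L measurableT).
- by move=> xi _; apply: mule_ge0.
- by apply: emeasurable_funM; [exact: measurable_cst|exact: mwt].
- exact: (measurable_hardy_density _ measurable_test_fun).
move=> xi _; rewrite /wt; case: ifPn => b; last first.
  by rewrite mule0; exact: hardy_density_ge0.
have x0 := bx_gt0 b.
rewrite hardy_density_test_fun// -EFinM lee_fin ler_wpM2r ?powR_ge0//.
have lowT : (@chi_low R) ^+ (1 + m + n + 1) <= Theta xi.
  have c0 : 0 <= (@chi_low R) by exact: expR_ge0.
  have cd (x a : R) : 0 < a -> `|x| <= a / 2 -> (@chi_low R) <= chi (x / a).
    move=> a0 xa; apply: chi_ge_low.
    by rewrite normrM normfV (gtr0_norm a0) ler_pdivrMr// mulrC.
  move: b => /and4P[/andP[b1 b2] /forallP b3 /forallP b4 b5].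
  have -> : (@chi_low R) ^+ (1 + m + n + 1) =
      @chi_low R * ((@chi_low R) ^+ m * (@chi_low R) ^+ n * @chi_low R).
    by rewrite !exprD !expr1; ring.
  have cm0 k : 0 <= (@chi_low R) ^+ k by exact: exprn_ge0.
  rewrite /Theta /cut_all /cut_rest; apply: ler_pM => //.
  - by do 2 (apply: mulr_ge0 => //).
  - apply: cd => //; rewrite ler_norml.
    apply/andP; split; first by rewrite -[leLHS]expRK ler_ln ?posrE ?expR_gt0.
    by rewrite -[leRHS]expRK ler_ln ?posrE ?expR_gt0.
  apply: ler_pM => //; first exact: mulr_ge0.
    apply: ler_pM => //.
      rewrite -[X in _ ^+ X <= _]card_ord -prodr_const.
      apply: ler_prod => i _; rewrite c0 /=; apply: cd => //.
      by have := b3 i; rewrite mxE.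
    rewrite -[X in _ ^+ X <= _]card_ord -prodr_const.
    by apply: ler_prod => i _; rewrite c0 /=; apply: cd.
  by apply: cd => //; rewrite exprn_gt0.
apply: ge0_ler_powR => //; rewrite ?nnegrE ?(ltW p0)//.
  by rewrite exprn_ge0// expR_ge0.
by apply: le_trans lowT; rewrite exprn_ge0// expR_ge0.
Qed.

(** What remains of the cutoff term of energy_density_le after the integration
    in xi, except for the constants and the factor 1 / j. *)
Definition cutoff_error (eta : @heis R n) : R :=
  (1 - height eta) `^ (beta - 1) * cutoff_growth (height eta) *
  (wnorm eta * (1 + eta.2 ^+ 2) `^ (1 / 4)) `^ q0.

Lemma cutoff_error_ge0 eta : height eta < 1 -> 0 <= cutoff_error eta.
Proof.
move=> s1; rewrite /cutoff_error !mulr_ge0 ?powR_ge0// /cutoff_growth.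
by case: ifP => _; [exact: powR_ge0|rewrite invr_ge0 subr_ge0 ltW].
Qed.

(** energy_density_le is integrated in xi.  The indicator of the box at the
    displaced point has the same integral as the one at xi, because the density
    1 / x_1 is invariant (integral_hardy_density_displace with exponent 1). *)
Lemma slice_energy_le eta : 0 < height eta < 1 ->
  (slice_energy s p alpha f eta <=
   ((1 - e) `^ (1 - p) * `|1 - (1 - height eta) `^ gam| `^ p)%:E * N +
   (e `^ (1 - p) * (c3 / j) * cutoff_error eta)%:E * (2 * box_mass)%:E)%E.
Proof.
move=> s01; move: (s01) => /andP[s0 s1].
set A := _ * _ `^ p; set B := _ * cutoff_error eta.
have A0 : (0 <= A%:E)%E by rewrite lee_fin mulr_ge0 ?powR_ge0.
have B0 : (0 <= B%:E)%E.
  rewrite lee_fin /B mulr_ge0 ?cutoff_error_ge0// mulr_ge0 ?powR_ge0//.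
  by rewrite divr_ge0 ?powR_ge0 ?ltW.
(* the indicator as a function, to use the dilation formula for hardy_density *)
pose g (xi : @heis R n) : R := (bx xi)%:R.
have mg : measurable_fun [set: H] (g : H -> rR).
  rewrite (_ : g = fun xi => if bx xi then 1 else 0); last by apply/funext => xi; rewrite /g; case: (bx xi).
  by apply: measurable_fun_ifT; [exact: measurable_box|exact: measurable_cst|exact: measurable_cst].
have gp (b : bool) : `|b%:R : R| `^ p = b%:R.
  by case: b; rewrite ?normr1 ?powR1// normr0 powR0// gt_eqF.
have I1 : (\int[L]_xi hardy_density 1 p g xi = box_mass%:E)%E.
  rewrite -int_box; apply: eq_integral => xi _; rewrite /hardy_density /wt /g gp -/Lr -/(bx xi).
  have [b|b] := boolP (bx xi); first by rewrite (bx_gt0 b) mul1r.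
  by rewrite mul0r if_same.
have := integral_hardy_density_displace p mg 1 s1.
rewrite I1 subrr powRr0 mul1e => I2.
pose G2 (xi : H) : \bar R := if 0 < height xi then (`|g (displace xi eta)| `^ p * height xi `^ (- 1))%:E else 0%E.
have mG2 : measurable_fun setT G2.
  apply: measurable_fun_ifT; last exact: measurable_cst.
    by apply: measurable_lt; [exact: measurable_cst|exact: (measurable_height (@measurable_id _ H setT))].
  apply/measurable_EFinP; apply: measR_mul; apply: measR_powR.
    apply: measR_norm; apply: (measurableT_comp mg).
    by apply: measurable_displace; [exact: measurable_id|exact: measurable_cst].
  exact: (measurable_height (@measurable_id _ H setT)).
have G20 xi : (0 <= G2 xi)%E by rewrite /G2; case: ifP => // _; rewrite lee_fin mulr_ge0 ?powR_ge0.
have mh := measurable_hardy_density p mg 1.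
have h0 xi := hardy_density_ge0 p g 1 xi.
have mN := measurable_hardy_density p measurable_test_fun beta.
have N0 xi := hardy_density_ge0 p f beta xi.
have -> : (2 * box_mass)%:E = (\int[L]_xi (hardy_density 1 p g xi + G2 xi))%E.
  rewrite (ge0_integralD L measurableT (fun x _ => h0 x) mh (fun x _ => G20 x) mG2).
  by rewrite I1 /G2 I2 -EFinD; congr EFin; ring.
have mS := emeasurable_funD mh mG2.
have S0 xi : (0 <= hardy_density 1 p g xi + G2 xi)%E by exact: adde_ge0.
rewrite -(ge0_integralZl L measurableT mS (fun x _ => S0 x) B0).
rewrite -(ge0_integralZl L measurableT mN (fun x _ => N0 x) A0).
have mA := emeasurable_funM (measurable_cst (A%:E)) mN.
have mBS := emeasurable_funM (measurable_cst (B%:E)) mS.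
rewrite -(ge0_integralD L measurableT (fun x _ => mule_ge0 A0 (N0 x)) mA
  (fun x _ => mule_ge0 B0 (S0 x)) mBS).
apply: (ge0_le_integral L measurableT).
- by move=> xi _; case: ifP => // _; rewrite lee_fin mulr_ge0 ?powR_ge0.
- exact: (measurable_energy_density _ _ _ measurable_test_fun).
- exact: (emeasurable_funD mA mBS).
move=> xi _; rewrite /hardy_density /G2; case: ifP => x0; last by rewrite adde0 !mule0 adde0.
rewrite -[leRHS]/((A * (`|f xi| `^ p * height xi `^ (- beta)) +
  B * (`|g xi| `^ p * height xi `^ (- 1) + `|g (displace xi eta)| `^ p * height xi `^ (- 1)))%:E).
rewrite lee_fin !gp.
have := energy_density_le x0 s01.
rewrite -/beta -/gam -/Lr -/f -/(bx _) -/(bx _) => h.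
apply: (le_trans h); rewrite lerD2l /B /cutoff_error /g le_eqVlt; apply/orP; left; apply/eqP.
by rewrite -/c3; ring.
Qed.

End energy.

(** * Finiteness of the error *)

Section finite.
Context {R : realType}.
Local Notation rR := (measurableTypeR R).
Local Notation mu := (@lebesgue_measure R).

(** The integrand is at most 1 on ]0, 1] and r^(- 2 b) beyond. *)
Lemma integral_1Dsqr_lty (b : R) : 2^-1 < b ->
  (\int[mu]_(r in `]0%R, +oo[) ((1 + r ^+ 2) `^ (- b))%:E < +oo)%E.
Proof.
move=> b2; have b0 : 0 < b by lra.
pose c := 2 * b - 1; have c0 : 0 < c by rewrite /c; lra.
rewrite integral_mkcond.
pose I1 (r : R) : \bar R := if (0 < r) && (r <= 1) then 1%E else 0%E.
pose I2 (r : R) : \bar R := if 1 <= r then (r `^ (- c - 1))%:E else 0%E.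
have mid := @measurable_id _ rR setT.
have mI1 : measurable_fun setT (I1 : rR -> _).
  apply: measurable_fun_ifT; try exact: measurable_cst.
  apply: measurable_and; first by apply: measurable_lt; [exact: measurable_cst|exact: mid].
  by apply: measurable_fun_ler; [exact: mid|exact: measurable_cst].
have mI2 : measurable_fun setT (I2 : rR -> _).
  apply: measurable_fun_ifT; last exact: measurable_cst.
    by apply: measurable_fun_ler; [exact: measurable_cst|exact: mid].
  by apply/measurable_EFinP; exact: measR_powR.
have I10 r : (0 <= I1 r)%E by rewrite /I1; case: ifP.
have I20 r : (0 <= I2 r)%E by rewrite /I2; case: ifP => // _; rewrite lee_fin powR_ge0.
have i1 : (\int[mu]_r I1 r = 1)%E.
  rewrite (_ : I1 = EFin \o \1_(`]0%R, 1%R]%classic : set rR)); last first.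
    by apply/funext => x; rewrite /I1 /= indicE mem_setE in_itv /=; case: ifP.
  rewrite integral_indic//= setIT lebesgue_measure_itv /= lte_fin ltr01.
  by rewrite sube0.
have i2 : (\int[mu]_r I2 r = (c^-1)%:E)%E.
  rewrite -(integral_powR_neary c0) [RHS]integral_mkcond.
  by apply: eq_integral => x _; rewrite patchE mem_setE in_itv /= andbT.
apply: (@le_lt_trans _ _ (\int[mu]_r (I1 r + I2 r))%E); last first.
  rewrite (ge0_integralD mu measurableT (fun x _ => I10 x) mI1 (fun x _ => I20 x) mI2).
  by rewrite i1 i2 -EFinD ltry.
have mF : measurable_fun setT (fun r : rR => ((1 + r ^+ 2) `^ (- b))%:E).
  by apply/measurable_EFinP; exact: measurable_1Dsqr_powR.
apply: (ge0_le_integral mu measurableT).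
- by move=> r _; rewrite patchE; case: ifP => // _; rewrite lee_fin powR_ge0.
- apply/(measurable_restrictT _ (measurable_itv _)); exact: measurable_funTS.
- exact: emeasurable_funD.
move=> r _; rewrite patchE mem_setE in_itv /= andbT /I1.
case: ifP => r0; last by rewrite add0e.
have r1 : 1 <= 1 + r ^+ 2 by rewrite lerDl sqr_ge0.
have [rl|rl] := leP r 1; rewrite /=.
  apply: (@le_trans _ _ 1%E); last by rewrite leeDl.
  by rewrite lee_fin -[leRHS](powRr0 (1 + r ^+ 2)); apply: ler_powR => //; rewrite oppr_le0 ltW.
rewrite add0e /I2 (ltW rl) lee_fin !powRN /c.
have -> : - (2 * b - 1) - 1 = - (2 * b) by ring.
have V0 : 0 < 1 + r ^+ 2 by exact: lt_le_trans ltr01 r1.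
rewrite powRN lef_pV2 ?posrE ?powR_gt0//.
rewrite powRrM; apply: ge0_ler_powR; rewrite ?nnegrE ?powR_ge0//; first exact: ltW.
  exact: ltW.
by rewrite (powR_mulrn 2 (ltW r0)) lerDr.
Qed.

(** The unit ball lies in a cube. *)
Lemma sphere_area_lty k : (sphere_area R k < +oo)%E.
Proof.
rewrite /sphere_area /surface_measure; apply: lte_mul_pinfty => //.
have mi : measurable_fun setT (fun u : 'rV[rR]_k => if cube 1 u then 1 else 0 : \bar R)%E.
  apply: measurable_fun_ifT; try exact: measurable_cst.
  by apply: measurable_cube; exact: measurable_id.
have mc := @measurable_cone R k.
apply: (@le_lt_trans _ _ (\int[lebesgue_rV k]_u (if cube 1 u then 1 else 0))%E); last first.
  by rewrite integral_cube ?ler01// ltry.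
rewrite -[X in lebesgue_rV k X]setIT -(integral_indic _ measurableT mc).
apply: (ge0_le_integral (lebesgue_rV k) measurableT).
- by move=> x _; rewrite lee_fin.
- by apply/measurable_EFinP; exact: (measurable_indic mc).
- exact: mi.
move=> x _; rewrite indicE; case: ifPn => cx; first by rewrite lee_fin; case: (_ \in _).
rewrite memNset// coneE /= => /andP[_ d1].
move/negP: cx; apply; apply/forallP => i.
rewrite -sqrtr_sqr -[leRHS]sqrtr1; apply: ler_wsqrtr.
exact: le_trans (coord_le_dot _ _) d1.
Qed.

Lemma integral_01_powR (c : R) : 0 < c ->
  (\int[mu]_r (if ((0 < r) && (r <= 1))%R then (r `^ (c - 1))%:E else 0) < +oo)%E.
Proof.
move=> c0; apply: le_lt_trans (ltry c^-1); apply: le_trans (integral_powR_near0 c0).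
rewrite [leRHS]integral_mkcond le_eqVlt; apply/orP; left; apply/eqP.
by apply: eq_integral => r _; rewrite patchE mem_setE in_itv.
Qed.

Variable m : nat.
Local Notation n := m.+1.
Local Notation H := ('rV[rR]_n * 'rV[rR]_n * rR)%type.
Local Notation L := (@lebesgue_heis R n).
Variables s p alpha q0 : R.
Let beta := s * p + alpha.
Hypotheses (beta1 : 1 < beta) (bq : beta < q0) (qb : q0 < beta + 1) (qn : q0 < (n + n)%:R + s * p).

Let phi (x : R) : R := if (0 < x) && (x < 1) then
  x `^ (- (1 + beta)) * ((1 - x) `^ (beta - 1) * cutoff_growth q0 x) else 0.

Let mphi : measurable_fun setT (phi : rR -> rR).
Proof.
have mid := @measurable_id _ rR setT.
have m1 : measurable_fun setT (fun x : rR => 1 - x : rR) by apply: measR_sub; [exact: measurable_cst|exact: mid].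
apply: measurable_fun_ifT; last exact: measurable_cst.
  by apply: measurable_and; apply: measurable_lt; try exact: measurable_cst; exact: mid.
apply: measR_mul; first exact: measR_powR.
apply: measR_mul; first exact: measR_powR.
apply: measurable_fun_ifT; [|exact: measR_powR|exact: measR_inv].
by apply: measurable_fun_ler; [exact: mid|exact: measurable_cst].
Qed.

Let hfun_ge0 x : x < 1 -> 0 <= cutoff_growth q0 x.
Proof.
by move=> x1; rewrite /cutoff_growth; case: ifP => _; [exact: powR_ge0|rewrite invr_ge0 subr_ge0 ltW].
Qed.

Let phi0 x : 0 <= phi x.
Proof.
rewrite /phi; case: ifP => // /andP[x0 x1].
by rewrite !mulr_ge0 ?powR_ge0// hfun_ge0.
Qed.

(** At 0 the integrand is of order x^(q0 - beta - 1), at 1 of order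
    (1 - x)^(beta - 2). *)
Let iphi : (\int[mu]_x (phi x)%:E < +oo)%E.
Proof.
pose J c (r : R) : \bar R := if (0 < r) && (r <= 1) then (r `^ (c - 1))%:E else 0%E.
have mid := @measurable_id _ rR setT.
have mJ c : measurable_fun setT (J c : rR -> _).
  apply: measurable_fun_ifT; last exact: measurable_cst.
    apply: measurable_and; first by apply: measurable_lt; [exact: measurable_cst|exact: mid].
    by apply: measurable_fun_ler; [exact: mid|exact: measurable_cst].
  by apply/measurable_EFinP; exact: measR_powR.
have J0 c r : (0 <= J c r)%E by rewrite /J; case: ifP => // _; rewrite lee_fin powR_ge0.
have qb0 : 0 < q0 - beta by rewrite subr_gt0.
have b10 : 0 < beta - 1 by rewrite subr_gt0.
(* a bound for x^(- (1 + beta)) on x >= 1 / 2 *)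
pose k2 : R := (2^-1) `^ (- (1 + beta)).
have k20 : (0 <= k2%:E)%E by rewrite lee_fin powR_ge0.
pose J' (r : R) := J (beta - 1) (1 + - 1 * r).
have mJ' : measurable_fun setT (J' : rR -> _).
  exact: (measurableT_comp (mJ (beta - 1)) (measurable_affine (- 1) 1)).
have iJ' : (\int[mu]_x J' x < +oo)%E.
  have n1 : (- 1 : R) != 0 by rewrite oppr_eq0 oner_eq0.
  have := integral_01_powR b10; rewrite -/(J (beta - 1)).
  by rewrite (ge0_integral_affine 1 n1 (mJ _) (J0 _)) normrN1 mul1e.
have J'0 r : (0 <= J' r)%E by exact: J0.
apply: (@le_lt_trans _ _ (\int[mu]_x (J (q0 - beta)%R x + k2%:E * J' x))%E); last first.
  have mkJ := emeasurable_funM (measurable_cst k2%:E) mJ'.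
  rewrite (ge0_integralD mu measurableT (fun x _ => J0 _ x) (mJ _) (fun x _ => mule_ge0 k20 (J'0 x)) mkJ).
  apply: lte_add_pinfty; first exact: integral_01_powR.
  rewrite (ge0_integralZl mu measurableT mJ' (fun x _ => J'0 x) k20).
  by apply: lte_mul_pinfty.
apply: (ge0_le_integral mu measurableT).
- by move=> x _; rewrite lee_fin.
- exact/measurable_EFinP.
- apply: emeasurable_funD; first exact: mJ.
  exact: (emeasurable_funM (measurable_cst k2%:E) mJ').
move=> x _; rewrite /phi; case: ifP => [/andP[x0 x1]|_]; last first.
  by apply: adde_ge0 => //; exact: mule_ge0.
have y0 : 0 < 1 - x by lra.
have y1 : 1 - x <= 1 by lra.
rewrite /cutoff_growth; case: ifPn => xh.
  apply: (@le_trans _ _ (J (q0 - beta)%R x)); last by rewrite leeDl// mule_ge0.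
  rewrite /J x0 (ltW x1) /= lee_fin.
  have -> : x `^ (q0 - beta - 1) = x `^ (- (1 + beta)) * x `^ q0.
    rewrite -powRD; last by rewrite (gt_eqF x0) implybT.
    by congr (_ `^ _); ring.
  rewrite ler_wpM2l ?powR_ge0// ler_piMl ?powR_ge0//.
  have e : (1 : R) `^ (beta - 1) = 1 by rewrite powR1.
  by rewrite -[leRHS]e; apply: ge0_ler_powR; rewrite ?nnegrE// ltW.
apply: (@le_trans _ _ (k2%:E * J' x)%E); last by rewrite leeDr.
rewrite /J' /J mulN1r y0 y1 /= -EFinM lee_fin; apply: ler_pM.
- exact: powR_ge0.
- by rewrite mulr_ge0 ?powR_ge0// invr_ge0 ltW.
- rewrite /k2 !powRN lef_pV2 ?posrE ?powR_gt0//.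
  apply: ge0_ler_powR; rewrite ?nnegrE ?(ltW x0)//; first by lra.
  by rewrite ltW// ltNge.
- rewrite -powR_inv1 ?(ltW y0)// -powRD ?(gt_eqF y0) ?implybT//.
Qed.

(** Each variable uses one bound on q0: the height beta < q0, the horizontal
    variables q0 < beta + 1 and the vertical one q0 < 2 n + s p. *)
Lemma cutoff_error_integral_lty :
  (\int[L]_eta (if (0 < height eta)%R then
     (rho s p alpha eta)%:E * (if height eta < 1 then cutoff_error s p alpha q0 eta else 0)%:E else 0) < +oo)%E.
Proof.
pose a1 := ((n + n)%:R + beta - q0) / 2.
pose a2 := ((n + n)%:R + 2 + s * p - q0) / 4.
have a10 : 0 < a1.
  rewrite /a1 divr_gt0//; have n2 : 2 <= (n + n)%:R :> R by rewrite ler_nat addSn addnS.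
  by move: qb n2; move: beta (_ + _)%:R => b2 N2 ? ?; lra.
have -> : (\int[L]_eta (if (0 < height eta)%R then
     (rho s p alpha eta)%:E * (if height eta < 1 then cutoff_error s p alpha q0 eta else 0)%:E else 0) =
   \int[L]_eta (phi (height eta) * (wsqr eta) `^ (- a1) * (1 + eta.2 ^+ 2) `^ (- a2))%:E)%E.
  apply: eq_integral => eta _; rewrite /phi.
  case: ifP => x0 /=; last by rewrite !mul0r.
  case: ifP => x1; last by rewrite mule0 !mul0r.
  rewrite -EFinM; congr EFin; rewrite /rho /cutoff_error -/beta.
  have W0 : 0 < wsqr eta by exact: lt_le_trans (wsqr_ge1 _).
  have V0 : 0 < 1 + eta.2 ^+ 2 by rewrite ltr_pwDl// sqr_ge0.
  rewrite /wnorm -powR12_sqrt ?(ltW W0)// powRM ?powR_ge0// -!powRrM.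
  have -> : wsqr eta `^ (- a1) = wsqr eta `^ (- (((n + n)%:R + beta) / 2)) * wsqr eta `^ (2^-1 * q0).
    rewrite -powRD; last by rewrite (gt_eqF W0) implybT.
    by congr (_ `^ _); rewrite /a1; field.
  have -> : (1 + eta.2 ^+ 2) `^ (- a2) = (1 + eta.2 ^+ 2) `^ (- ((n + n)%:R + 2 + s * p) / 4) *
      (1 + eta.2 ^+ 2) `^ (1 / 4 * q0).
    rewrite -powRD; last by rewrite (gt_eqF V0) implybT.
    by congr (_ `^ _); rewrite /a2; field.
  ring.
have mb : measurable_fun setT (fun x : rR => x `^ (- a1) : rR) by apply: measR_powR; exact: measurable_id.
have mchi := @measurable_1Dsqr_powR R (- a2).
have b0 (x : rR) : 0 <= x `^ (- a1) by exact: powR_ge0.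
have chi0 (x : rR) : 0 <= (1 + x ^+ 2) `^ (- a2) by exact: powR_ge0.
rewrite (integral_separable m mphi mb mchi phi0 b0 chi0).
have a22 : 2^-1 < a2.
  by rewrite /a2; move: qn; move: (_ + _)%:R => N2 ?; lra.
have i3 : (\int[mu]_x ((1 + x ^+ 2) `^ (- a2))%:E < +oo)%E.
  have mE : measurable_fun setT (fun x : rR => ((1 + x ^+ 2) `^ (- a2))%:E) by exact/measurable_EFinP.
  rewrite (integral_even mE (fun _ => chi0 _)); last by move=> x; rewrite sqrrN.
  by apply: lte_mul_pinfty => //; exact: integral_1Dsqr_lty.
have i2 : (\int[lebesgue_rV (m + n)]_x ((1 + dot x x) `^ (- a1))%:E < +oo)%E.
  rewrite addnS (integral_radial (m + m) a10).
  have sf := sphere_area_lty (m + m).+1.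
  have s0 : (0 <= sphere_area R (m + m).+1)%E by rewrite /sphere_area /surface_measure mule_ge0// lee_fin.
  apply: lte_mul_pinfty => //; first by rewrite ge0_fin_numE.
  have b2 : 2^-1 < a1 - m%:R.
    rewrite /a1 (natrD _ n n) -(natr1 m); move: qb; move: beta m%:R => b2 M2 ?; lra.
  apply: le_lt_trans (integral_1Dsqr_lty b2).
  have mid := @measurable_id _ rR setT.
  apply: (ge0_le_integral mu (measurable_itv _)).
  - by move=> r; rewrite /= in_itv /= andbT => r0; rewrite lee_fin mulr_ge0 ?powR_ge0// exprn_ge0// ltW.
  - apply: measurable_funTS; apply/measurable_EFinP; apply: measR_mul; first exact: measR_exp.
    exact: measurable_1Dsqr_powR.
  - by apply: measurable_funTS; apply/measurable_EFinP; exact: measurable_1Dsqr_powR.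
  move=> r; rewrite /= in_itv /= andbT => r0; rewrite lee_fin.
  have V0 : 0 < 1 + r ^+ 2 by rewrite ltr_pwDl// sqr_ge0.
  have -> : (1 + r ^+ 2) `^ (- (a1 - m%:R)) = (1 + r ^+ 2) ^+ m * (1 + r ^+ 2) `^ (- a1).
    rewrite -(powR_mulrn m (ltW V0)) -powRD; last by rewrite (gt_eqF V0) implybT.
    by congr (_ `^ _); ring.
  rewrite ler_wpM2r ?powR_ge0// addnn -mul2n exprM lerXn2r ?nnegrE ?sqr_ge0 ?(ltW V0)//.
  by rewrite lerDr.
have f2 : (0 <= \int[lebesgue_rV (m + n)]_x ((1 + dot x x) `^ (- a1))%:E)%E.
  by apply: integral_ge0 => x _; rewrite lee_fin powR_ge0.
have f1 : (0 <= \int[mu]_x (phi x)%:E)%E by apply: integral_ge0 => x _; rewrite lee_fin.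
apply: lte_mul_pinfty => //; first exact: mule_ge0.
  by rewrite ge0_fin_numE; [apply: lte_mul_pinfty => //; rewrite ge0_fin_numE|exact: mule_ge0].
Qed.

End finite.

(** * The sharp constant *)

Section sharp.
Context {R : realType}.
Variable m : nat.
Local Notation n := m.+1.
Local Notation rR := (measurableTypeR R).
Local Notation mu := (@lebesgue_measure R).
Local Notation H := ('rV[rR]_n * 'rV[rR]_n * rR)%type.
Local Notation L := (@lebesgue_heis R n).
Variable n_gt0 : (0 < n)%N.
Variables s p alpha : R.
Let beta := s * p + alpha.
Let gam := (beta - 1) / p.
Hypotheses (p1 : 1 < p) (beta1 : 1 < beta).
Let p0 : 0 < p. Proof. exact: lt_trans p1. Qed.
Let pn0 : p != 0. Proof. by rewrite gt_eqF. Qed.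

Lemma x1_height (xi : @heis R n) : x1 n_gt0 xi = height xi.
Proof. by rewrite /x1 /height (_ : Ordinal n_gt0 = ord0)//; exact/val_inj. Qed.

Lemma hardy_weightedE (f : @heis R n -> R) :
  hardy_weighted n_gt0 s p alpha f = (\int[L]_xi hardy_density beta p f xi)%E.
Proof.
rewrite /hardy_weighted integral_mkcond; apply: eq_integral => xi _.
rewrite patchE /hardy_density x1_height.
have -> : (xi \in half_space n_gt0) = (0 < height xi).
  by apply/idP/idP; rewrite inE /half_space /= x1_height.
by case: ifP => // _; rewrite powRN.
Qed.

Lemma measurable_Cc (A : set (@heis R n)) f : Cc_infty A f ->
  measurable_fun [set: H] (f : H -> rR).
Proof. by case=> /(_ 0%N) fc _ _; exact: continuous_measurable_heis. Qed.

Lemma Cc_half_space0 (f : @heis R n -> R) xi :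
  Cc_infty (half_space n_gt0) f -> height xi <= 0 -> f xi = 0.
Proof.
case=> _ _ fh x0; apply/eqP/negP => /negP fx.
have := fh xi (@subset_closure _ [set x | f x != 0] xi fx).
by rewrite /half_space /= x1_height ltNge x0.
Qed.

Let phi0 (x : R) : R := if x < 1 then `|1 - (1 - x) `^ gam| `^ p else 1.

Let mphi0 : measurable_fun setT (phi0 : rR -> rR).
Proof.
have mid := @measurable_id _ rR setT.
apply: measurable_fun_ifT; last exact: measurable_cst.
  by apply: measurable_lt; [exact: mid|exact: measurable_cst].
apply: measR_powR; apply: measR_norm; apply: measR_sub; first exact: measurable_cst.
by apply: measR_powR; apply: measR_sub; [exact: measurable_cst|exact: mid].
Qed.

Let phi00 x : 0 <= phi0 x.
Proof. by rewrite /phi0; case: ifP => // _; exact: powR_ge0. Qed.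

Let CL : (C_const n s p alpha * Lambda_const s p alpha =
  2%:E * \int[L]_eta (if (0 < height eta)%R then (rho s p alpha eta)%:E * (phi0 (height eta))%:E else 0))%E.
Proof. by rewrite -(integral_Lambda beta1) (integral_rho m beta1 mphi0 phi00). Qed.

Let mrho_phi : measurable_fun [set: H] (fun eta : H =>
  (if (0 < height eta)%R then (rho s p alpha eta)%:E * (phi0 (height eta))%:E else 0)%E).
Proof.
have mid := @measurable_id _ H setT.
apply: measurable_fun_ifT; last exact: measurable_cst.
  by apply: measurable_lt; [exact: measurable_cst|exact: measurable_height].
apply: emeasurable_funM; apply/measurable_EFinP; first exact: measurable_rho.
exact: (measurableT_comp mphi0 (measurable_height mid)).
Qed.

Let rho_phi_ge0 (eta : H) :
  (0 <= if (0 < height eta)%R then (rho s p alpha eta)%:E * (phi0 (height eta))%:E else 0)%E.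
Proof.
case: ifP => // _; apply: mule_ge0; rewrite lee_fin; first exact: rho_ge0.
exact: phi00.
Qed.

Lemma hardy_const_ge :
  (C_const n s p alpha * Lambda_const s p alpha <= hardy_const n_gt0 s p alpha)%E.
Proof.
apply: le_ereal_inf_tmp => _ [f [fC fN] <-].
have mf := measurable_Cc fC.
have f0 xi : height xi <= 0 -> f xi = 0 by exact: Cc_half_space0.
move: fN; rewrite hardy_weightedE => fN.
have -> : gagliardo s p alpha f = (2%:E * \int[L]_eta (if (0 < height eta)%R then
   (rho s p alpha eta)%:E * slice_energy s p alpha f eta else 0))%E.
  exact: (integral_gagliardo s alpha mf f0 pn0).
rewrite CL; apply: lee_wpmul2l; first by rewrite lee_fin.
apply: (ge0_le_integral L measurableT).
- by move=> eta _; exact: rho_phi_ge0.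
- exact: mrho_phi.
- exact: measurable_rho_energy.
move=> eta _; case: ifP => // x0; apply: lee_wpmul2l.
  by rewrite lee_fin rho_ge0.
rewrite /phi0; case: ltP => x1; last by rewrite (slice_energy_ge1 s p alpha f0 x1) -/beta fN.
by apply: slice_energy_lt1 => //; rewrite x0.
Qed.

Variable q0 : R.
Hypotheses (q01 : 1 <= q0) (q0p : q0 <= p) (bq : beta < q0) (qb : q0 < beta + 1)
  (qn : q0 < (n + n)%:R + s * p).

Let err1 (eta : H) : R := if height eta < 1 then cutoff_error s p alpha q0 eta else 0.

Let err10 eta : 0 <= err1 eta.
Proof. by rewrite /err1; case: ifP => // x1; exact: cutoff_error_ge0. Qed.

Let rho_err (eta : H) : \bar R :=
  (if (0 < height eta)%R then (rho s p alpha eta)%:E * (err1 eta)%:E else 0)%E.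

Let rho_err_ge0 eta : (0 <= rho_err eta)%E.
Proof.
rewrite /rho_err; case: ifP => // _; apply: mule_ge0; rewrite lee_fin //; exact: rho_ge0.
Qed.

Let mrho_err : measurable_fun setT rho_err.
Proof.
have mid := @measurable_id _ H setT.
have mh := measurable_height mid.
have m1 : measurable_fun setT (fun eta : H => 1 - height eta : rR).
  by apply: measR_sub; [exact: measurable_cst|exact: mh].
apply: measurable_fun_ifT; last exact: measurable_cst.
  by apply: measurable_lt; [exact: measurable_cst|exact: mh].
apply: emeasurable_funM; apply/measurable_EFinP; first exact: measurable_rho.
apply: measurable_fun_ifT; last exact: measurable_cst.
  by apply: measurable_lt; [exact: mh|exact: measurable_cst].
apply: measR_mul.
  apply: measR_mul; first exact: measR_powR.
  apply: measurable_fun_ifT; [|exact: measR_powR|exact: measR_inv].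
  by apply: measurable_fun_ler; [exact: mh|exact: measurable_cst].
apply: measR_powR; apply: measR_mul; first by apply: measR_sqrt; exact: measurable_wsqr.
apply: measR_powR; apply: measR_add; first exact: measurable_cst.
exact: (measR_exp _ measurable_snd).
Qed.

Let M := (\int[L]_eta rho_err eta)%E.

Let M_lty : (M < +oo)%E.
Proof. exact: cutoff_error_integral_lty. Qed.

Lemma slice_energyZ (f : @heis R n -> R) (c : R) eta :
  measurable_fun [set: H] (f : H -> rR) -> 0 <= c ->
  slice_energy s p alpha (fun xi => c * f xi) eta = ((c `^ p)%:E * slice_energy s p alpha f eta)%E.
Proof.
move=> mf c0.
have c0p : (0 <= (c `^ p)%:E)%E by rewrite lee_fin powR_ge0.
have me := measurable_energy_density s p alpha mf eta.
rewrite /slice_energy -(ge0_integralZl L measurableT me _ c0p); last first.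
  by move=> xi _; case: ifP => // _; rewrite lee_fin mulr_ge0 ?powR_ge0.
apply: eq_integral => xi _; case: ifP => _; last by rewrite mule0.
by rewrite -EFinM -mulrBr normrM (ger0_norm c0) powRM// mulrA.
Qed.

Lemma integral_hardy_densityZ (f : @heis R n -> R) (c b : R) :
  measurable_fun [set: H] (f : H -> rR) -> 0 <= c ->
  (\int[L]_xi hardy_density b p (fun xi => (c * f xi)%R) xi =
   (c `^ p)%:E * \int[L]_xi hardy_density b p f xi)%E.
Proof.
move=> mf c0.
have c0p : (0 <= (c `^ p)%:E)%E by rewrite lee_fin powR_ge0.
rewrite -(ge0_integralZl L measurableT (measurable_hardy_density p mf b) (fun x _ => hardy_density_ge0 _ _ _ _) c0p).
apply: eq_integral => xi _; rewrite /hardy_density; case: ifP => _; last by rewrite mule0.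
by rewrite -EFinM normrM (ger0_norm c0) powRM// mulrA.
Qed.

(** The test function is divided by its weighted norm, whose p-th power lies
    between norm_ratio * box_mass and box_mass; so the mass of the box cancels
    from the error. *)
Lemma hardy_const_le_test_fun (e j : R) : 0 < e < 1 -> 1 <= j ->
  (hardy_const n_gt0 s p alpha <=
   ((1 - e) `^ (1 - p))%:E * (C_const n s p alpha * Lambda_const s p alpha) +
   (4 * (e `^ (1 - p) * ((2 * displacement_const m) `^ q0 / j)) / norm_ratio m p)%:E * M)%E.
Proof.
move=> e01 j1.
have j0 : 0 < j by exact: lt_le_trans j1.
have L0 : 0 < j * expR j by rewrite mulr_gt0// expR_gt0.
pose f : @heis R n -> R := test_fun gam j (j * expR j).
have mf : measurable_fun [set: H] (f : H -> rR) by exact: measurable_test_fun.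
have := test_fun_norm_le m s alpha p1 j1; have := test_fun_norm_ge m s alpha p1 j1.
rewrite -/beta -/gam -/f.
have cl0 := norm_ratio_gt0 m p; have V0 := box_mass_gt0 m j1.
case NE : (\int[L]_xi hardy_density beta p f xi)%E => [N| |] //; rewrite !lee_fin => Nlo Nhi.
have N0 : 0 < N by apply: lt_le_trans Nlo; exact: mulr_gt0.
(* c * f has weighted norm 1 *)
pose c := N `^ (- p^-1).
have c0 : 0 <= c by exact: powR_ge0.
have cp : c `^ p = N^-1 by rewrite /c -powRrM mulNr mulVf// powR_inv1// ltW.
pose g : @heis R n -> R := fun xi => c * f xi.
have gC : Cc_infty (half_space n_gt0) g by exact: test_fun_Cc.
have mg := measurable_Cc gC.
have g0 xi : height xi <= 0 -> g xi = 0 by exact: Cc_half_space0.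
have gN : (\int[L]_xi hardy_density beta p g xi = 1)%E.
  by rewrite (integral_hardy_densityZ _ mf c0) NE cp -EFinM mulVf// gt_eqF.
set K := (1 - e) `^ (1 - p); set k2 := e `^ (1 - p) * _.
have K1 : 1 <= K.
  rewrite /K; move: e01 => /andP[e0 e1].
  have f0 : 0 < 1 - e by rewrite subr_gt0.
  rewrite -(opprB p 1) powRN -[leLHS]invr1 lef_pV2 ?posrE ?powR_gt0//.
  have h : (1 : R) `^ (p - 1) = 1 by rewrite powR1.
  rewrite -[leRHS]h; apply: ge0_ler_powR; rewrite ?nnegrE ?subr_ge0 ?(ltW p1) ?(ltW e1)//.
  by rewrite gerBl ltW.
have K0 : 0 <= K by exact: powR_ge0.
have k20 : 0 <= k2 by rewrite mulr_ge0 ?powR_ge0// divr_ge0 ?powR_ge0 ?ltW.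
pose D := k2 * 2 / norm_ratio m p.
have D0 : 0 <= D := divr_ge0 (mulr_ge0 k20 (ler0n _ 2)) (ltW cl0).
have bound (eta : H) : 0 < height eta ->
  (slice_energy s p alpha g eta <= (K * phi0 (height eta) + D * err1 eta)%:E)%E.
  move=> x0; rewrite /phi0 /err1; case: ltP => x1; last first.
    by rewrite (slice_energy_ge1 s p alpha g0 x1) -/beta gN mulr1 mulr0 addr0 lee_fin.
  have s01 : 0 < height eta < 1 by rewrite x0.
  rewrite (slice_energyZ _ mf c0) cp.
  have Ni0 : (0 <= (N^-1)%:E)%E by rewrite lee_fin invr_ge0 ltW.
  apply: (le_trans (lee_wpmul2l Ni0 (slice_energy_le s alpha p1 q01 q0p j1 e01 s01))).
  rewrite -/beta -/gam -/f NE -/K -/k2 -!EFinM lee_fin.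
  set A := `|_| `^ p; set B := cutoff_error _ _ _ _ _.
  have B0 : 0 <= B by exact: cutoff_error_ge0.
  have -> : N^-1 * (K * A * N + k2 * B * (2 * box_mass m j)) = K * A + (box_mass m j / N) * (k2 * 2 * B).
    by field; rewrite gt_eqF.
  rewrite lerD2l.
  have -> : D * B = (norm_ratio m p)^-1 * (k2 * 2 * B) by rewrite /D; ring.
  apply: ler_wpM2r; first by do 2 apply: mulr_ge0 => //.
  by rewrite ler_pdivrMr// mulrC ler_pdivlMr// mulrC.
apply: (@le_trans _ _ (gagliardo s p alpha g)).
  by apply: ereal_inf_lbound; exists g => //; split => //; rewrite hardy_weightedE.
have -> : gagliardo s p alpha g = (2%:E * \int[L]_eta (if (0 < height eta)%R then
   (rho s p alpha eta)%:E * slice_energy s p alpha g eta else 0))%E.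
  exact: (integral_gagliardo s alpha mg g0 pn0).
have KE0 : (0 <= K%:E)%E by [].
have DE0 : (0 <= D%:E)%E by [].
rewrite CL muleCA.
have -> : ((4 * k2 / norm_ratio m p)%:E * M = 2%:E * (D%:E * M))%E.
  by rewrite muleA -EFinM; congr (_%:E * _)%E; rewrite /D; ring.
rewrite /M -(ge0_integralZl L measurableT (mrho_phi) (fun x _ => rho_phi_ge0 x) KE0).
rewrite -(ge0_integralZl L measurableT mrho_err (fun x _ => rho_err_ge0 x) DE0).
have m1 := emeasurable_funM (measurable_cst K%:E) (mrho_phi).
have m2 := emeasurable_funM (measurable_cst D%:E) mrho_err.
rewrite -ge0_muleDr; last 2 first.
- by apply: integral_ge0 => eta _; exact: mule_ge0.
- by apply: integral_ge0 => eta _; exact: mule_ge0.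
rewrite -(ge0_integralD L measurableT (fun x _ => mule_ge0 KE0 (rho_phi_ge0 x)) m1
  (fun x _ => mule_ge0 DE0 (rho_err_ge0 x)) m2).
apply: lee_wpmul2l; first by rewrite lee_fin.
apply: (ge0_le_integral L measurableT).
- move=> eta _; case: ifP => // _; apply: mule_ge0; last exact: slice_energy_ge0.
  by rewrite lee_fin rho_ge0.
- exact: measurable_rho_energy.
- exact: (emeasurable_funD m1 m2).
move=> eta _; rewrite /rho_err; case: ifP => x0; last by rewrite !mule0 adde0.
have r0 : (0 <= (rho s p alpha eta)%:E)%E by rewrite lee_fin rho_ge0.
apply: (le_trans (lee_wpmul2l r0 (bound _ x0))).
rewrite -!EFinM -EFinD lee_fin le_eqVlt; apply/orP; left; apply/eqP; ring.
Qed.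

(** j tends to infinity for fixed e, then e to 0.  The case of infinite constants
    is trivial. *)
Lemma hardy_const_le :
  (hardy_const n_gt0 s p alpha <= C_const n s p alpha * Lambda_const s p alpha)%E.
Proof.
have M0 : (0 <= M)%E by apply: integral_ge0 => eta _; exact: rho_err_ge0.
have cl0 := norm_ratio_gt0 m p.
have le_e e : 0 < e < 1 -> (hardy_const n_gt0 s p alpha <=
    ((1 - e) `^ (1 - p))%:E * (C_const n s p alpha * Lambda_const s p alpha))%E.
  move=> e01; apply/lee_addgt0Pr => d d0.
  have Mf : M \is a fin_num by rewrite ge0_fin_numE.
  pose k := 4 * (e `^ (1 - p) * (2 * displacement_const m) `^ q0) / norm_ratio m p * fine M.
  have k0 : 0 <= k.
    by apply: mulr_ge0; [rewrite divr_ge0 ?(ltW cl0)// !mulr_ge0// powR_ge0|exact: fine_ge0].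
  pose j := 1 + k / d.
  have kd0 : 0 <= k / d by rewrite divr_ge0// ltW.
  have j1 : 1 <= j by rewrite lerDl.
  have j0 : 0 < j by exact: lt_le_trans j1.
  apply: (le_trans (hardy_const_le_test_fun e01 j1)); rewrite leeD2l//.
  rewrite -[M]fineK// -EFinM lee_fin.
  have -> : 4 * (e `^ (1 - p) * ((2 * displacement_const m) `^ q0 / j)) / norm_ratio m p * fine M = k / j.
    by rewrite /k; field; rewrite !gt_eqF.
  by rewrite ler_pdivrMr// /j mulrDr mulr1 mulrCA divff ?gt_eqF// mulr1 lerDr ltW.
have CL0 : (0 <= C_const n s p alpha * Lambda_const s p alpha)%E.
  by rewrite CL; apply: mule_ge0 => //; apply: integral_ge0 => eta _; exact: rho_phi_ge0.
have [->|Cf] := eqVneq (C_const n s p alpha * Lambda_const s p alpha)%E +oo%E; first exact: leey.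
move: CL0 Cf le_e.
case: (C_const n s p alpha * Lambda_const s p alpha)%E => [r||] //; rewrite lee_fin => r0 _ le_e.
apply/lee_addgt0Pr => d d0.
pose t := d / (r + 1).
have r10 : 0 < r + 1 by rewrite ltr_wpDl.
have t0 : 0 < t by exact: divr_gt0.
have t10 : 0 < 1 + t by rewrite ltr_wpDl.
(* chosen so that (1 - e) `^ (1 - p) = 1 + t *)
pose e := 1 - (1 + t) `^ (- (p - 1)^-1).
have p10 : 0 < p - 1 by rewrite subr_gt0.
have e01 : 0 < e < 1.
  rewrite /e subr_gt0 gtrBl powR_gt0// andbT powRN invf_lt1 ?powR_gt0//.
  have h : (1 : R) `^ (p - 1)^-1 = 1 by rewrite powR1.
  rewrite -[ltLHS]h; apply: gt0_ltr_powR; rewrite ?invr_gt0 ?nnegrE ?(ltW t10)//.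
  by rewrite ltrDl.
apply: (le_trans (le_e e e01)).
have -> : 1 - e = (1 + t) `^ (- (p - 1)^-1) by rewrite /e; ring.
rewrite -powRrM.
have -> : - (p - 1)^-1 * (1 - p) = 1 by field; rewrite gt_eqF.
rewrite powRr1 ?(ltW t10)// -EFinM -EFinD lee_fin mulrDl mul1r lerD2l.
rewrite /t mulrAC ler_pdivrMr// ler_wpM2l ?(ltW d0)//.
by rewrite lerDl.
Qed.

End sharp.

Unset Implicit Arguments.

Theorem theorem1p3 (R : realType) (n : nat) (n_gt0 : (0 < n)%N)
    (p s alpha : R) :
  1 < p -> 0 < s < 1 ->
  0 <= alpha < Num.min ((hom_dim n)%:R - 2) (p * (1 - s)) ->
  1 < s * p + alpha ->
  hardy_const n_gt0 s p alpha = (C_const n s p alpha * Lambda_const s p alpha)%E.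
Proof.
case: n n_gt0 => [//|m] n_gt0 p1 /andP[s0 s1] /andP[a0].
rewrite lt_min => /andP[aQ ap] beta1.
have p0 : 0 < p by exact: lt_trans p1.
have bp : s * p + alpha < p by move: ap; rewrite mulrBr mulr1; lra.
have {}aQ : alpha < (m.+1 + m.+1)%:R.
  by move: aQ; rewrite /hom_dim natrD addrK mul2n addnn.
(* the minimum of the upper bounds for q0, which is taken halfway between beta and it *)
pose q := Num.min (Num.min p (s * p + alpha + 1)) ((m.+1 + m.+1)%:R + s * p).
have bq : s * p + alpha < q by rewrite /q !lt_min bp ltrDl ltr01 addrC ltrD2r.
pose q0 := (s * p + alpha + q) / 2.
have [h1 h2] : s * p + alpha < q0 /\ q0 < q by rewrite /q0; split; lra.
move: h2; rewrite /q !lt_min => /andP[/andP[q0p qb] qn].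
have q01 : 1 <= q0 by exact: ltW (lt_trans beta1 h1).
apply/eqP; rewrite eq_le hardy_const_ge// andbT.
exact: (hardy_const_le n_gt0 p1 beta1 q01 (ltW q0p) h1 qb qn).
Qed.
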